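(* Let $M\subset\mathbb{R}^3$ be a bounded convex domain with smooth boundary $\partial M$, and let $\lambda,\mu,\rho,\nu_1,\nu_2,\nu_3,\nu_4$ be real constants with $\rho>0$, $\lambda+2\mu>0$, $$3(\nu_1+\nu_2)+2(1+\nu_3+\nu_4)\neq 0\quad\text{and}\quad 1+\nu_3+\nu_4\neq 0 .$$ Put $v_p=\sqrt{(\lambda+2\mu)/\rho}$. For a residual stress field $R$ on $M$ (extended by zero to $\mathbb{R}^3\setminus M$) and a straight line $\gamma$ of $\mathbb{R}^3$ parameterized by Euclidean arc length $\tau$, let $$D_R(\gamma)=\int_{\gamma}\frac{1}{\rho v_p^4}\Big((1+\nu_3+\nu_4)R_{jk}\dot\gamma^j\dot\gamma^k+\frac12(\nu_1+\nu_2)\,\mathrm{tr}\,R\Big)\,d\tau .$$ Then the following two conditions are equivalent: (i) every residual stress field $R$ on $M$ is uniquely determined by the data $D_R(\gamma)$ known for all lines $\gamma$ of $\mathbb{R}^3$ (that is, if two residual stress fields $R,R'$ on $M$ satisfy $D_R(\gamma)=D_{R'}(\gamma)$ for all lines $\gamma$, then $R=R'$); (ii) $\nu_1+\nu_2+\nu_3+\nu_4\neq -1$.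
   Context: A residual stress field on $M$ is a smooth (up to the boundary) symmetric tensor field $R=(R_{jk})$, $R_{jk}=R_{kj}$, on the closure of $M$ satisfying the equilibrium equation $\mathrm{div}\,R=0$ in $M$, i.e. $\sum_k\partial_kR_{jk}=0$ for each $j$ in Cartesian coordinates, and the traction-free boundary condition $RN=0$ on $\partial M$, where $N$ is the normal to $\partial M$. Here $\mathrm{tr}\,R=\sum_jR_{jj}$ is the Euclidean trace, $\dot\gamma=d\gamma/d\tau$, and summation over repeated indices is understood. *)

(* Defs.v *)
From HB Require Import structures.
From mathcomp Require Import all_boot all_order all_algebra.
From mathcomp Require Import all_classical all_reals all_analysis.

Set Implicit Arguments.
Unset Strict Implicit.
Unset Printing Implicit Defensive.
Import Order.TTheory GRing.Theory Num.Theory.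
Import numFieldNormedType.Exports.
Local Open Scope classical_set_scope.
Local Open Scope ring_scope.

(* Points, directions and normals are row vectors.  The norm that the library
   puts on 'rV[R]_3 is the sup norm: it gives the usual topology, bounded sets
   and derivatives, but Euclidean lengths have to be taken with [enorm]. *)
Definition enorm (R : realType) (v : 'rV[R]_3) : R :=
  Num.sqrt (\sum_j v 0 j ^+ 2).

Definition partial (R : realType) (i : 'I_3) (f : 'rV[R]_3 -> R) :
  'rV[R]_3 -> R := fun x => 'D_(delta_mx 0 i) f x.

Definition gradient (R : realType) (f : 'rV[R]_3 -> R) (x : 'rV[R]_3) :
  'rV[R]_3 := \row_i partial i f x.

(* Infinite differentiability on an open set U: every iterated partial
   derivative [d_(i_1) (d_(i_2) (... f))] is Frechet differentiable on U. *)
Definition smooth_on (R : realType) (U : set 'rV[R]_3) (f : 'rV[R]_3 -> R) :=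
  forall (s : seq 'I_3) (x : 'rV[R]_3), U x ->
    differentiable (foldr (@partial R) f s) x.

(* f is smooth up to the boundary of M: on the closure of M it coincides with
   a smooth function on the whole space. *)
Definition smooth_upto_boundary (R : realType) (M : set 'rV[R]_3)
    (f : 'rV[R]_3 -> R) :=
  exists2 g : 'rV[R]_3 -> R, smooth_on setT g &
    forall x, closure M x -> f x = g x.

Definition is_domain (R : realType) (M : set 'rV[R]_3) :=
  [/\ open M, M !=set0 & connected M].

Definition boundary (R : realType) (M : set 'rV[R]_3) : set 'rV[R]_3 :=
  closure M `\` interior M.

Definition local_defining_function (R : realType) (M : set 'rV[R]_3)
    (p : 'rV[R]_3) (U : set 'rV[R]_3) (psi : 'rV[R]_3 -> R) :=
  [/\ open U, U p, smooth_on U psi,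
      forall x, U x -> gradient psi x != 0 &
      forall x, U x -> (M x <-> psi x < 0)].

Definition smooth_boundary (R : realType) (M : set 'rV[R]_3) :=
  forall p, boundary M p -> exists U psi, local_defining_function M p U psi.

(* The gradient points towards the exterior {psi > 0}, so N is the outward
   unit normal at p; it does not depend on the choice of U and psi. *)
Definition unit_normal (R : realType) (M : set 'rV[R]_3) (p N : 'rV[R]_3) :=
  exists U psi, local_defining_function M p U psi /\
    N = (enorm (gradient psi p))^-1 *: gradient psi p.

(* Only the values of S on the closure of M matter. *)
Definition residual_stress (R : realType) (M : set 'rV[R]_3)
    (S : 'rV[R]_3 -> 'M[R]_3) :=
  [/\ forall j k, smooth_upto_boundary M (fun x => S x j k),
      forall x, closure M x -> forall j k, S x j k = S x k j,
      forall x, M x -> forall j, \sum_k partial k (fun y => S y j k) x = 0 &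
      forall p N, boundary M p -> unit_normal M p N ->
        forall j, \sum_k S p j k * N 0 k = 0].

Definition vp (R : realType) (lambda mu rho : R) : R :=
  Num.sqrt ((lambda + 2 * mu) / rho).

Definition DR_integrand (R : realType) (lambda mu rho nu1 nu2 nu3 nu4 : R)
    (A : 'M[R]_3) (w : 'rV[R]_3) : R :=
  (rho * vp lambda mu rho ^+ 4)^-1 *
  ((1 + nu3 + nu4) * (\sum_j \sum_k A j k * w 0 j * w 0 k)
   + 2^-1 * (nu1 + nu2) * \tr A).

(* The line is tau |-> x + tau *: w, with enorm w = 1 for arc length;
   [patch (fun=> 0) M S] is the extension of S by zero outside M. *)
Definition DR (R : realType) (M : set 'rV[R]_3)
    (lambda mu rho nu1 nu2 nu3 nu4 : R) (S : 'rV[R]_3 -> 'M[R]_3)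
    (x w : 'rV[R]_3) : R :=
  Rintegral (@lebesgue_measure R) setT (fun tau : R =>
    DR_integrand lambda mu rho nu1 nu2 nu3 nu4
      (patch (fun=> 0) M S (x + tau *: w)) w).

(* Main.v *)
Require Import Defs.
From HB Require Import structures.
From mathcomp Require Import all_boot all_order all_algebra.
From mathcomp Require Import all_classical all_reals all_analysis.
From mathcomp Require Import measurable_realfun ring lra.
Import Order.TTheory GRing.Theory Num.Theory.
Import numFieldNormedType.Exports.
Set Implicit Arguments.
Unset Strict Implicit.
Unset Printing Implicit Defensive.
Local Open Scope classical_set_scope.
Local Open Scope ring_scope.

(* Put a = 1 + nu3 + nu4 and b = (nu1 + nu2) / 2, so that the data are the line
   integrals of a S(w,w) + b tr S and condition (ii) reads a + 2 b <> 0.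

   If a + 2 b <> 0, let m be the tensor of the moments of S against
   (xi . x)^n, S being extended by zero.  By Fubini along the lines of
   direction w orthogonal to xi, vanishing data give a m(w,w) + b |w|^2 tr m = 0.
   The divergence theorem, where the traction-free condition removes the
   boundary term, gives m xi = 0.  Taking the trace over the plane orthogonal to
   xi yields (a + 2 b) tr m = 0, hence m = 0.  So all the polynomial moments of S
   vanish, and S = 0 by testing against the polynomials (1 - |x - p|^2 / B)^n,
   which peak at p.

   The divergence theorem is proved without surface integrals: the field is
   multiplied by cutoffs that are functions of the Minkowski gauge of M, which is
   differentiable because the boundary is smooth; as the field is tangential its
   scalar product with the gradient of the cutoffs stays bounded, and dominated
   convergence applies.

   If a + 2 b = 0, the field S = Hess phi - (Laplacian phi) 1 with phi a bump
   function supported in M is a residual stress for which a S(w,w) + b tr S is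
   the derivative along the line of a compactly supported function. *)

(** * Integration over space *)

(** Polynomial moments take the place of the Fourier transform: for a field of bounded support they
    are finite, and Fubini along lines then needs only translations and a shear. This is why xi is
    taken of the form (s, t, 1) and w of the form (1, c, d): the first coordinate parameterizes the
    line, a shear straightens it, and the forms s x0 + t x1 + x2 still yield all monomials as s and
    t vary. The factor a + 2 b arises because m annihilates xi, so that its whole trace lives on the
    plane orthogonal to xi; summing a m(w,w) + b tr m over an orthonormal pair w counts b twice.
    Once tr m = 0, a <> 0 kills m on that plane. In the divergence theorem the obstacle is that the
    n-th cutoff has a gradient of size n in a layer of width 1/n at the boundary. In general this
    produces the boundary flux; for a tangential field the component along that gradient is O(1/n)
    in the layer, which compensates exactly. *)

Section Measures.
Variable R : realType.

Definition cube1 (a : R) : set (measurableTypeR R) := `[- a, a]%classic.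

Lemma measurable_cube1 a : measurable (cube1 a).
Proof. exact: measurable_itv. Qed.

Lemma lebesgue_cube1 a : 0 <= a -> lebesgue_measure (cube1 a) = (2 * a)%:E.
Proof.
move=> a0; rewrite /cube1 lebesgue_measure_itv /= lte_fin.
case: ltP => [_|]; first by rewrite -EFinD; congr (_%:E); ring.
by move=> h; congr (_%:E); lra.
Qed.

Definition leb2 : set (measurableTypeR R * measurableTypeR R) -> \bar R :=
  (@lebesgue_measure R \x @lebesgue_measure R)%E.
HB.instance Definition _ := Measure.on leb2.

Lemma leb2_sigma_finite : sigma_finite setT leb2.
Proof.
exists (fun n : nat => cube1 n%:R `*` cube1 n%:R).
  apply/esym/seteqP; split=> // -[x y] _.
  have [n hn] : exists n : nat, `|x| <= n%:R /\ `|y| <= n%:R.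
    exists (Num.Def.trunc (Num.max `|x| `|y|)).+1.
    have /ltW := truncnS_gt (Num.max `|x| `|y|).
    by rewrite ge_max => /andP[].
  exists n => //; rewrite /cube1 /= !in_itv /= -!ler_norml; exact: hn.
move=> n; split.
  by apply: measurableX; exact: measurable_cube1.
rewrite /leb2 product_measure1E; try exact: measurable_cube1.
rewrite /=.
by rewrite !lebesgue_cube1 // -EFinM ltry.
Qed.

HB.instance Definition _ := Measure_isSigmaFinite.Build _ _ _ leb2
  leb2_sigma_finite.

Definition leb3 :
    set (measurableTypeR R * (measurableTypeR R * measurableTypeR R)) -> \bar R :=
  (@lebesgue_measure R \x leb2)%E.
HB.instance Definition _ := Measure.on leb3.

Lemma measurable_cube2 a : measurable (cube1 a `*` cube1 a).
Proof. by apply: measurableX; exact: measurable_cube1. Qed.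

Lemma leb2_cube a : (leb2 (cube1 a `*` cube1 a) < +oo)%E.
Proof.
rewrite /leb2 product_measure1E; try exact: measurable_cube1.
have [a0|a0] := leP 0 a; first by rewrite /= !lebesgue_cube1// -EFinM ltry.
by rewrite /cube1 set_itv_ge ?bnd_simp -?ltNge ?measure0 ?mule0//; lra.
Qed.

Definition cube3 a := cube1 a `*` (cube1 a `*` cube1 a).

Lemma measurable_cube3 a : measurable (cube3 a).
Proof. by apply: measurableX; [exact: measurable_cube1|exact: measurable_cube2]. Qed.

Lemma leb3_cube a : (leb3 (cube3 a) < +oo)%E.
Proof.
rewrite /leb3 product_measure1E; [|exact: measurable_cube1|exact: measurable_cube2].
rewrite lte_mul_pinfty ?leb2_cube//.
have [a0|a0] := leP 0 a; first by rewrite /= lebesgue_cube1//.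
by rewrite /cube1 set_itv_ge ?bnd_simp -?ltNge ?measure0//; lra.
Qed.

End Measures.

Section BoundedFiniteSupport.
Context d (T : measurableType d) (R : realType).
Variable mu : {measure set T -> \bar R}.
Implicit Types (E : set T) (C : R) (f : T -> R).

Definition bounded_on E C f := measurable_fun setT f /\
  forall x, `|f x| <= C /\ (~ E x -> f x = 0).

Lemma bounded_on_integrable E C f : measurable E -> (mu E < +oo)%E ->
  bounded_on E C f -> mu.-integrable setT (EFin \o f).
Proof.
move=> mE muE [mf fE].
have -> : EFin \o f = (EFin \o f) \_ E.
  apply/funext => x; rewrite /patch; case: ifPn => // /negP; rewrite inE => Ex.
  by rewrite /= (fE x).2.
apply/(integrable_mkcond _ mE).1/measurable_bounded_integrable => //.
  exact: measurable_funTS.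
exists C; split; first exact: num_real.
by move=> r Cr x _; rewrite /= (le_trans (fE x).1)// ltW.
Qed.


(** The approximants will be difference quotients or divergences of truncated fields, whose
    integrals vanish one by one. A common bound on a set of finite measure supplies the dominating
    function. *)
Lemma dominated_limit_integral0 E C (f_ : nat -> T -> R) f :
  measurable E -> (mu E < +oo)%E ->
  (forall n, bounded_on E C (f_ n)) ->
  (forall x, f_ n x @[n --> \oo] --> f x) ->
  (forall n, Rintegral mu setT (f_ n) = 0) -> Rintegral mu setT f = 0.
Proof.
move=> mE muE f_E f_f f_0.
have mf : measurable_fun setT f.
  apply/measurable_EFinP; apply: (emeasurable_fun_cvg (fun n x => (f_ n x)%:E)).
    by move=> n; apply/measurable_EFinP; exact: (f_E n).1.
  by move=> x _; apply: cvg_EFin; [exact: nearW|exact: f_f].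
have iE : mu.-integrable setT (EFin \o (fun x => `|C| * \1_E x)).
  apply: (@bounded_on_integrable E `|C|) => //; split.
    by apply: measurable_funM => //; exact: measurable_indic.
  move=> x; rewrite indicE; case: (boolP (x \in E)) => xE /=.
    by rewrite mulr1 normr_id; split=> // /(_ (set_mem xE)).
  by rewrite mulr0 normr0; split.
have f0 n : (\int[mu]_x (f_ n x)%:E = 0)%E.
  have fin : (\int[mu]_x (f_ n x)%:E)%E \is a fin_num.
    apply: integrable_fin_num => //.
    exact: (bounded_on_integrable mE muE (f_E n)).
  by rewrite -(fineK fin); congr (_%:E); exact: f_0.
have mf_ n : measurable_fun setT (fun x => (f_ n x)%:E).
  by apply/measurable_EFinP; exact: (f_E n).1.
have mfE : measurable_fun setT (EFin \o f) by exact/measurable_EFinP.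
have f_fE : {ae mu, forall x, setT x -> (fun n => (f_ n x)%:E) @ \oo --> (EFin \o f) x}.
  by apply: aeW => x _; apply: cvg_EFin; [exact: nearW|exact: f_f].
have [|_ _] := dominated_convergence measurableT mf_ mfE f_fE iE.
  apply: aeW => x n _; rewrite /= lee_fin indicE.
  have [fC f0'] := (f_E n).2 x.
  case: (boolP (x \in E)) => xE /=.
    by rewrite mulr1 (le_trans fC)// ler_norm.
  by rewrite mulr0 f0' ?normr0// => Ex; move/negP: xE; apply; rewrite inE.
rewrite (_ : [sequence _]_n = cst 0%E); last by apply/funext => n; rewrite /= f0.
by move=> /(cvg_lim (@ereal_hausdorff R)); rewrite lim_cst// /Rintegral => <-.
Qed.

End BoundedFiniteSupport.

Section RealFubini.
Context d1 d2 (T1 : measurableType d1) (T2 : measurableType d2) (R : realType).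
Variables (m1 : {sigma_finite_measure set T1 -> \bar R}).
Variables (m2 : {sigma_finite_measure set T2 -> \bar R}).
Variable f : T1 * T2 -> R.
Hypothesis fi : (m1 \x m2)%E.-integrable setT (EFin \o f).

(** Every section is asked to be integrable, not almost every one, so that [fine] can be cancelled
    pointwise in the iterated integral. *)
Lemma Rintegral_prod12 :
  (forall x, m2.-integrable setT (EFin \o (fun y => f (x, y)))) ->
  Rintegral (m1 \x m2)%E setT f =
  Rintegral m1 setT (fun x => Rintegral m2 setT (fun y => f (x, y))).
Proof.
move=> fx; rewrite /Rintegral -(integral12_prod_meas1 fi); congr fine.
apply: eq_integral => x _; rewrite /fubini_F /= fineK//.
exact: integrable_fin_num (fx x).
Qed.

Lemma Rintegral_prod21 :
  (forall y, m1.-integrable setT (EFin \o (fun x => f (x, y)))) ->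
  Rintegral (m1 \x m2)%E setT f =
  Rintegral m2 setT (fun y => Rintegral m1 setT (fun x => f (x, y))).
Proof.
move=> fx; rewrite /Rintegral -(integral21_prod_meas1 fi); congr fine.
apply: eq_integral => x _; rewrite /fubini_G /= fineK//.
exact: integrable_fin_num (fx x).
Qed.

End RealFubini.

(** * Affine substitutions on the real line *)

Section LineIntegrals.
Variable R : realType.
Notation leb := (@lebesgue_measure R).

Lemma measurable_affine (k c : R) : measurable_fun setT
  ((fun x => k * x + c) : measurableTypeR R -> measurableTypeR R).
Proof. by apply: measurable_funD => //; exact: measurable_funM. Qed.

Definition affine_image (k c : R) : {measure set (measurableTypeR R) -> \bar R} :=
  measure_function_pushforward__canonical__measure_function_Measure leb
    (measurable_affine k c).

(** By uniqueness of Lebesgue measure half-open intervals suffice: the preimage of one of length l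
    has length l / k, and the factor k restores it. *)
Lemma lebesgue_measure_affine (k c : R) (k0 : 0 <= k)
    (A : set (measurableTypeR R)) : 0 < k -> measurable A ->
  leb A = mscale (NngNum k0) (affine_image k c) A.
Proof.
move=> kp; apply: lebesgue_measure_unique => _ [[a b]] _ <-.
rewrite [RHS](_ : _ = k%:E * leb ((fun x => (k * x + c)%R) @^-1` `]a, b]%classic))%E; last by [].
rewrite (_ : _ @^-1` _ = `](a - c) / k, (b - c) / k]%classic); last first.
  apply/seteqP; split => x /=; rewrite !in_itv /=;
  by rewrite ltr_pdivrMr// ler_pdivlMr// ![x * k]mulrC ltrBlDr lerBrDr.
rewrite !lebesgue_measure_itv/= !lte_fin ltr_pM2r ?invr_gt0// ltrD2r.
case: ifPn => _; last by rewrite mule0.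
by rewrite -!EFinB -EFinM; congr (_%:E); field; rewrite gt_eqF.
Qed.

Lemma ge0_integral_affine (k c : R) (f : measurableTypeR R -> \bar R) : 0 < k ->
  measurable_fun setT f -> (forall x, 0 <= f x)%E ->
  (\int[leb]_x f x = k%:E * \int[leb]_x f (k * x + c)%R)%E.
Proof.
move=> kp mf f0; have k0 := ltW kp.
rewrite (@eq_measure_integral _ _ _ setT (mscale (NngNum k0) (affine_image k c))).
  rewrite ge0_integral_mscale//= ge0_integral_pushforward//.
  exact: measurable_affine.
by move=> A mA _; exact: (lebesgue_measure_affine c k0).
Qed.

(** The data are given for arc length; this passes to lines run through at the speed k. *)
Lemma integral_affine (k c : R) (f : measurableTypeR R -> R) : 0 < k ->
  leb.-integrable setT (EFin \o f) ->
  leb.-integrable setT (EFin \o (fun x => f (k * x + c))) ->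
  Rintegral leb setT f = k * Rintegral leb setT (fun x => f (k * x + c)).
Proof.
move=> kp fi fki; have mf := measurable_int _ fi.
have posE : (\int[leb]_x ((EFin \o f)^\+ x) =
    k%:E * \int[leb]_x ((EFin \o (fun x => f (k * x + c))%R)^\+ x))%E.
  rewrite (ge0_integral_affine c kp)//; last exact: measurable_funepos.
  by congr (_ * _)%E; apply: eq_integral => x _; rewrite !funeposE.
have negE : (\int[leb]_x ((EFin \o f)^\- x) =
    k%:E * \int[leb]_x ((EFin \o (fun x => f (k * x + c))%R)^\- x))%E.
  rewrite (ge0_integral_affine c kp)//; last exact: measurable_funeneg.
  by congr (_ * _)%E; apply: eq_integral => x _; rewrite !funenegE.
rewrite /Rintegral integralE [X in k * fine X]integralE.
rewrite [X in fine (X - _)]posE [X in fine (_ - X)]negE.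
have pfin := integrable_pos_fin_num measurableT fki.
have nfin := integrable_neg_fin_num measurableT fki.
move: pfin nfin; rewrite /=.
set X := (integral _ _ _); set Y := (integral _ _ _).
by move=> /fineK <- /fineK <-; rewrite -!EFinM -!EFinB /=; ring.
Qed.

Lemma lebesgue_measure_translate (c : R) (A : set (measurableTypeR R)) :
  measurable A -> leb ((fun x => x + c) @^-1` A) = leb A.
Proof.
move=> mA; rewrite [RHS](lebesgue_measure_affine c ler01 ltr01 mA).
rewrite [RHS](_ : _ = 1%:E * leb ((fun x => (1 * x + c)%R) @^-1` A))%E; last by [].
by rewrite mul1e; congr (leb _); apply/funext => x; rewrite /preimage/= mul1r.
Qed.

End LineIntegrals.

Section MeasurePreserving.
Local Open Scope ereal_scope.
Context d (T : measurableType d) (R : realType).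

Lemma Rintegral_measure_preserving (mu : {measure set T -> \bar R})
    (phi : T -> T) (f : T -> R) : measurable_fun setT phi ->
  (forall A, measurable A -> mu (phi @^-1` A) = mu A) ->
  measurable_fun setT f ->
  Rintegral mu setT (f \o phi) = Rintegral mu setT f.
Proof.
move=> mphi muphi mf.
have tr (g : T -> \bar R) : measurable_fun setT g -> (forall x, 0 <= g x) ->
    \int[mu]_x g (phi x) = \int[mu]_x g x.
  move=> mg g0.
  rewrite [RHS](@eq_measure_integral _ _ _ setT
      (measure_function_pushforward__canonical__measure_function_Measure mu mphi)).
    by rewrite -(ge0_integral_pushforward mphi mu measurableT mg)//.
  by move=> A mA _; exact/esym/muphi.
have mEf : measurable_fun setT (EFin \o f) by exact/measurable_EFinP.
rewrite /Rintegral integralE [in RHS]integralE; congr (fine (_ - _)).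
  rewrite -[RHS]tr//; last exact: measurable_funepos.
  by apply: eq_integral => x _; rewrite !funeposE.
rewrite -[RHS]tr//; last exact: measurable_funeneg.
by apply: eq_integral => x _; rewrite !funenegE.
Qed.

End MeasurePreserving.

Lemma product_measure_preserving d1 d2 (T1 : measurableType d1)
    (T2 : measurableType d2) (R : realType)
    (m1 : {sigma_finite_measure set T1 -> \bar R})
    (m2 : {sigma_finite_measure set T2 -> \bar R})
    (phi1 : T1 -> T1) (phi2 : T2 -> T2) :
  measurable_fun setT phi1 -> measurable_fun setT phi2 ->
  (forall A, measurable A -> m1 (phi1 @^-1` A) = m1 A) ->
  (forall A, measurable A -> m2 (phi2 @^-1` A) = m2 A) ->
  measurable_fun setT (fun z => (phi1 z.1, phi2 z.2)) /\
  (forall A, measurable A ->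
  (m1 \x m2)%E ((fun z => (phi1 z.1, phi2 z.2)) @^-1` A) = (m1 \x m2)%E A).
Proof.
move=> mphi1 mphi2 p1 p2.
have mphi : measurable_fun setT (fun z : T1 * T2 => (phi1 z.1, phi2 z.2)).
  apply/measurable_fun_pairP; split.
    exact: (measurableT_comp mphi1 measurable_fst).
  exact: (measurableT_comp mphi2 measurable_snd).
split=> // A mA; apply/esym.
apply: (@product_measure_unique _ _ _ _ _ m1 m2
  (measure_function_pushforward__canonical__measure_function_Measure _ mphi)) => //.
move=> B C mB mC; rewrite -(p1 _ mB) -(p2 _ mC).
rewrite -product_measure1E//.
  by rewrite -[X in measurable X]setTI; exact: mphi1.
by rewrite -[X in measurable X]setTI; exact: mphi2.
Qed.

(** * Integrals over three-space *)

Section SpaceIntegral.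
Variable R : realType.
Notation leb := (@lebesgue_measure R).
Notation T3 := (measurableTypeR R * (measurableTypeR R * measurableTypeR R))%type.
Implicit Types (f g : 'rV[R]_3 -> R) (x y v w : 'rV[R]_3).

Lemma rV_norm_le (n : nat) (e : R) (x : 'rV[R]_n) : 0 <= e ->
  (`|x| <= e) <-> (forall j, `|x 0 j| <= e).
Proof.
move=> e0; rewrite (_ : `|x| = mx_norm x)// mx_normrE; split=> [xe j|xe].
  by apply: le_trans xe; apply/bigmax_geP; right => /=; exists (0, j).
by apply/bigmax_leP; split=> //= -[i j] _; rewrite /= ord1.
Qed.

Lemma rV_coord_le (n : nat) (x : 'rV[R]_n) j : `|x 0 j| <= `|x|.
Proof. by apply: (rV_norm_le _ (normr_ge0 x)).1. Qed.

(* Integrals over ['rV[R]_3] are taken on nested pairs, which carry the product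
   measure. *)
Definition vec (z : T3) : 'rV[R]_3 := \row_i nth 0 [:: z.1; z.2.1; z.2.2] i.

Definition unvec (x : 'rV[R]_3) : T3 := (x 0 0, (x 0 1, x 0 2%:R)).

Lemma vecE z : (vec z 0 0 = z.1) * (vec z 0 1 = z.2.1) * (vec z 0 2%:R = z.2.2).
Proof. by rewrite !mxE. Qed.

Lemma rV3P x y : x 0 0 = y 0 0 -> x 0 1 = y 0 1 -> x 0 2%:R = y 0 2%:R -> x = y.
Proof.
move=> h0 h1 h2; apply/rowP => -[[|[|[|//]]] i].
- by rewrite (_ : Ordinal i = 0)//; exact/val_inj.
- by rewrite (_ : Ordinal i = 1)//; exact/val_inj.
- by rewrite (_ : Ordinal i = 2%:R)//; exact/val_inj.
Qed.

Lemma unvecK : cancel unvec vec.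
Proof. by move=> x; apply: rV3P; rewrite vecE. Qed.

Lemma vec_norm_le e z : 0 <= e ->
  (`|vec z| <= e) <-> [/\ `|z.1| <= e, `|z.2.1| <= e & `|z.2.2| <= e].
Proof.
move=> e0; split=> [/(rV_norm_le _ e0) h|[h0 h1 h2]].
  by split; rewrite -?(vecE z).
apply/(rV_norm_le _ e0) => -[[|[|[|//]]] i]; by rewrite mxE.
Qed.

(** The sigma-algebra is that of the product, whereas [open] refers to the sup norm. They meet
    because an open set is the union of the countably many boxes with rational centre and radius
    that it contains. *)
Lemma measurable_vec_open (U : set 'rV[R]_3) : open U ->
  measurable (vec @^-1` U).
Proof.
move=> oU.
pose box (q : rat * (rat * rat) * rat) : set T3 :=
  ball (ratr q.1.1 : R) (ratr q.2) `*`
  (ball (ratr q.1.2.1 : R) (ratr q.2) `*` ball (ratr q.1.2.2 : R) (ratr q.2)).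
have -> : vec @^-1` U =
    \bigcup_q (if `[< box q `<=` vec @^-1` U >] then box q else set0).
  apply/seteqP; split=> [z Uz|z [q _]]; last by case: asboolP => // + zq; exact.
  have /nbhs_ballP[e /= e0 eU] := open_nbhs_nbhs (conj oU Uz).
  (* The centre will lie within e / 4 of z, so a radius between e / 4 and e / 2 makes the box
     contain z and stay within 3 e / 4 of it. *)
  have /rat_in_itvoo[r] : e / 4 < e / 2 by lra.
  rewrite in_itv /= => /andP[r1 r2].
  have ap (t : R) : {q : rat | `|ratr q - t| < e / 4}.
    have /rat_in_itvoo/cid[q] : t - e / 4 < t + e / 4 by lra.
    by rewrite in_itv /= => tq; exists q; rewrite ltr_distl.
  have [q0 h0] := ap z.1; have [q1 h1] := ap z.2.1; have [q2 h2] := ap z.2.2.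
  exists (q0, (q1, q2), r) => //; case: asboolP => [_|[]].
    rewrite /box /= -!ball_normE /ball_ /=; do ![split] => /=;
    by apply: lt_trans r1.
  move=> y; rewrite /box /= -!ball_normE /ball_ /= => -[y0 [y1 y2]].
  apply: eU; rewrite -ball_normE /ball_ /=.
  have tr (a b c : R) : `|ratr r| < e/2 -> `|b - a| < e / 4 -> `|b - c| < ratr r -> `|a - c| <= 3/4 * e.
    move=> _ h h'; have := ler_distD b a c; rewrite (distrC a b).
    by move=> /le_trans; apply; lra.
  have r0 : `|ratr r : R| < e / 2 by rewrite gtr0_norm //; lra.
  apply: (@le_lt_trans _ _ (3 / 4 * e)); last by lra.
  have e1 : 0 <= 3 / 4 * e by lra.
  apply/(rV_norm_le _ e1) => -[[|[|[|//]]] i]; rewrite !mxE /=.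
  - exact: tr h0 y0.
  - exact: tr h1 y1.
  - exact: tr h2 y2.
apply: countable_bigcupT_measurable => // q; case: ifP => // _.
do ![apply: measurableX]; exact: measurable_ball.
Qed.

Lemma measurable_vec_continuous f : continuous f -> measurable_fun setT (f \o vec).
Proof.
move=> /continuousP cf; apply: (measurability _ (RGenOpens.measurableE R)).
move=> _ [_ [a [b ->] <-]]; rewrite setTI comp_preimage.
apply: measurable_vec_open; exact/cf/interval_open.
Qed.

(** Continuity is not asked, so that extensions by zero qualify. One constant bounds both the values
    and the support, which leaves a single quantity to track. *)
Definition bounded_support f := measurable_fun setT (f \o vec) /\
  exists A, forall x, `|f x| <= A /\ (A < `|x| -> f x = 0).

Definition vint f : R := Rintegral (@leb3 R) setT (f \o vec).

Lemma bounded_on_vec A C f : measurable_fun setT (f \o vec) -> 0 <= A ->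
  (forall x, `|f x| <= C /\ (A < `|x| -> f x = 0)) ->
  bounded_on (cube3 A) C (f \o vec).
Proof.
move=> mf A0 fA; split=> // z; split; first exact: (fA _).1.
move=> zA; apply: (fA _).2; rewrite ltNge; apply/negP => /(vec_norm_le _ A0)[*].
by apply: zA; rewrite /cube3 /cube1 /=; do ![split]; rewrite /= in_itv /= -ler_norml.
Qed.

Lemma bounded_support_on f : bounded_support f ->
  exists2 A, 0 <= A & bounded_on (cube3 A) A (f \o vec).
Proof.
move=> [mf [A fA]]; have A0 : 0 <= A by apply: le_trans (fA 0).1.
by exists A => //; exact: bounded_on_vec.
Qed.

Lemma bounded_support_integrable f : bounded_support f ->
  (@leb3 R).-integrable setT (EFin \o (f \o vec)).
Proof.
move=> /bounded_support_on[A A0]; apply: bounded_on_integrable.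
  exact: measurable_cube3.
exact: leb3_cube.
Qed.

End SpaceIntegral.

Section VintTheory.
Variable R : realType.
Notation leb := (@lebesgue_measure R).
Notation T3 := (measurableTypeR R * (measurableTypeR R * measurableTypeR R))%type.
Implicit Types (f g : 'rV[R]_3 -> R) (x y v w : 'rV[R]_3).

Lemma continuous_bounded_ball (n : nat) (g : 'rV[R]_n -> R) (A : R) :
  continuous g -> exists2 C, 0 <= C & forall x : 'rV[R]_n, `|x| <= A -> `|g x| <= C.
Proof.
move=> cg.
have /compact_bounded[C [_ hC]] : compact (g @` [set x : 'rV[R]_n | `|x| <= A]).
  apply: continuous_compact; first exact: continuous_subspaceT.
  apply: bounded_closed_compact.
    by exists A; split=> [|r Ar x /= xA]; [exact: num_real|rewrite (le_trans xA)// ltW].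
  rewrite (_ : mkset _ = (fun x : 'rV[R]_n => `|x|) @^-1` [set r | r <= A])//.
  apply: closed_comp; first by move=> x _; exact: norm_continuous.
  exact: closed_le.
exists (`|C| + 1) => [|x xA]; first by rewrite addr_ge0.
by apply: hC; [rewrite (le_lt_trans (ler_norm _))// ltrDl|exists x].
Qed.

Lemma bounded_supportD f g : bounded_support f -> bounded_support g ->
  bounded_support (fun x => f x + g x).
Proof.
move=> [mf [A fA]] [mg [B gB]]; split; first exact: measurable_funD mf mg.
have A0 : 0 <= A by apply: le_trans (fA 0).1.
have B0 : 0 <= B by apply: le_trans (gB 0).1.
exists (A + B) => x; split.
  by rewrite (le_trans (ler_normD _ _))// lerD ?(fA x).1 ?(gB x).1.
by move=> ABx; rewrite (fA x).2 ?(gB x).2 ?addr0//; apply: le_lt_trans ABx; lra.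
Qed.

Lemma bounded_supportM f g : bounded_support f -> continuous g ->
  bounded_support (fun x => f x * g x).
Proof.
move=> [mf [A fA]] cg; split.
  exact: (measurable_funM mf (measurable_vec_continuous cg)).
have A0 : 0 <= A by apply: le_trans (fA 0).1.
have [C C0 gC] := continuous_bounded_ball A cg.
have AC0 : 0 <= A * C by rewrite mulr_ge0.
exists (A + A * C) => x; split; last first.
  by move=> h; rewrite (fA x).2 ?mul0r//; apply: le_lt_trans h; lra.
have [xA|xA] := leP `|x| A; last by rewrite (fA x).2// mul0r normr0 addr_ge0.
rewrite normrM (@le_trans _ _ (A * C))//; last by lra.
by rewrite ler_pM// ?(fA x).1 ?gC.
Qed.

Lemma bounded_supportZ k f : bounded_support f ->
  bounded_support (fun x => k * f x).
Proof.
move=> bf; rewrite (_ : (fun x => _) = (fun x => f x * cst k x)).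
  by apply: bounded_supportM => //; exact: cst_continuous.
by apply/funext => x; rewrite mulrC.
Qed.

Lemma bounded_support0 : bounded_support (cst 0 : 'rV[R]_3 -> R).
Proof. by split; [exact: measurable_cst|exists 0 => x; rewrite normr0]. Qed.

Lemma bounded_supportB f g : bounded_support f -> bounded_support g ->
  bounded_support (fun x => f x - g x).
Proof.
move=> bf bg; have := bounded_supportD bf (bounded_supportZ (-1) bg).
by congr bounded_support; apply/funext => x; rewrite mulN1r.
Qed.

Lemma bounded_support_sum (I : Type) (r : seq I) (F : I -> 'rV[R]_3 -> R) :
  (forall i, bounded_support (F i)) -> bounded_support (fun x => \sum_(i <- r) F i x).
Proof.
move=> bF; elim: r => [|i r ih].
  by under eq_fun do rewrite big_nil; exact: bounded_support0.
by under eq_fun do rewrite big_cons; exact: bounded_supportD.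
Qed.

Lemma bounded_support_zero_ext (M : set 'rV[R]_3) g : open M -> bounded_set M ->
  continuous g -> bounded_support (fun x => g x * \1_M x).
Proof.
move=> oM [A [_ MA]] cg; split.
  have mM : measurable_fun setT (\1_(@vec R @^-1` M : set T3) : T3 -> R).
    by apply: measurable_indic; exact: measurable_vec_open.
  exact: (measurable_funM (measurable_vec_continuous cg) mM).
have M1 x : M x -> `|x| <= `|A| + 1.
  by move=> Mx; apply: MA => //; rewrite (le_lt_trans (ler_norm _))// ltrDl.
have [C C0 gC] := continuous_bounded_ball (`|A| + 1) cg.
exists (C + (`|A| + 1)) => x.
rewrite indicE; have [/set_mem/M1 xM|_] := boolP (x \in M).
  rewrite mulr1; split; first by have := gC _ xM; have := normr_ge0 A; lra.
  by move=> h; exfalso; lra.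
by rewrite mulr0 normr0; split=> //; have := normr_ge0 A; lra.
Qed.

Lemma vintD f g : bounded_support f -> bounded_support g ->
  vint (fun x => f x + g x) = vint f + vint g.
Proof. by move=> bf bg; apply: RintegralD => //; exact: bounded_support_integrable. Qed.

Lemma vintZ k f : bounded_support f -> vint (fun x => k * f x) = k * vint f.
Proof. by move=> bf; apply: RintegralZl => //; exact: bounded_support_integrable. Qed.

Lemma vintB f g : bounded_support f -> bounded_support g ->
  vint (fun x => f x - g x) = vint f - vint g.
Proof. by move=> bf bg; apply: RintegralB => //; exact: bounded_support_integrable. Qed.

Lemma vint0 : vint (fun=> 0 : R) = 0.
Proof.
rewrite -[RHS](mul0r (vint (cst 0 : 'rV[R]_3 -> R))) -vintZ; last exact: bounded_support0.
by congr vint; apply/funext => x; rewrite mul0r.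
Qed.

Lemma vint_sum (I : Type) (r : seq I) (F : I -> 'rV[R]_3 -> R) :
  (forall i, bounded_support (F i)) ->
  vint (fun x => \sum_(i <- r) F i x) = \sum_(i <- r) vint (F i).
Proof.
move=> bF; elim: r => [|i r ih].
  by under eq_fun do rewrite big_nil; rewrite vint0 big_nil.
under eq_fun do rewrite big_cons; rewrite vintD ?ih ?big_cons//.
exact: bounded_support_sum.
Qed.

Lemma translate2_preserving (c d : R) :
  measurable_fun setT (fun p : measurableTypeR R * measurableTypeR R =>
    (p.1 + c, p.2 + d) : measurableTypeR R * measurableTypeR R) /\
  (forall A, measurable A -> leb2 ((fun p => (p.1 + c, p.2 + d)) @^-1` A) = leb2 A).
Proof.
have m (b : R) : measurable_fun setT
    ((fun t => t + b) : measurableTypeR R -> measurableTypeR R).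
  exact: measurable_funD.
apply: (product_measure_preserving (m c) (m d)) => A mA;
exact: lebesgue_measure_translate.
Qed.

Lemma vint_translate v f : measurable_fun setT (f \o @vec R) ->
  vint (fun x => f (x + v)) = vint f.
Proof.
move=> mf.
have m (b : R) : measurable_fun setT
    ((fun t => t + b) : measurableTypeR R -> measurableTypeR R).
  exact: measurable_funD.
have [mt pt] := translate2_preserving (v 0 1) (v 0 2%:R).
have [mphi pphi] := product_measure_preserving
   (m1 := leb) (m2 := @leb2 R) (m (v 0 0)) mt
   (fun A mA => lebesgue_measure_translate (v 0 0) mA) pt.
rewrite /vint -[RHS](Rintegral_measure_preserving mphi pphi mf).
congr Rintegral; apply/funext => z /=; congr f; apply: rV3P;
by rewrite mxE !vecE.
Qed.

Lemma vint_dominated0 (A : R) (f_ : nat -> 'rV[R]_3 -> R) f :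
  (forall n, measurable_fun setT (f_ n \o @vec R)) ->
  (forall n x, `|f_ n x| <= A /\ (A < `|x| -> f_ n x = 0)) ->
  (forall x, f_ n x @[n --> \oo] --> f x) ->
  (forall n, vint (f_ n) = 0) -> vint f = 0.
Proof.
move=> mf_ f_A f_f f_0; have A0 : 0 <= A by apply: le_trans (f_A 0 0).1.
apply: (@dominated_limit_integral0 _ _ _ (@leb3 R) (cube3 A) A (fun n => f_ n \o @vec R)) => //.
- exact: measurable_cube3.
- exact: leb3_cube.
- by move=> n; exact: bounded_on_vec.
- by move=> z; exact: f_f.
Qed.

(** For a fixed first coordinate the shear [sh] translates the other two, so it preserves the
    integral. Integrating in the opposite order, the first coordinate becomes the inner variable,
    and since w has first coordinate 1 the inner integral runs along the line through (0, p) with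
    direction w. *)
Lemma vint_shear w f : bounded_support f -> w 0 0 = 1 ->
  (forall x, Rintegral leb setT (fun t => f (x + t *: w)) = 0) -> vint f = 0.
Proof.
move=> bf w0 f0.
pose sh (z : T3) : T3 := (z.1, (z.2.1 + w 0 1 * z.1, z.2.2 + w 0 2%:R * z.1)).
have msh : measurable_fun setT sh.
  apply/measurable_fun_pairP; split; first exact: measurable_fst.
  have m1 : measurable_fun setT (fun z : T3 => z.1) by exact: measurable_fst.
  have m2 : measurable_fun setT (fun z : T3 => z.2) by exact: measurable_snd.
  apply/measurable_fun_pairP; split.
    apply: measurable_funD; last exact: measurable_funM.
    exact: (measurableT_comp measurable_fst m2).
  apply: measurable_funD; last exact: measurable_funM.
  exact: (measurableT_comp measurable_snd m2).
have [A A0 fA] := bounded_support_on bf.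
have [C C0 hC] : exists2 C, 0 <= C & bounded_on (cube3 C) A (f \o @vec R \o sh).
  exists (A + `|w| * A) => //; first by rewrite addr_ge0// mulr_ge0.
  split; first exact: (measurableT_comp fA.1 msh).
  move=> z; split; first exact: (fA.2 _).1.
  move=> zC; apply: (fA.2 _).2 => shA; apply: zC; move: shA.
  rewrite /cube3 /cube1 /= !in_itv /= -!ler_norml => -[z1 [z2 z3]].
  have wA : 0 <= `|w| * A by rewrite mulr_ge0.
  have h j : `|w 0 j * z.1| <= `|w| * A by rewrite normrM ler_pM// rV_coord_le.
  split; first by lra.
  have aux (a b : R) : `|a + b| <= A -> `|b| <= `|w| * A -> `|a| <= A + `|w| * A.
    by move=> ab b1; rewrite -[a](addrK b) (le_trans (ler_normB _ _))// lerD.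
  by split; [apply: aux z2 (h _)|apply: aux z3 (h _)].
have shi : (@leb3 R).-integrable setT (EFin \o (f \o @vec R \o sh)).
  by apply: bounded_on_integrable hC; [exact: measurable_cube3|exact: leb3_cube].
have fi := bounded_support_integrable bf.
have sec (g : T3 -> R) (B D t : R) : bounded_on (cube3 B) D g ->
    bounded_on (cube1 B `*` cube1 B) D (fun p => g (t, p)).
  move=> [mg gB]; split; first exact: measurableT_comp mg (measurable_pair1 _).
  by move=> p; split; [exact: (gB _).1|move=> pB; apply: (gB _).2 => -[_]].
have sec1 (g : T3 -> R) (B D : R) p : bounded_on (cube3 B) D g ->
    bounded_on (cube1 B) D (fun t => g (t, p)).
  move=> [mg gB]; split; first exact: measurableT_comp mg (measurable_pair2 _).
  by move=> x; split; [exact: (gB _).1|move=> pB; apply: (gB _).2 => -[]].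
have seci (g : T3 -> R) (B D t : R) : 0 <= B -> bounded_on (cube3 B) D g ->
    (@leb2 R).-integrable setT (EFin \o (fun p => g (t, p))).
  move=> B0 /(sec _ _ _ t); apply: bounded_on_integrable.
    exact: measurable_cube2.
  exact: leb2_cube.
have sec1i (g : T3 -> R) (B D : R) p : 0 <= B -> bounded_on (cube3 B) D g ->
    leb.-integrable setT (EFin \o (fun t => g (t, p))).
  move=> B0 /(sec1 _ _ _ p); apply: bounded_on_integrable.
    exact: measurable_cube1.
  by rewrite [X in (X < _)%E]lebesgue_cube1// ltry.
transitivity (Rintegral (@leb3 R) setT (f \o @vec R \o sh)).
  rewrite /vint /leb3 (Rintegral_prod12 fi); last first.
    by move=> x; exact: (seci (f \o @vec R) A A).
  rewrite (Rintegral_prod12 shi); last first.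
    by move=> x; exact: (seci (f \o @vec R \o sh) C A).
  congr Rintegral; apply/funext => x.
  have [mt pt] := translate2_preserving (w 0 1 * x) (w 0 2%:R * x).
  rewrite -(Rintegral_measure_preserving mt pt)//.
  exact: (sec (f \o @vec R) A A x fA).1.
rewrite /leb3 (Rintegral_prod21 shi); last first.
  by move=> p; exact: (sec1i (f \o @vec R \o sh) C A).
transitivity (Rintegral (@leb2 R) setT (cst 0)); last by rewrite Rintegral_cst// mul0r.
congr Rintegral; apply/funext => p /=; rewrite -[RHS](f0 (vec (0, p))); congr Rintegral.
apply/funext => t; congr f; apply: rV3P; rewrite !mxE /= ?w0 ?add0r ?mulr1//;
by rewrite mulrC.
Qed.

End VintTheory.

(** * Directional derivatives *)

Section DirectionalDerivatives.
Context {R : realType} {V : normedModType R}.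
Implicit Types (f : V -> R) (x v : V).

Lemma is_derive_quotient f x v l :
  (fun h => h^-1 * (f (h *: v + x) - f x)) @ 0^' --> l <-> is_derive x v f l.
Proof.
split=> [h|[fxv <-]]; last exact: fxv.
by apply: DeriveDef; [apply/cvg_ex; exists l|exact: cvg_lim].
Qed.

Lemma is_derive_line f x v l :
  is_derive x v f l <-> is_derive (0 : R) 1 (fun h => f (h *: v + x)) l.
Proof.
rewrite -is_derive_quotient; split=> [h|[]].
  apply: DeriveDef.
    by apply: (derivable1P f x v).1; apply/cvg_ex; exists l; exact: h.
  apply: cvg_lim => //; rewrite (_ : (fun _ => _) = (fun h => h^-1 * (f (h *: v + x) - f x)))//.
  by apply/funext => t /=; rewrite addr0 scale0r add0r [_%:A]mulr1.
move=> /(derivable1P f x v).2 fxv <-.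
rewrite (_ : 'D_1 (fun h : R => f (h *: v + x)) (0 : R) = 'D_v f x); first exact: fxv.
rewrite /derive; set g1 := fun h => h^-1 *: _; set g2 := fun h => h^-1 *: _.
suff -> : g1 = g2 by [].
by apply/funext => t; rewrite /g1 /g2 /=; rewrite addr0 scale0r add0r [_%:A]mulr1.
Qed.

(** Restriction to a line reduces this to the one-variable chain rule, so f needs a derivative in
    the direction v only. That is the form in which the derivative of the gauge is obtained. *)
Lemma is_derive_comp_real (c : R -> R) f x v l c' : is_derive x v f l ->
  is_derive (f x) 1 c c' -> is_derive x v (c \o f) (c' * l).
Proof.
move=> /is_derive_line df dc; apply/is_derive_line.
have dc0 : is_derive (f (0 *: v + x)) 1 c c' by rewrite scale0r add0r.
have := is_derive1_comp (f := c) (g := fun h : R => f (h *: v + x)) (x := 0).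
by move=> /(_ _ _ dc0 df); rewrite mulrC.
Qed.

Lemma is_derive_sequence f x v l : is_derive x v f l ->
  n.+1%:R * (f (x + n.+1%:R^-1 *: v) - f x) @[n --> \oo] --> l.
Proof.
move=> /is_derive_quotient dl.
have h0 : (@harmonic R) @ \oo --> 0^'.
  move=> A [e /= e0 eA].
  have : \forall n \near \oo, `|0 - harmonic n : R| < e.
    by have := @cvg_harmonic R; move/cvgrPdist_lt => /(_ _ e0).
  apply: filterS => n hn; apply: eA => //=.

have := cvg_comp _ _ h0 dl; apply: cvg_trans; apply: near_eq_cvg.
near=> n. rewrite /= /harmonic /= invrK. by rewrite [x + _]addrC.
Unshelve. all: by end_near. Qed.

Lemma is_derive_epsilon f x v l :
  (forall e, 0 < e -> \forall t \near (0 : R), `|f (t *: v + x) - f x - t * l| <= e * `|t|) ->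
  is_derive x v f l.
Proof.
move=> fe; apply/is_derive_quotient/cvgrPdist_le => e e0.
near=> t; have t0 : t != 0 by near: t; exact: nbhs_dnbhs_neq.
have -> : l - t^-1 * (f (t *: v + x) - f x) =
    - t^-1 * (f (t *: v + x) - f x - t * l) by field.
rewrite normrM normrN normfV ler_pdivrMl ?normr_gt0// [leRHS]mulrC.
by near: t; apply: cvg_within; exact: fe.
Unshelve. all: by end_near. Qed.

Lemma is_derive_scaled f x v l (k : R) :
  is_derive x v f l -> is_derive x (k *: v) f (k * l).
Proof.
move=> /is_derive_line df; apply/is_derive_line.
have dk : is_derive (0 : R) 1 (fun h : R => h * k) k.
  have := is_deriveM (is_derive_id (0:R) 1) (is_derive_cst k (0 : R) 1).
  by move=> /is_derive_eq; apply; rewrite scaler0 add0r [_%:A]mulr1.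
have df0 : is_derive (0 * k) 1 (fun h => f (h *: v + x)) l by rewrite mul0r.
have := is_derive1_comp (f := fun h : R => f (h *: v + x)) (g := fun h => h * k).
move=> /(_ _ _ _ df0 dk) /=.
by rewrite [l * k]mulrC; congr is_derive; apply/funext => t /=; rewrite scalerA.
Qed.

End DirectionalDerivatives.

Section SmoothFields.
Variable R : realType.
Implicit Types (f g : 'rV[R]_3 -> R) (x y v w : 'rV[R]_3).

(** The derivative is the limit of difference quotients, each of which has integral zero by
    translation invariance; the Lipschitz bound dominates them. *)
Lemma vint_directional_derivative v (L : R) f (df : 'rV[R]_3 -> R) :
  bounded_support f -> continuous f ->
  (forall x y, `|f x - f y| <= L * `|x - y|) ->
  (forall x, is_derive x v f (df x)) -> bounded_support df /\ vint df = 0.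
Proof.
move=> bf cf fL fdf; have [mf [A fA]] := bf.
have A0 : 0 <= A by apply: le_trans (fA 0).1.
have Lv0 : 0 <= L * `|v|.
  by have := fL v 0; rewrite subr0; apply: le_trans.
pose q n x : R := n.+1%:R * (f (x + n.+1%:R^-1 *: v) - f x).
(* As the increments 1 / (n + 1) are at most 1, the quotients are bounded by L |v| and supported
   within A + |v|; B exceeds both. *)
pose B := A + `|v| + L * `|v|.
have ctr (a : 'rV[R]_3) : continuous (fun x => f (x + a)).
  move=> x; apply: (@continuous_comp _ _ _ (fun x => x + a)); last exact: cf.
  by apply: continuousD; [move=> ?; exact|exact: cst_continuous].
have mq n : measurable_fun setT (q n \o @vec R).
  apply: measurable_vec_continuous => x; rewrite /q.
  have c1 : {for x, continuous (cst n.+1%:R : 'rV[R]_3 -> R)} by exact: cst_continuous.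
  have c2 : {for x, continuous ((fun y => f (y + n.+1%:R^-1 *: v)) - f)}.
    by apply: continuousB; [exact: ctr|exact: cf].
  exact: (continuousM c1 c2).
have qB n x : `|q n x| <= B /\ (B < `|x| -> q n x = 0).
  have n1 : `|n.+1%:R^-1 *: v| <= `|v|.
    rewrite normrZ ger0_norm ?invr_ge0// ler_piMl// invf_le1 ?ltr0n//.
    by rewrite ler1n.
  split; last first.
    rewrite /q /B => Bx; rewrite (fA x).2 ?(fA (_ + _)).2 ?subr0 ?mulr0//.
      have := ler_normB (x + n.+1%:R^-1 *: v) (n.+1%:R^-1 *: v).
      by rewrite addrK => ?; lra.
    by have := normr_ge0 v; lra.
  rewrite /q normrM ger0_norm//.
  apply: (@le_trans _ _ (n.+1%:R * (L * `|n.+1%:R^-1 *: v|))).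
    rewrite ler_wpM2l//; apply: le_trans (fL _ _) _.
    by rewrite [x + _]addrC addrK.
  rewrite normrZ ger0_norm ?invr_ge0// mulrCA mulrA mulrA.
  rewrite -(mulrA L) mulfV ?pnatr_eq0// mulr1 /B.
  by have := normr_ge0 v; lra.
have qdf x : q n x @[n --> \oo] --> df x by exact: is_derive_sequence.
split.
  split.
    apply/measurable_EFinP; apply: (emeasurable_fun_cvg (fun n z => (q n (vec z))%:E)).
      by move=> n; apply/measurable_EFinP; exact: mq.
    by move=> z _; apply: cvg_EFin; [exact: nearW|exact: qdf].
  exists B => x; split.
    have /cvg_norm h := qdf x.
    by apply: (cvgr_to_le h); apply: nearW => n; exact: (qB n x).1.
  move=> Bx; apply: (@cvg_unique _ _ _ _ _ _ (qdf x)) => //.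
  rewrite (_ : (fun n => q n x) = cst 0); first exact: cvg_cst.
  by apply/funext => n; exact: (qB n x).2.
apply: (vint_dominated0 mq qB qdf) => n.
have bft : bounded_support (fun x => f (x + n.+1%:R^-1 *: v)).
  split; first exact: measurable_vec_continuous.
  exists (A + `|n.+1%:R^-1 *: v|) => x; split.
    by rewrite (le_trans (fA _).1)// lerDl.
  move=> h; apply: (fA _).2.
  have := ler_normB (x + n.+1%:R^-1 *: v) (n.+1%:R^-1 *: v).
  by rewrite addrK => ?; lra.
by rewrite vintZ; [rewrite vintB// vint_translate// subrr mulr0|exact: bounded_supportB].
Qed.

Definition C1 f := (forall x, differentiable f x) /\
  forall i, continuous (partial i f).

Lemma smooth_C1 f : smooth_on setT f -> C1 f.
Proof.
move=> sf; split=> [x|i x]; first exact: (sf [::] x).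
exact/differentiable_continuous/(sf [:: i] x).
Qed.

Lemma C1_continuous f : C1 f -> continuous f.
Proof. by move=> [df _] x; exact: differentiable_continuous. Qed.

Lemma derive_partial f x v : differentiable f x ->
  'D_v f x = \sum_i v 0 i * partial i f x.
Proof.
move=> df; rewrite deriveE// [in LHS](row_sum_delta v) linear_sum.
by apply: eq_bigr => i _; rewrite linearZ /partial deriveE.
Qed.

Lemma differentiable_is_derive f x v : differentiable f x ->
  is_derive x v f (\sum_i v 0 i * partial i f x).
Proof.
move=> df; rewrite -derive_partial//; apply/derivableP.
exact: diff_derivable.
Qed.

Lemma is_derive_along f x v (t : R) : (forall y, differentiable f y) ->
  is_derive t 1 (fun s => f (x + s *: v)) (\sum_i v 0 i * partial i f (x + t *: v)).
Proof.
move=> df; have /is_derive_line h := differentiable_is_derive v (df (x + t *: v)).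
apply/is_derive_line; move: h; congr is_derive; apply/funext => s.
by congr f; rewrite [s%:A]mulr1 scalerDl addrCA.
Qed.

(** Mean value theorem on the segment, which stays in the ball. Each coordinate of x - y is at most
    its sup norm, so the bounds of the partial derivatives add up. *)
Lemma C1_lipschitz_ball f (A : R) : C1 f -> exists2 L, 0 <= L &
  forall x y, `|x| <= A -> `|y| <= A -> `|f x - f y| <= L * `|x - y|.
Proof.
move=> [df cf].
have /choice[C hC] : forall i, exists c, 0 <= c /\
    forall x, `|x| <= A -> `|partial i f x| <= c.
  by move=> i; have [c c0 hc] := continuous_bounded_ball A (cf i); exists c.
exists (\sum_i C i) => [|x y xA yA]; first by rewrite sumr_ge0// => i _; case: (hC i).
have seg (t : R) : 0 <= t <= 1 -> `|y + t *: (x - y)| <= A.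
  move=> /andP[t0 t1]; rewrite (_ : _ + _ = t *: x + (1 - t) *: y); last first.
    by rewrite scalerBr scalerBl scale1r addrC -addrA [- _ + _]addrC.
  rewrite (le_trans (ler_normD _ _))// !normrZ !ger0_norm ?subr_ge0//.
  have h1 : t * `|x| <= t * A by rewrite ler_wpM2l.
  have h2 : (1 - t) * `|y| <= (1 - t) * A by rewrite ler_wpM2l// subr_ge0.
  by nra.
have [||c c01] := @MVT _ (fun s => f (y + s *: (x - y)))
    (fun s => \sum_i (x - y) 0 i * partial i f (y + s *: (x - y))) 0 1 ltr01.
- by move=> s _; exact: is_derive_along.
- apply: continuous_subspaceT => s.
  apply/differentiable_continuous/derivable1_diffP.
  by have [] := is_derive_along y (x - y) s df.
rewrite scale1r scale0r addr0 addrCA subrr addr0 subr0 mulr1 => ->.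
rewrite mulr_suml (le_trans (ler_norm_sum _ _ _))//; apply: ler_sum => i _.
rewrite normrM mulrC ler_pM// ?rV_coord_le//; apply: (hC i).2; apply: seg.
by move: c01; rewrite in_itv /= => /andP[/ltW -> /ltW ->].
Qed.

End SmoothFields.

(** * The Minkowski gauge *)

Section MinkowskiGauge.
Context {R : realType} {V : normedModType R}.
Variable K : set V.
Hypothesis K_open : open K.
Hypothesis K0 : K 0.
Hypothesis K_convex : forall x y (t : R), K x -> K y -> 0 <= t -> t <= 1 ->
  K (t *: x + (1 - t) *: y).
Variables (r B : R).
Hypothesis r_gt0 : 0 < r.
Hypothesis K_ball : forall y : V, `|y| < r -> K y.
Hypothesis K_bounded : forall y : V, K y -> `|y| <= B.
Implicit Types (x y v : V) (s t : R).

Let scales y : set R := [set t | 0 < t /\ K (t^-1 *: y)].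

Definition gauge y : R := inf (scales y).

Let scales_lb y : has_lbound (scales y).
Proof. by exists 0 => t [/ltW]. Qed.

Let scales_gt y t : `|y| / r < t -> scales y t.
Proof.
move=> yt; have t0 : 0 < t by apply: le_lt_trans yt; rewrite divr_ge0// ltW.
split=> //; apply: K_ball; rewrite normrZ gtr0_norm ?invr_gt0//.
by rewrite ltr_pdivrMl// -ltr_pdivrMr.
Qed.

Let scales_ex y : scales y !=set0.
Proof. by exists (`|y| / r + 1); apply: scales_gt; rewrite ltrDl. Qed.

Lemma gauge_ge0 y : 0 <= gauge y.
Proof. by apply: lb_le_inf; [exact: scales_ex|move=> t [/ltW]]. Qed.

Lemma gauge_le_norm y : gauge y <= `|y| / r.
Proof.
rewrite leNgt; apply/negP => h.
have /midf_lt[h1 h2] := h; move: h2; rewrite ltNge => /negP; apply.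
by apply: ge_inf => //; apply: scales_gt.
Qed.

(** From left to right, convexity with 0 in K allows shrinking; from right to left, openness of K
    leaves room for a scale slightly below t. Later properties of the gauge are read off this
    equivalence rather than the infimum. *)
Lemma gauge_lt y t : 0 < t -> gauge y < t <-> K (t^-1 *: y).
Proof.
move=> t0; split=> [/(inf_lt (scales_ex y))[s [s0 Ks] st]|Kt].
  rewrite (_ : t^-1 *: y = (s / t) *: (s^-1 *: y) + (1 - s / t) *: 0).
    apply: K_convex => //; first by rewrite divr_ge0// ltW.
    by rewrite ler_pdivrMr// mul1r ltW.
  by rewrite scaler0 addr0 scalerA mulrAC mulfV ?mul1r// gt_eqF.
have : \forall s \near t, K (s^-1 *: y).
  have c : s^-1 *: y @[s --> t] --> t^-1 *: y.
    by apply: cvgZr_tmp; apply: cvgV; [rewrite gt_eqF|exact: cvg_id].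
  by apply: c; apply: open_nbhs_nbhs; split.
move=> /nbhs_ballP[e /= e0 eK].
pose s := t - Num.min (e / 2) (t / 2).
have m0 : 0 < Num.min (e / 2) (t / 2) by rewrite lt_min !divr_gt0.
have me : Num.min (e / 2) (t / 2) <= e / 2 by rewrite ge_min lexx.
have mt : Num.min (e / 2) (t / 2) <= t / 2 by rewrite ge_min lexx orbT.
have s0 : 0 < s by rewrite /s; lra.
apply: (@le_lt_trans _ _ s); last by rewrite /s; lra.
apply: ge_inf => //; split=> //; apply: eK.
rewrite -ball_normE /ball_ /= /s opprD addrA subrr add0r opprK gtr0_norm//; lra.
Qed.

Lemma gauge_lt1 y : gauge y < 1 <-> K y.
Proof. by rewrite gauge_lt// invr1 scale1r. Qed.

Lemma gauge_homo y s : 0 < s -> gauge (s *: y) = s * gauge y.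
Proof.
move=> s0.
have lt z t u : 0 < u -> 0 < t -> gauge (u *: z) < t -> gauge z < t / u.
  move=> u0 t0 /(gauge_lt _ t0) h; apply/gauge_lt; first by rewrite divr_gt0.
  by rewrite invf_div; move: h; rewrite scalerA mulrC.
apply/eqP; rewrite eq_le; apply/andP; split; rewrite leNgt; apply/negP => h.
  have t0 : 0 < gauge (s *: y) by apply: le_lt_trans h; rewrite mulr_ge0 ?gauge_ge0// ltW.
  have si : 0 < s^-1 by rewrite invr_gt0.
  have h1 : gauge y < gauge (s *: y) / s by rewrite ltr_pdivlMr// mulrC.
  have := lt (s *: y) (gauge (s *: y) / s) s^-1 si (divr_gt0 t0 s0).
  by rewrite scalerA mulVf ?gt_eqF// scale1r invrK divfK ?gt_eqF// ltxx => /(_ h1).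
have h0 : 0 < s * gauge y by apply: le_lt_trans h; exact: gauge_ge0.
have := lt y (s * gauge y) s s0 h0 h.
by rewrite mulrC mulKf ?gt_eqF// ltxx.
Qed.

Lemma gaugeD x y : gauge (x + y) <= gauge x + gauge y.
Proof.
apply/ler_addgt0Pr => e e0.
pose a := gauge x + e / 2; pose b := gauge y + e / 2.
have a0 : 0 < a by rewrite /a; have := gauge_ge0 x; lra.
have b0 : 0 < b by rewrite /b; have := gauge_ge0 y; lra.
have Ka : K (a^-1 *: x) by apply/gauge_lt => //; rewrite /a; lra.
have Kb : K (b^-1 *: y) by apply/gauge_lt => //; rewrite /b; lra.
have ab0 : 0 < a + b by rewrite addr_gt0.
rewrite (_ : _ + e = a + b); last by rewrite /a /b; lra.
apply/ltW/gauge_lt => //.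
rewrite (_ : _ *: _ = (a / (a + b)) *: (a^-1 *: x) + (1 - a / (a + b)) *: (b^-1 *: y)).
  apply: K_convex => //; first by rewrite divr_ge0// ltW.
  by rewrite ler_pdivrMr// mul1r lerDl ltW.
rewrite !scalerA scalerDr; congr (_ *: _ + _ *: _); field; rewrite ?gt_eqF//.
Qed.

Lemma gauge_lipschitz x y : `|gauge x - gauge y| <= r^-1 * `|x - y|.
Proof.
have h u v : gauge u - gauge v <= r^-1 * `|u - v|.
  rewrite lerBlDr -{1}(subrK v u) (le_trans (gaugeD _ _))// lerD2r mulrC.
  exact: gauge_le_norm.
by rewrite ler_norml h andbT lerNl opprB distrC h.
Qed.

Lemma norm_le_gauge y : `|y| <= B * gauge y.
Proof.
have B0 : 0 <= B by apply: le_trans (K_bounded K0).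
apply/ler_addgt0Pr => e e0.
(* The denominator B + 1 stays positive even if B = 0. *)
pose t := gauge y + e / (B + 1).
have t0 : 0 < t by rewrite ltr_wpDl ?gauge_ge0// divr_gt0// ltr_wpDl.
have /(gauge_lt _ t0)/K_bounded : gauge y < t by rewrite ltrDl divr_gt0// ltr_wpDl.
rewrite normrZ gtr0_norm ?invr_gt0// ler_pdivrMl// /t => /le_trans; apply.
rewrite mulrDl mulrC lerD2l mulrAC ler_pdivrMr ?ltr_wpDl// ler_wpM2l// ?ltW//.
by rewrite ltrDl.
Qed.

Lemma gauge0 : gauge 0 = 0.
Proof.
by apply/eqP; rewrite eq_le gauge_ge0 andbT (le_trans (gauge_le_norm 0))// normr0 mul0r.
Qed.

End MinkowskiGauge.

(** * Cutoff profiles on the real line *)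

Section Cutoff.
Context {R : realType}.
Implicit Types (s t : R).

Lemma bounded_derivative_lipschitz (f f' : R -> R) (C : R) :
  (forall s, is_derive s 1 f (f' s)) -> (forall s, `|f' s| <= C) ->
  forall s t, `|f s - f t| <= C * `|s - t|.
Proof.
move=> df fC.
have cf : continuous f.
  by move=> s; apply/differentiable_continuous/derivable1_diffP; case: (df s).
have lt s t : s < t -> `|f s - f t| <= C * `|s - t|.
  move=> st; have [c _] := MVT st (fun x _ => df x) (continuous_subspaceT cf).
  by rewrite distrC => ->; rewrite normrM [`|t - s|]distrC ler_wpM2r.
move=> s t; have [|ts|->] := ltgtP s t; first exact: lt.
  by rewrite distrC [`|s - t|]distrC; exact: lt.
by rewrite !subrr normr0 mulr0.
Qed.

Definition pos t := Num.max 0 t.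

(** A ramp with continuous, piecewise linear derivative: the cutoffs are differentiated only
    once. *)
Definition sqpos t := pos t ^+ 2.

Lemma is_derive_sqpos t : is_derive t 1 sqpos (2 * pos t).
Proof.
apply: is_derive_epsilon => e e0; near=> h.
have he : `|h| <= e by near: h; exact: (@nbhs0_le R R^o).
(* The first-order error of [sqpos] is at most h ^ 2 whatever the signs of t and h + t. *)
rewrite [h%:A]mulr1; apply: (@le_trans _ _ (`|h| * `|h|)); last by rewrite ler_wpM2r.
rewrite -normrM -expr2 ger0_norm ?sqr_ge0// ler_norml /sqpos /pos.
case: (leP 0 (h + t)) => h1; case: (leP 0 t) => h2; apply/andP; split.
- nra.
- nra.
- nra.
- nra.
- nra.
- nra.
- nra.
- nra.
Unshelve. all: by end_near. Qed.

Section Profile.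
Variable n : nat.
Hypothesis n_gt0 : (0 < n)%N.

(* Equal to 1 up to [1 - 1/n] and to 0 from 1 on. *)
Definition profile s := sqpos (1 - sqpos (n%:R * s - n%:R + 1)).

Definition profile' s :=
  - (4 * n%:R * pos (1 - sqpos (n%:R * s - n%:R + 1)) * pos (n%:R * s - n%:R + 1)).

Lemma is_derive_profile s : is_derive s 1 profile (profile' s).
Proof.
have d1 : is_derive s 1 (fun s => n%:R * s - n%:R + 1) n%:R.
  apply: is_derive_epsilon => e e0; near=> h.
  rewrite [h%:A]mulr1 (_ : _ - _ - _ = 0) ?normr0; last by ring.
  by rewrite mulr_ge0// ltW.
have d2 := is_derive_comp_real d1 (is_derive_sqpos _).
have d3 : is_derive s 1 (fun s => 1 - sqpos (n%:R * s - n%:R + 1))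
    (- (2 * pos (n%:R * s - n%:R + 1) * n%:R)).
  have := is_deriveB (is_derive_cst (1 : R) s 1) d2.
  by rewrite sub0r.
have d4 := is_derive_comp_real d3 (is_derive_sqpos _).
move: d4; congr is_derive; rewrite /profile'; ring.
Unshelve. all: by end_near. Qed.

Let n1 : 1 <= n%:R :> R. Proof. by rewrite ler1n. Qed.

Lemma profile_bounds s : 0 <= profile s <= 1.
Proof.
rewrite /profile; set u := sqpos (_ - _ + 1); have u0 : 0 <= u by exact: sqr_ge0.
have p0 : 0 <= pos (1 - u) by rewrite /pos le_max lexx.
have p1 : pos (1 - u) <= 1 by rewrite /pos ge_max ler01 /= gerBl.
by rewrite /sqpos; nra.
Qed.

Lemma profile_ge1 s : 1 <= s -> profile s = 0 /\ profile' s = 0.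
Proof.
move=> s1; have u1 : 1 <= n%:R * s - n%:R + 1 by have := n1; nra.
have p0 : pos (1 - sqpos (n%:R * s - n%:R + 1)) = 0.
  rewrite /pos; apply/eqP; rewrite eq_maxl.
  by rewrite subr_le0 /sqpos expr_ge1// /pos le_max ?lexx// u1 orbT.
have -> : profile s = pos (1 - sqpos (n%:R * s - n%:R + 1)) ^+ 2 by [].
by rewrite /profile' p0 expr0n mulr0 mul0r oppr0.
Qed.

Lemma profile_le s : n%:R * s <= n%:R - 1 -> profile s = 1 /\ profile' s = 0.
Proof.
move=> s1; have u0 : pos (n%:R * s - n%:R + 1) = 0.
  by apply/eqP; rewrite eq_maxl; lra.
have q0 : sqpos (n%:R * s - n%:R + 1) = 0 by rewrite /sqpos u0 expr0n.
split; last by rewrite /profile' u0 mulr0 oppr0.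
rewrite /profile q0 subr0.
by rewrite /sqpos /pos max_r// expr1n.
Qed.

Lemma profile'_bound s : `|profile' s| <= 4 * n%:R.
Proof.
rewrite /profile' normrN ger0_norm; last first.
  by rewrite !mulr_ge0 //; rewrite /pos le_max lexx.
rewrite -mulrA ger_pMr; last by have := n1; nra.
set u := _ - _ + 1; have u0 : 0 <= pos u by rewrite /pos le_max lexx.
have v0 : 0 <= sqpos u by exact: sqr_ge0.
have w0 : 0 <= pos (1 - sqpos u) by rewrite /pos le_max lexx.
have w1 : pos (1 - sqpos u) <= 1 by rewrite /pos ge_max ler01 /= gerBl.
(* Where the inner ramp reaches 1 the other factor vanishes, so the product never exceeds 1. *)
have [u1|u1] := leP 1 (pos u); last by nra.
suff -> : pos (1 - sqpos u) = 0 by rewrite mul0r.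
by apply/eqP; rewrite eq_maxl subr_le0 expr_ge1.
Qed.

(** The derivative has size n only where 1 - s is at most 1/n, so this product is bounded
    independently of n. It pays for the growth of the cutoff gradients. *)
Lemma profile'_edge s : `|profile' s| * `|1 - s| <= 4.
Proof.
have [/profile_ge1[_ ->]|s1] := leP 1 s; first by rewrite normr0 mul0r.
have [/profile_le[_ ->]|s2] := leP (n%:R * s) (n%:R - 1).
  by rewrite normr0 mul0r.
rewrite (gtr0_norm (_ : 0 < 1 - s)) ?subr_gt0//.
have := profile'_bound s; set a := `|_|; have a0 : 0 <= a by exact: normr_ge0.
have : n%:R * (1 - s) <= 1 by lra.
nra.
Qed.

Lemma profile_lipschitz s t : `|profile s - profile t| <= 4 * n%:R * `|s - t|.
Proof. exact: bounded_derivative_lipschitz is_derive_profile profile'_bound _ _. Qed.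

End Profile.
End Cutoff.

(** * The gauge of a convex domain and its derivative at the boundary *)

Section ConvexDomain.
Variable R : realType.
Variable M : set 'rV[R]_3.
Hypothesis M_open : open M.
Hypothesis M_bounded : bounded_set M.
Hypothesis M_convex : convex_set M.
Implicit Types (x y v w p o : 'rV[R]_3) (s t : R).

Lemma convex_combination x y t : M x -> M y -> 0 <= t -> t <= 1 ->
  M (t *: x + (1 - t) *: y).
Proof.
move=> Mx My t0 t1; have := M_convex (x := x) (y := y).
by move=> /(_ (Itv01 t0 t1)); rewrite !inE => /(_ Mx My).
Qed.

(** The gauge is taken about the origin, so an interior point o of M is moved there. *)
Definition translate_to o : set 'rV[R]_3 := [set y | M (o + y)].

Lemma translate_to_open o : open (translate_to o).
Proof.
have c : continuous (fun y => o + y).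
  by move=> y; apply: continuousD; [exact: cst_continuous|move=> ?; exact].
by move/continuousP : c; exact.
Qed.

Lemma translate_to_convex o x y t : translate_to o x -> translate_to o y ->
  0 <= t -> t <= 1 -> translate_to o (t *: x + (1 - t) *: y).
Proof.
rewrite /translate_to /= => Mx My t0 t1; have := convex_combination Mx My t0 t1.
by congr M; apply/rowP => i; rewrite !mxE; ring.
Qed.

Lemma translate_to_ball o : M o -> exists2 r, 0 < r &
  forall y, `|y| < r -> translate_to o y.
Proof.
move=> Mo; have /nbhs_ballP[r /= r0 rM] := open_nbhs_nbhs (conj M_open Mo).
exists r => // y yr; apply: rM; rewrite -ball_normE /ball_ /=.
by rewrite opprD addrA subrr add0r normrN.
Qed.

Lemma translate_to_bounded o : exists B, forall y, translate_to o y -> `|y| <= B.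
Proof.
have [A [_ MA]] := M_bounded; exists (`|A| + 1 + `|o|) => y /= My.
have : `|o + y| <= `|A| + 1 by apply: MA => //; rewrite (le_lt_trans (ler_norm _))// ltrDl.
by have := ler_normB (o + y) o; rewrite addrAC subrr add0r; lra.
Qed.

Lemma boundaryP p : boundary M p <-> closure M p /\ ~ M p.
Proof. by rewrite /boundary /setD /= ((interior_id _).1 M_open). Qed.

Lemma gauge_closure o p : M o -> closure M p -> gauge (translate_to o) (p - o) <= 1.
Proof.
move=> Mo cp; have [r r0 rM] := translate_to_ball Mo.
have K0 : translate_to o 0 by rewrite /translate_to /= addr0.
rewrite leNgt; apply/negP => g1.
have e0 : 0 < (gauge (translate_to o) (p - o) - 1) * r by rewrite mulr_gt0// subr_gt0.
have [q [Mq]] := cp _ (nbhsx_ballx p _ e0); rewrite -ball_normE /ball_ /= => pq.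
have /(gauge_lt1 (@translate_to_open o) K0 (@translate_to_convex o) r0 rM) gq :
  translate_to o (q - o) by rewrite /translate_to /= addrC subrK.
have := gauge_lipschitz (@translate_to_open o) K0 (@translate_to_convex o) r0 rM
  (p - o) (q - o).
rewrite opprB addrA subrK => h.
have : r^-1 * `|p - q| < gauge (translate_to o) (p - o) - 1.
  by rewrite ltr_pdivrMl// mulrC.
by move: h; rewrite ler_norml => /andP[_]; lra.
Qed.

Lemma segment_to_closure o p t : M o -> closure M p -> 0 < t -> t <= 1 ->
  M (p + t *: (o - p)).
Proof.
move=> Mo cp t0; rewrite le_eqVlt => /predU1P[->|t1].
  by rewrite scale1r addrC subrK.
have [r r0 rM] := translate_to_ball Mo.
have K0 : translate_to o 0 by rewrite /translate_to /= addr0.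
have := gauge_closure Mo cp; set g := gauge _ _ => g1.
have : gauge (translate_to o) ((1 - t) *: (p - o)) < 1.
  rewrite (gauge_homo (@translate_to_open o) K0 (@translate_to_convex o) r0 rM) ?subr_gt0//.
  have g0 : 0 <= g by exact: gauge_ge0 rM _.
  by rewrite -/g; nra.
move=> /(gauge_lt1 (@translate_to_open o) K0 (@translate_to_convex o) r0 rM).
by rewrite /translate_to /=; congr M; apply/rowP => i; rewrite !mxE; ring.
Qed.

Lemma gauge_boundary o z : M o -> gauge (translate_to o) z = 1 -> boundary M (o + z).
Proof.
move=> Mo gz; have [r r0 rM] := translate_to_ball Mo.
have K0 : translate_to o 0 by rewrite /translate_to /= addr0.
apply/boundaryP; split; last first.
  move=> /(gauge_lt1 (@translate_to_open o) K0 (@translate_to_convex o) r0 rM).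
  by rewrite gz ltxx.
move=> A /nbhs_ballP[e /= e0 eA].
pose d := Num.min (1 / 2) (e / (2 * (`|z| + 1))).
have z0 := normr_ge0 z.
have d0 : 0 < d by rewrite lt_min !divr_gt0// mulr_gt0// ltr_wpDl.
have d1 : d <= 1 / 2 by rewrite ge_min lexx.
have de : d * (2 * (`|z| + 1)) <= e.
  by rewrite -ler_pdivlMr ?mulr_gt0 ?ltr_wpDl// ge_min lexx orbT.
exists (o + (1 - d) *: z); split.
  apply: (gauge_lt1 (@translate_to_open o) K0 (@translate_to_convex o) r0 rM _).1.
  rewrite (gauge_homo (@translate_to_open o) K0 (@translate_to_convex o) r0 rM); last by lra.
  by rewrite gz; lra.
apply: eA; rewrite -ball_normE /ball_ /=.
rewrite (_ : _ - _ = d *: z); last by apply/rowP => i; rewrite !mxE; ring.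
by rewrite normrZ gtr0_norm//; nra.
Qed.

Section DefiningFunction.
Variables (p : 'rV[R]_3) (U : set 'rV[R]_3) (psi : 'rV[R]_3 -> R).
Hypothesis pM : boundary M p.
Hypothesis psiP : local_defining_function M p U psi.

(** The differential of [psi] at p. *)
Let d v := \sum_i v 0 i * partial i psi p.

Let psi_expansion (e : R) : 0 < e -> exists2 del, 0 < del & forall h, `|h| < del ->
  U (p + h) /\ `|psi (p + h) - psi p - d h| <= e * `|h|.
Proof.
have [oU Up sU _ _] := psiP; move=> e0.
have dpsi : differentiable psi p by exact: (sU [::] p Up).
have dE h : 'd psi p h = d h by rewrite -deriveE// derive_partial.
have [_ /funext/eqaddoP/(_ _ e0)] := (diff_locallyxP _ _).1 dpsi.
move=> /nbhs_norm0P[/= d1 d10 h1].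
have /nbhs_ballP[d2 /= d20 h2] := open_nbhs_nbhs (conj oU Up).
exists (Num.min d1 d2) => [|h]; first by rewrite lt_min d10.
rewrite lt_min => /andP[hd1 hd2]; split.
  by apply: h2; rewrite -ball_normE /ball_ /= opprD addrA subrr add0r normrN.
have : `|psi (h + p) - (psi p + 'd psi p h)| <= e * `|h| := h1 h hd1.
by rewrite [h + p]addrC dE opprD addrA.
Qed.

Let psi0 : psi p = 0.
Proof.
have [oU Up sU _ Mpsi] := psiP; have [cp nMp] := (boundaryP p).1 pM.
apply/eqP; rewrite eq_le; apply/andP; split; last first.
  by rewrite leNgt; apply/negP => /(Mpsi _ Up).2.
rewrite leNgt; apply/negP => p0.
have cpsi : {for p, continuous psi}.
  exact/differentiable_continuous/(sU [::] p Up).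
have nb : nbhs p [set x | U x /\ 0 < psi x].
  apply: filterI; first exact: open_nbhs_nbhs.
  exact: (cvgr_gt _ cpsi).
have [q [Mq [Uq]]] := cp _ nb.
by rewrite ltNge => /negP; apply; apply/ltW/(Mpsi _ Uq).1.
Qed.

Let dZ (a : R) v : d (a *: v) = a * d v.
Proof. by rewrite /d mulr_sumr; apply: eq_bigr => i _; rewrite mxE mulrA. Qed.

Let dD v w : d (v + w) = d v + d w.
Proof. by rewrite /d -big_split; apply: eq_bigr => i _; rewrite mxE mulrDl. Qed.

Let dNeg v : d (- v) = - d v.
Proof. by rewrite -scaleN1r dZ mulN1r. Qed.

(** Otherwise [psi] would be positive on the segment from p towards o near p, although this segment
    lies in M, where [psi] is negative. *)
Let d_le0 o : M o -> d (o - p) <= 0.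
Proof.
move=> Mo; have [oU Up sU _ Mpsi] := psiP; have [cp nMp] := (boundaryP p).1 pM.
rewrite leNgt; apply/negP => d0.
have op0 : 0 < 2 * (`|o - p| + 1) by rewrite mulr_gt0// ltr_wpDl.
(* With this tolerance the remainder is smaller than the linear term t d (o - p). *)
have e0 : 0 < d (o - p) / (2 * (`|o - p| + 1)) by rewrite divr_gt0.
have [del del0 hdel] := psi_expansion e0.
pose t := Num.min 1 (del / (2 * (`|o - p| + 1))).
have t0 : 0 < t by rewrite lt_min ltr01 divr_gt0.
have t1 : t <= 1 by rewrite ge_min lexx.
have td : t * (2 * (`|o - p| + 1)) <= del.
  by rewrite -ler_pdivlMr// ge_min lexx orbT.
have n0 := normr_ge0 (o - p).
have [|Uh] := hdel (t *: (o - p)); first by rewrite normrZ gtr0_norm//; nra.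
rewrite psi0 subr0 dZ normrZ gtr0_norm// => hp.
have := (Mpsi _ Uh).1 (segment_to_closure Mo cp t0 t1).
move: hp; rewrite ler_norml => /andP[hp _] psi_lt.
have : d (o - p) / (2 * (`|o - p| + 1)) * (t * `|o - p|) < t * d (o - p).
  rewrite mulrCA ltr_pM2l// mulrAC ltr_pdivrMr//; nra.
lra.
Qed.

(** The weak inequality also holds at o + e N, still in M for small e. Since d N is the squared
    length of the gradient, hence positive, it becomes strict at o. *)
Lemma defining_function_transversal o : M o -> 0 < d (p - o).
Proof.
move=> Mo; have [oU Up sU gpsi Mpsi] := psiP.
pose N := gradient psi p.
have dN : 0 < d N.
  have -> : d N = \sum_i partial i psi p ^+ 2.
    by apply: eq_bigr => i _; rewrite /N mxE expr2.
  rewrite lt_neqAle sumr_ge0 ?andbT => [|i _]; last exact: sqr_ge0.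
  apply/eqP => /esym/eqP; rewrite psumr_eq0 => [/allP h|i _]; last exact: sqr_ge0.
  have := gpsi p Up; rewrite -/N => /eqP; apply; apply/rowP => i.
  by rewrite !mxE; apply/eqP; rewrite -sqrf_eq0; apply: (h i); rewrite mem_index_enum.
have [r r0 rM] := translate_to_ball Mo.
pose e := r / (2 * (`|N| + 1)).
have NN : 0 < 2 * (`|N| + 1) by rewrite mulr_gt0// ltr_wpDl.
have e0 : 0 < e by rewrite divr_gt0.
have : M (o + e *: N).
  apply: rM; rewrite normrZ gtr0_norm// /e mulrAC ltr_pdivrMr//.
  by rewrite ltr_pM2l//; have := normr_ge0 N; lra.
move=> /d_le0; rewrite (_ : _ - p = (-1) *: (p - o) + e *: N); last first.
  by apply/rowP => i; rewrite !mxE; ring.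
rewrite [X in X <= _]dD !dZ; have : 0 < e * d N by rewrite mulr_gt0.
lra.
Qed.

(** The gauge of a vector is less than s exactly when [psi] is negative at the vector rescaled by 1
    / s. So the first-order expansion of [psi], tested at two scales s on either side of the
    expected value, squeezes the gauge between them; transversality makes the signs definite. *)
Lemma is_derive_gauge_boundary o v : M o ->
  is_derive (p - o) v (gauge (translate_to o)) (d v / d (p - o)).
Proof.
move=> Mo; have [y yE] : exists y, y = p - o by exists (p - o).
(* With this slope d (v - l *: y) = 0: moving by t v and rescaling by 1 + t l is tangent to the
   boundary to first order. *)
have [l lE] : exists l, l = d v / d y by exists (d v / d y).
rewrite -yE -lE.
have [oU Up sU gpsi Mpsi] := psiP; have [cp nMp] := (boundaryP p).1 pM.
have dy0 : 0 < d y by rewrite yE; exact: defining_function_transversal.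
have [r r0 rM] := translate_to_ball Mo.
have K0 : translate_to o 0 by rewrite /translate_to /= addr0.
have glt := gauge_lt (@translate_to_open o) K0 (@translate_to_convex o) r0 rM.
have gy : gauge (translate_to o) y = 1.
  apply/eqP; rewrite eq_le {1}yE gauge_closure//= leNgt; apply/negP => h.
  apply: nMp; have := (glt y 1 ltr01).1 h; rewrite invr1 scale1r /translate_to /=.
  by rewrite yE addrC subrK.
apply: is_derive_epsilon => e e0; rewrite gy.
pose C := `|v - l *: y| + e * `|y|.
have C0 : 0 <= C by rewrite addr_ge0// mulr_ge0// ltW.
have CC : 0 < 2 * (C + 1) by rewrite mulr_gt0// ltr_wpDl.
(* The displacement h used below satisfies |h| <= |t| C / s, so this tolerance keeps the remainder
   within half of the main term e |t| d y / s. *)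
have eta0 : 0 < e * d y / (2 * (C + 1)) by rewrite divr_gt0// mulr_gt0.
have [del del0 hdel] := psi_expansion eta0.
have le0 : 0 <= `|l| + e by rewrite addr_ge0// ltW.
near=> t.
have t_del : `|t| * (2 * (C + 1)) <= del.
  rewrite -ler_pdivlMr//; near: t; apply: (@nbhs0_le R R^o); exact: divr_gt0.
have t_half : `|t| * (2 * (`|l| + e + 1)) <= 1.
  rewrite -ler_pdivlMr; last by lra.
  near: t; apply: (@nbhs0_le R R^o); apply: divr_gt0 => //; lra.
have [->|t0] := eqVneq t 0.
  by rewrite scale0r add0r gy subrr mul0r subr0 normr0 mulr0.
have at0 : 0 < `|t| by rewrite normr_gt0.
(* At the scale 1 + t l + sg e |t| the linear part of [psi] is - sg e |t| d y / s, the part along v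
   - l y being annihilated. Hence [psi] is negative for sg = 1 and positive for sg = -1. *)
have main (sg : R) : `|sg| = 1 ->
    let s := 1 + t * l + sg * e * `|t| in
    0 < s /\ exists2 q, q = psi (o + s^-1 *: (t *: v + y)) &
    U (o + s^-1 *: (t *: v + y)) /\
    `|q + sg * (e * `|t| * d y / s)| <= e * `|t| * d y / s / 2.
  move=> sg1 s.
  have s_half : 1 / 2 <= s.
    have h1 : `|t * l + sg * e * `|t| | <= `|t| * (`|l| + e).
      rewrite (le_trans (ler_normD _ _))// !normrM sg1 mul1r normr_id (gtr0_norm e0).
      by rewrite mulrDr [`|t| * e]mulrC.
    have : `|t| * (`|l| + e) <= 1 / 2 by lra.
    by move: h1; rewrite ler_norml /s => /andP[h1 _]; lra.
  have s0 : 0 < s by lra.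
  split=> //; eexists; first reflexivity.
  pose h := s^-1 *: (t *: (v - l *: y) - (sg * e * `|t|) *: y).
  have -> : o + s^-1 *: (t *: v + y) = p + h.
    have sn : s != 0 by rewrite gt_eqF.
    by apply/rowP => i; rewrite /h yE !mxE; move: sn; rewrite /s => sn; field.
  have hn : `|h| <= `|t| * C / s.
    rewrite /h normrZ gtr0_norm ?invr_gt0// mulrC ler_pM2r ?invr_gt0//.
    rewrite (le_trans (ler_normB _ _))// !normrZ ?normrM sg1 mul1r normr_id (gtr0_norm e0).
    by rewrite /C mulrDr mulrCA mulrA.
  have tCs : `|t| * C / s <= 2 * (`|t| * C).
    rewrite ler_pdivrMr//; have : 0 <= `|t| * C by rewrite mulr_ge0.
    nra.
  have [|Uh hp] := hdel h; first by nra.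
  split=> //.
  have dh : d h = - (sg * (e * `|t| * d y / s)).
    have dlin c z : d (s^-1 *: (t *: (v - l *: z) - c *: z)) =
        s^-1 * (t * (d v - l * d z) - c * d z).
      by rewrite !(dZ, dD, dNeg); ring.
    rewrite /h dlin lE; field.
    by rewrite !gt_eqF.
  move: hp; rewrite psi0 subr0 dh opprK => /le_trans; apply.
  apply: (@le_trans _ _ (e * d y / (2 * (C + 1)) * (`|t| * C / s))).
    by rewrite ler_wpM2l// ltW.
  have -> : e * d y / (2 * (C + 1)) * (`|t| * C / s) =
    (e * `|t| * d y / s / 2) * (C / (C + 1)).
    by field; rewrite !gt_eqF//; lra.
  rewrite ler_piMr//; first by rewrite !mulr_ge0 ?invr_ge0// ltW.
  by rewrite ler_pdivrMr; lra.
have pos s : 0 < s -> 0 < e * `|t| * d y / s by move=> s0; rewrite divr_gt0// !mulr_gt0.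
rewrite ler_norml; apply/andP; split.
  have [|s0 [q qE [Uq hq]]] := main (-1); first by rewrite normrN1.
  rewrite lerNl opprB lerBlDr leNgt; apply/negP => glow.
  have : gauge (translate_to o) (t *: v + y) < 1 + t * l + -1 * e * `|t| by lra.
  move=> /(glt _ _ s0); rewrite /translate_to /= => /(Mpsi _ Uq); rewrite -qE.
  have := pos _ s0; move: hq; rewrite ler_norml => /andP[].
  set z := e * _ * _ / _; lra.
have [|s0 [q qE [Uq hq]]] := main 1; first by rewrite normr1.
rewrite lerBlDr lerBlDr.
have : gauge (translate_to o) (t *: v + y) < 1 + t * l + 1 * e * `|t|; last by lra.
apply/(glt _ _ s0)/(Mpsi _ Uq); rewrite -qE.
have := pos _ s0; move: hq; rewrite ler_norml => /andP[].
set z := e * _ * _ / _; lra.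
Unshelve. all: by end_near. Qed.

End DefiningFunction.
End ConvexDomain.

(** * The divergence theorem for tangential fields *)

Lemma is_derive_lipschitz_le (R : realType) (V : normedModType R) (f : V -> R)
    (x v : V) (l L : R) :
  (forall x y, `|f x - f y| <= L * `|x - y|) -> is_derive x v f l ->
  `|l| <= L * `|v|.
Proof.
move=> fL /is_derive_sequence/cvg_norm h; apply: (cvgr_to_le h); apply: nearW => n.
rewrite normrM ger0_norm//.
have := fL (x + n.+1%:R^-1 *: v) x; rewrite addrAC subrr add0r normrZ ger0_norm ?invr_ge0//.
by rewrite mulrCA -ler_pdivlMl ?invr_gt0 ?ltr0n// invrK.
Qed.

Lemma norm_delta_le1 (R : realType) (n : nat) (k : 'I_n) :
  `|delta_mx 0 k : 'rV[R]_n| <= 1.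
Proof.
apply/rV_norm_le => // j; rewrite mxE; case: (_ && _) => /=.
  by rewrite normr1.
by rewrite normr0.
Qed.

Lemma continuous_of_lipschitz (R : realType) (V : normedModType R) (f : V -> R)
    (L : R) :
  (forall x y, `|f x - f y| <= L * `|x - y|) -> continuous f.
Proof.
move=> fL x; apply/cvgrPdist_le => e e0; near=> y.
have L0 : 0 < `|L| + 1 by rewrite ltr_wpDl.
have xy : `|x - y| <= e / (`|L| + 1).
  by near: y; apply: cvgr_dist_le; [exact: cvg_id|exact: divr_gt0].
apply: le_trans (fL x y) _; move: xy; rewrite ler_pdivlMr// => /(le_trans _); apply.
by rewrite mulrC ler_wpM2l// (le_trans (ler_norm _))// lerDl.
Unshelve. all: by end_near. Qed.

Section DivergenceTheorem.
Variable R : realType.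
Variable M : set 'rV[R]_3.
Hypothesis M_open : open M.
Hypothesis M_bounded : bounded_set M.
Hypothesis M_convex : convex_set M.
Hypothesis M_smooth : smooth_boundary M.
Implicit Types (x y v w p : 'rV[R]_3) (s t : R).

Section Centre.
Variable o : 'rV[R]_3.
Hypothesis Mo : M o.

Let phi x := gauge (translate_to M o) (x - o).

Let K0 : translate_to M o 0. Proof. by rewrite /translate_to /= addr0. Qed.

Variables r B : R.
Hypothesis r_gt0 : 0 < r.
Hypothesis rM : forall y, `|y| < r -> translate_to M o y.
Hypothesis BM : forall y, translate_to M o y -> `|y| <= B.

Let Kopen := @translate_to_open R M M_open o.
Let Kconvex := @translate_to_convex R M M_convex o.

Lemma centred_gauge_lt1 x : phi x < 1 <-> M x.
Proof.
rewrite /phi (gauge_lt1 Kopen K0 Kconvex r_gt0 rM) /translate_to /=.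
by rewrite addrC subrK.
Qed.

Lemma centred_gauge_lipschitz x y : `|phi x - phi y| <= r^-1 * `|x - y|.
Proof.
have := gauge_lipschitz Kopen K0 Kconvex r_gt0 rM (x - o) (y - o).
by rewrite opprB addrA subrK.
Qed.

(** The point p is the radial projection of x from o. By homogeneity the gauge has the same gradient
    at x and at p, where it is a multiple of the normal; and x - p is phi x - 1 times the vector p -
    o, whose norm is at most B. *)
Lemma centred_gauge_gradient x : x != o -> exists p, [/\ boundary M p,
  `|x - p| <= B * `|1 - phi x| &
  exists (l : 'I_3 -> R) N c, [/\ unit_normal M p N,
    forall k, is_derive x (delta_mx 0 k) phi (l k) &
    forall k, l k = c * N 0 k]].
Proof.
move=> xo; pose y := x - o; pose g := gauge (translate_to M o) y.
have y0 : 0 < `|y| by rewrite normr_gt0 subr_eq0.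
have B0 : 0 <= B by apply: le_trans (BM K0).
have yg := norm_le_gauge Kopen K0 Kconvex r_gt0 rM BM y.
have g0 : 0 < g.
  rewrite lt_neqAle (gauge_ge0 r_gt0 rM) andbT eq_sym; apply/eqP => gE.
  by move: yg; rewrite -/g gE mulr0; lra.
pose z := g^-1 *: y.
have gz : gauge (translate_to M o) z = 1.
  by rewrite (gauge_homo Kopen K0 Kconvex r_gt0 rM) ?invr_gt0// mulVf ?gt_eqF.
have yE : y = g *: z by rewrite /z scalerA mulfV ?gt_eqF// scale1r.
have bp := gauge_boundary M_open M_convex Mo gz.
have [U [psi psiP]] := M_smooth bp.
exists (o + z); split=> //.
  have -> : x - (o + z) = (g - 1) *: z.
    by rewrite scalerBl scale1r -yE /y opprD addrA.
  rewrite normrZ [`|g - 1|]distrC mulrC -/y -/g ler_wpM2r//.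
  by have := norm_le_gauge Kopen K0 Kconvex r_gt0 rM BM z; rewrite gz mulr1.
pose G := gradient psi (o + z).
have G0 : enorm G != 0.
  have [_ Up _ /(_ _ Up) nz _] := psiP; apply: contra_neq nz => /eqP.
  rewrite /enorm sqrtr_eq0 => G0.
  have : \sum_j G 0 j ^+ 2 = 0.
    by apply/le_anti; rewrite G0 sumr_ge0// => i _; exact: sqr_ge0.
  move=> /eqP; rewrite psumr_eq0 => [/allP h|i _]; last exact: sqr_ge0.
  apply/rowP => i; rewrite [RHS]mxE; apply/eqP; rewrite -sqrf_eq0.
  by apply: (h i); rewrite mem_index_enum.
pose D := \sum_i z 0 i * partial i psi (o + z).
have D0 : 0 < D.
  have := defining_function_transversal M_open M_convex bp psiP Mo.
  by rewrite addrAC subrr add0r.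
exists (fun k => partial k psi (o + z) / D), ((enorm G)^-1 *: G), (enorm G / D).
split; first by exists U, psi.
  move=> k; have := is_derive_gauge_boundary M_open M_convex bp psiP (delta_mx 0 k) Mo.
  rewrite addrAC subrr add0r -/D (_ : \sum_i _ = partial k psi (o + z)); last first.
    rewrite (bigD1 k)//= big1 ?addr0 => [|i ik]; rewrite mxE eqxx /= ?eqxx ?mul1r//.
    by rewrite (negbTE ik) mul0r.
  (* An increment h v at y corresponds to h g^-1 v at z and the gauge is multiplied by g, so the two
     factors cancel. *)
  move=> /(is_derive_scaled g^-1)/is_derive_line dz; apply/is_derive_line.
  have := is_deriveZ g dz.
  rewrite [g *: _]mulrA mulfV ?gt_eqF// mul1r; congr is_derive.
  apply/funext => h.
  transitivity (g * gauge (translate_to M o) (h *: (g^-1 *: delta_mx 0 k) + z)).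
    by [].
  rewrite /phi -(gauge_homo Kopen K0 Kconvex r_gt0 rM)//; congr gauge.
  rewrite scalerDr -yE /y addrA; congr (_ + _ + _).
  by rewrite !scalerA; congr (_ *: _); field; rewrite gt_eqF.
by move=> k; rewrite !mxE; field; rewrite G0 gt_eqF.
Qed.

Section CutoffFamily.
Variable V : 'I_3 -> 'rV[R]_3 -> R.
Hypothesis V_C1 : forall k, C1 (V k).
Hypothesis V_tangent : forall p N, boundary M p -> unit_normal M p N ->
  \sum_k V k p * N 0 k = 0.

Let e_ k : 'rV[R]_3 := delta_mx 0 k.

(** The index is at least 2 so that [chi m] is constant where phi is at most 1/2, in particular near
    o, where the gauge is not differentiated. *)
Let chi m x := profile m.+2 (phi x).

Let dchi m k x := profile' m.+2 (phi x) * 'D_(e_ k) phi x.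

Let phi_o : phi o = 0.
Proof. by rewrite /phi subrr (gauge0 r_gt0 rM). Qed.

Let is_derive_chi m k x : is_derive x (e_ k) (chi m) (dchi m k x).
Proof.
(* At o the value of the directional derivative of phi is immaterial, because its factor [profile']
   vanishes there. *)
have [->|xo] := eqVneq x o.
  rewrite /dchi phi_o (profile_le _).2 ?mul0r//; last first.
    by rewrite mulr0 subr_ge0 ler1n.
  apply: near_eq_is_derive (is_derive_cst (1 : R) o (e_ k)).
  near=> y; rewrite /chi (profile_le _).1//.
  have yr : `|o - y| <= r / 2.
    by near: y; apply: cvgr_dist_le; [exact: cvg_id|exact: divr_gt0].
  have := centred_gauge_lipschitz y o; rewrite phi_o subr0 distrC => h.
  have py : phi y <= 1 / 2.
    apply: le_trans (ler_norm _) _; apply: le_trans h _.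
    by rewrite ler_pdivrMl// mulrC mul1r mulrC.
  have m2 : m.+2%:R = m%:R + 2 :> R by rewrite -addn2 natrD.
  have m0 : 0 <= m%:R :> R by [].
  by rewrite m2; nra.
have [p [_ _ [l [N [c [_ dphi _]]]]]] := centred_gauge_gradient xo.
have [d1 d2] := dphi k.
rewrite /dchi /e_ d2.
exact: (is_derive_comp_real (dphi k) (@is_derive_profile R m.+2 (phi x))).
Unshelve. all: by end_near. Qed.

Let chi_out m x : ~ M x -> chi m x = 0 /\ forall k, dchi m k x = 0.
Proof.
move=> nMx; have p1 : 1 <= phi x.
  by rewrite leNgt; apply/negP => /centred_gauge_lt1.
have [c0 c1] := @profile_ge1 R m.+2 isT _ p1.
by split=> // k; rewrite /dchi c1 mul0r.
Qed.

Let chi_in x : M x -> \forall m \near \oo,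
  chi m x = 1 /\ forall k, dchi m k x = 0.
Proof.
move=> /centred_gauge_lt1; rewrite -subr_gt0 => p1.
near=> m.
have h : 1 / (1 - phi x) <= m%:R.
  by near: m; exact: nbhs_infty_ger.
have [|c0 c1] := @profile_le R m.+2 (phi x).
  have m2 : m.+2%:R = m%:R + 2 :> R by rewrite -addn2 natrD.
  by move: h; rewrite ler_pdivrMr// m2; nra.
by split=> // k; rewrite /dchi c1 mul0r.
Unshelve. all: by end_near. Qed.

Let gradient_bound k x l : is_derive x (e_ k) phi l -> `|l| <= r^-1.
Proof.
move=> /(is_derive_lipschitz_le centred_gauge_lipschitz) /le_trans; apply.
by rewrite ler_piMr ?invr_ge0 ?norm_delta_le1// ltW.
Qed.

(* On [M] the vector [V x] differs from the value of [V] at the radial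
   projection [p] of [x], which is orthogonal to the gradient of the gauge, by
   [O(1 - phi x)]; this compensates the growth of [profile']. *)
Let tangential_bound : exists2 C, 0 <= C & forall m x,
  `|\sum_k V k x * dchi m k x| <= C.
Proof.
have B0 : 0 <= B by apply: le_trans (BM K0).
pose A := `|o| + B.
have MA x : phi x <= 1 -> `|x| <= A.
  move=> px; rewrite /A -[x in `|x|](subrK o) addrC (le_trans (ler_normD _ _))// lerD2l.
  have := norm_le_gauge Kopen K0 Kconvex r_gt0 rM BM (x - o).
  by move/le_trans; apply; rewrite ler_piMr.
have /choice[L hL] : forall k, exists L, 0 <= L /\
    forall x y, `|x| <= A -> `|y| <= A -> `|V k x - V k y| <= L * `|x - y|.
  by move=> k; have [L L0 hL] := C1_lipschitz_ball A (V_C1 k); exists L.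
exists (4 * (\sum_k L k * B * r^-1)) => [|m x].
  rewrite mulr_ge0// sumr_ge0// => k _; rewrite !mulr_ge0 ?invr_ge0//; last exact: ltW.
  by case: (hL k).
have S0 : 0 <= \sum_k L k * B * r^-1.
  rewrite sumr_ge0// => k _; rewrite !mulr_ge0 ?invr_ge0//; last exact: ltW.
  by case: (hL k).
have zero : \sum_k V k x * dchi m k x = 0 -> `|\sum_k V k x * dchi m k x| <= 4 * \sum_k L k * B * r^-1.
  by move=> ->; rewrite normr0 mulr_ge0.
have [xo|xo] := eqVneq x o.
  apply: zero; apply: big1 => k _; rewrite xo /dchi phi_o (profile_le _).2 ?mul0r ?mulr0//.
have [nMx|px] := leP 1 (phi x).
  apply: zero; apply: big1 => k _; rewrite (chi_out m _).2 ?mulr0//.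
  by move=> /centred_gauge_lt1; rewrite ltNge nMx.
have [p [bp xp [l [N [c [uN dphi lN]]]]]] := centred_gauge_gradient xo.
have pA : `|p| <= A.
  apply: MA; apply: (gauge_closure M_open M_convex Mo).
  by have [] := (boundaryP M_open p).1 bp.
have -> : \sum_k V k x * dchi m k x =
    profile' m.+2 (phi x) * \sum_k (V k x - V k p) * l k.
  have t0 : \sum_k V k p * l k = 0.
    under eq_bigr do rewrite lN mulrCA.
    by rewrite -mulr_sumr (V_tangent bp uN) mulr0.
  under [in RHS]eq_bigr do rewrite mulrBl.
  rewrite sumrB t0 subr0 mulr_sumr; apply: eq_bigr => k _.
  by have [_ dk] := dphi k; rewrite /dchi /e_ dk mulrCA.
rewrite normrM.
have : `|\sum_k (V k x - V k p) * l k| <= `|1 - phi x| * \sum_k L k * B * r^-1.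
  rewrite (le_trans (ler_norm_sum _ _ _))// mulr_sumr ler_sum// => k _.
  rewrite normrM mulrA ler_pM//; last exact: gradient_bound (dphi k).
  have [Lk hk] := hL k; apply: le_trans (hk _ _ (MA _ (ltW px)) pA) _.
  by rewrite mulrCA ler_wpM2l// mulrC.
move=> h; apply: le_trans (ler_wpM2l (normr_ge0 _) h) _.
rewrite mulrA ler_wpM2r//; exact: profile'_edge.
Qed.

(** Each [chi m] times V k is Lipschitz with bounded support, so its derivatives integrate to zero.
    As m grows, the term with the divergence of V tends to the integrand, while the term with the
    gradient of [chi m] is bounded and, at each point, eventually zero. *)
Lemma tangential_divergence_centred :
  vint (fun x => (\sum_k partial k (V k) x) * \1_M x) = 0.
Proof.
have B0 : 0 <= B by apply: le_trans (BM K0).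
have [C C0 hC] := tangential_bound.
pose A := `|o| + B.
have MA x : M x -> `|x| <= A.
  move=> /centred_gauge_lt1/ltW px.
  rewrite /A -[x in `|x|](subrK o) addrC (le_trans (ler_normD _ _))// lerD2l.
  have := norm_le_gauge Kopen K0 Kconvex r_gt0 rM BM (x - o).
  by move/le_trans; apply; rewrite ler_piMr.
have A0 : 0 <= A by rewrite addr_ge0.
pose h m x := \sum_k (chi m x * partial k (V k) x + V k x * dchi m k x).
have chi01 m x : 0 <= chi m x <= 1 by exact: profile_bounds.
have dchiL m x y : `|chi m x - chi m y| <= 4 * m.+2%:R * r^-1 * `|x - y|.
  apply: le_trans (@profile_lipschitz R m.+2 isT _ _) _.
  by rewrite -(mulrA (4 * _)) ler_wpM2l ?mulr_ge0// centred_gauge_lipschitz.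
have chi_cont m : continuous (chi m).
  exact: continuous_of_lipschitz (dchiL m).
have chi_bs m : bounded_support (chi m).
  split; first exact: measurable_vec_continuous.
  exists (A + 1) => x; have /andP[c0 c1] := chi01 m x; rewrite ger0_norm//.
  split; first by rewrite (le_trans c1)// lerDr.
  move=> Ax; apply: (chi_out m _).1 => /MA; lra.
have G_bs m k : bounded_support (fun x => chi m x * V k x).
  by apply: bounded_supportM => //; exact: C1_continuous.
have dG m k x : is_derive x (e_ k) (fun x => chi m x * V k x)
    (chi m x * partial k (V k) x + V k x * dchi m k x).
  have dV : is_derive x (e_ k) (V k) (partial k (V k) x).
    by apply/derivableP/diff_derivable; exact: (V_C1 k).1.
  exact: is_deriveM (is_derive_chi m k x) dV.
have G_lip m k : exists L, forall x y,
    `|chi m x * V k x - chi m y * V k y| <= L * `|x - y|.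
  have [L L0 hL] := C1_lipschitz_ball A (V_C1 k).
  have [D D0 hD] := continuous_bounded_ball A (C1_continuous (V_C1 k)).
  have N0 : 0 <= 4 * m.+2%:R * r^-1 by rewrite !mulr_ge0 ?invr_ge0// ltW.
  exists (L + 4 * m.+2%:R * r^-1 * D).
  (* The product is split so that V k is evaluated alone only at x in M, where it is bounded, and
     its increment carries the factor [chi m y], which vanishes unless y is in M too. *)
  have key x y : M x ->
      `|chi m x * V k x - chi m y * V k y| <= (L + 4 * m.+2%:R * r^-1 * D) * `|x - y|.
    move=> Mx; have xA := MA _ Mx; have /andP[c0 c1] := chi01 m y.
    rewrite (_ : _ - _ = chi m y * (V k x - V k y) + (chi m x - chi m y) * V k x); last by ring.
    apply: (@le_trans _ _ (chi m y * `|V k x - V k y| + `|chi m x - chi m y| * `|V k x|)).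
      apply: le_trans (ler_normD _ _) _; rewrite lerD// ?(normrM (chi m y)) ?(normrM (chi m x - chi m y))//.
      by rewrite ler_wpM2r// ger0_norm.
    rewrite [leRHS]mulrDl lerD//.
      have [My|nMy] := pselect (M y).
        apply: (@le_trans _ _ (1 * `|V k x - V k y|)); first by rewrite ler_wpM2r.
        by rewrite mul1r hL// MA.
      by rewrite (chi_out m nMy).1 mul0r mulr_ge0.
    rewrite mulrAC; apply: ler_pM => //; exact: hD.
  move=> x y; have [Mx|nMx] := pselect (M x); first exact: key.
  have [My|nMy] := pselect (M y); first by rewrite distrC [`|x - y|]distrC; exact: key.
  rewrite (chi_out m nMx).1 (chi_out m nMy).1 !mul0r subrr normr0 mulr_ge0//.
  by rewrite addr_ge0// mulr_ge0.
have G_div m k : bounded_support (fun x => chi m x * partial k (V k) x + V k x * dchi m k x)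
    /\ vint (fun x => chi m x * partial k (V k) x + V k x * dchi m k x) = 0.
  have [L hL] := G_lip m k.
  apply: (@vint_directional_derivative R (e_ k) L (fun x => chi m x * V k x)) => //.
  exact: continuous_of_lipschitz hL.
have step m : vint (h m) = 0.
  rewrite /h vint_sum => [|k]; last by case: (G_div m k).
  by apply: big1 => k _; case: (G_div m k).
have [D D0 hD] : exists2 D, 0 <= D & forall x, M x ->
    `|\sum_k partial k (V k) x| <= D.
  have /choice[D hD] : forall k, exists D, 0 <= D /\
      forall x, `|x| <= A -> `|partial k (V k) x| <= D.
    by move=> k; have [D D0 hD] := continuous_bounded_ball A ((V_C1 k).2 k); exists D.
  exists (\sum_k D k) => [|x Mx]; first by rewrite sumr_ge0// => k _; case: (hD k).
  rewrite (le_trans (ler_norm_sum _ _ _))// ler_sum// => k _.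
  by apply: (hD k).2; exact: MA.
have hE m x : h m x = chi m x * (\sum_k partial k (V k) x) + \sum_k V k x * dchi m k x.
  by rewrite /h big_split mulr_sumr.
apply: (@vint_dominated0 R (A + D + C) h) => //.
- by move=> m; apply: (bounded_support_sum (index_enum 'I_3) (fun k => (G_div m k).1)).1.
- move=> m x; have [Mx|nMx] := pselect (M x).
    split; last by have := MA x Mx; lra.
    rewrite hE (le_trans (ler_normD _ _))// -addrA ler_wpDl// lerD//.
    rewrite normrM; have /andP[c0 c1] := chi01 m x; rewrite ger0_norm//.
    by rewrite (le_trans _ (hD x Mx))// ler_piMl.
  have [c0 c1] := chi_out m nMx; rewrite /h big1 ?normr0.
    by split=> //; rewrite !addr_ge0.
  by move=> k _; rewrite c0 c1 mul0r mulr0 addr0.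
- move=> x; have [Mx|nMx] := pselect (M x).
    rewrite indicE mem_set// mulr1.
    apply: cvg_near_cst.
    apply: filterS (chi_in Mx) => m [c0 c1].
    by rewrite hE c0 mul1r [X in _ + X]big1 ?addr0// => k _; rewrite c1 mulr0.
  rewrite indicE memNset// mulr0 (_ : (fun m => h m x) = cst 0); first exact: cvg_cst.
  apply/funext => m; have [c0 c1] := chi_out m nMx.
  by rewrite /h big1// => k _; rewrite c0 c1 mul0r mulr0 addr0.
Qed.

End CutoffFamily.
End Centre.
End DivergenceTheorem.

Theorem tangential_divergence (R : realType) (M : set 'rV[R]_3)
    (V : 'I_3 -> 'rV[R]_3 -> R) :
  is_domain M -> bounded_set M -> convex_set M -> smooth_boundary M ->
  (forall k, C1 (V k)) ->
  (forall p N, boundary M p -> unit_normal M p N -> \sum_k V k p * N 0 k = 0) ->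
  vint (fun x => (\sum_k partial k (V k) x) * \1_M x) = 0.
Proof.
move=> [oM [q Mq] _] hbM cM sM VC1 Vt.
have [r r0 rM] := translate_to_ball oM Mq.
have [B BM] := translate_to_bounded hbM q.
exact: (tangential_divergence_centred oM cM sM Mq r0 rM BM VC1 Vt).
Qed.

(** * Polynomial moments *)

Lemma poly_coefficients_eq0 (R : numDomainType) (n : nat) (c : 'I_n.+1 -> R) :
  (forall s : R, \sum_i c i * s ^+ i = 0) -> forall i, c i = 0.
Proof.
move=> h i; pose p := \poly_(j < n.+1) c (inord j).
have p0 : p = 0.
  (* The naturals 0, ..., n are n + 1 distinct roots, too many for the degree. *)
  apply: (@roots_geq_poly_eq0 _ _ [seq j%:R | j <- iota 0 n.+1]).
  - apply/allP => s _; apply/eqP; rewrite horner_poly -[RHS](h s).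
    by apply: eq_bigr => j _; rewrite inord_val.
  - by rewrite map_inj_uniq ?iota_uniq//; exact: mulrIn (oner_neq0 R).
  - by rewrite size_map size_iota size_poly.
have := coef_poly n.+1 (fun j => c (inord j)) i.
by rewrite -/p p0 coef0 ltn_ord inord_val.
Qed.

Lemma expr_ge_linear (R : numDomainType) (x : R) (n : nat) : 0 <= x ->
  n%:R * x <= (1 + x) ^+ n.
Proof.
move=> x0; suff : 1 + n%:R * x <= (1 + x) ^+ n by apply: le_trans; rewrite lerDr.
elim: n => [|n ih]; first by rewrite mul0r addr0 expr0.
rewrite exprS (le_trans _ (ler_wpM2l _ ih)) ?addr_ge0//.
rewrite -subr_ge0 -natr1 (_ : _ - _ = n%:R * x * x); last by ring.
by rewrite !mulr_ge0.
Qed.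

Section Moments.
Variable R : realType.
Implicit Types (f u v : 'rV[R]_3 -> R) (x y p : 'rV[R]_3).

(** Polynomials are presented by generation instead of coefficients, so that facts about them follow
    by structural induction. *)
Inductive polyfun : ('rV[R]_3 -> R) -> Prop :=
| polyfun_cst c : polyfun (fun=> c)
| polyfun_coord i : polyfun (fun x => x 0 i)
| polyfunD u v : polyfun u -> polyfun v -> polyfun (fun x => u x + v x)
| polyfunM u v : polyfun u -> polyfun v -> polyfun (fun x => u x * v x).

Lemma polyfunX u n : polyfun u -> polyfun (fun x => u x ^+ n).
Proof.
move=> pu; elim: n => [|n ih].
  by under eq_fun do rewrite expr0; exact: polyfun_cst.
by under eq_fun do rewrite exprS; exact: polyfunM.
Qed.

Lemma polyfun_sum (I : Type) (r : seq I) (F : I -> 'rV[R]_3 -> R) :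
  (forall i, polyfun (F i)) -> polyfun (fun x => \sum_(i <- r) F i x).
Proof.
move=> pF; elim: r => [|i r ih].
  by under eq_fun do rewrite big_nil; exact: polyfun_cst.
by under eq_fun do rewrite big_cons; exact: polyfunD.
Qed.

Lemma polyfun_continuous u : polyfun u -> continuous u.
Proof.
elim=> [c|i|v w _ cv _ cw|v w _ cv _ cw].
- exact: cst_continuous.
- exact: coord_continuous.
- by move=> x; exact: (continuousD (cv x) (cw x)).
- by move=> x; exact: (continuousM (cv x) (cw x)).
Qed.

Definition monomial i j k x : R := x 0 0 ^+ i * x 0 1 ^+ j * x 0 2%:R ^+ k.

Lemma polyfun_monomial i j k : polyfun (monomial i j k).
Proof. by do ![apply: polyfunM]; apply: polyfunX; exact: polyfun_coord. Qed.

(** The induction on u needs an accumulated factor v: if f v has vanishing monomial moments, so has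
    f v u. The case of a coordinate raises one exponent, and that of a product applies the two
    hypotheses in turn. *)
Lemma polynomial_moments_eq0 f u : bounded_support f ->
  (forall i j k, vint (fun x => f x * monomial i j k x) = 0) ->
  polyfun u -> vint (fun x => f x * u x) = 0.
Proof.
move=> bf f0 pu.
suff h v : polyfun v -> (forall i j k, vint (fun x => f x * v x * monomial i j k x) = 0) ->
    forall i j k, vint (fun x => f x * (v x * u x) * monomial i j k x) = 0.
  have := h (fun=> 1) (polyfun_cst 1) _ 0 0 0; rewrite /monomial => /(_ _) h1.
  rewrite -[RHS]h1 => [|i j k].
    by congr vint; apply/funext => x; rewrite !expr0 !mulr1 mul1r.
  by rewrite -[RHS](f0 i j k); congr vint; apply/funext => x; rewrite mulr1.
have bfp w : polyfun w -> bounded_support (fun x => f x * w x).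
  by move=> pw; apply: bounded_supportM => //; exact: polyfun_continuous.
elim: pu v => {u}.
- move=> c v pv v0 i j k.
  rewrite (_ : (fun x => _) = (fun x => c * (f x * v x * monomial i j k x))); last first.
    by apply/funext => x; ring.
  rewrite vintZ ?v0 ?mulr0//; apply: bounded_supportM; first exact: bfp.
  exact/polyfun_continuous/polyfun_monomial.
- move=> a v pv v0 i j k.
  have : [\/ a = 0, a = 1 | a = 2%:R].
    case: a => -[|[|[|//]]] la; [apply: Or31|apply: Or32|apply: Or33]; exact/val_inj.
  case=> ->.
  + rewrite -[RHS](v0 i.+1 j k); congr vint; apply/funext => x.
    by rewrite /monomial exprS; ring.
  + rewrite -[RHS](v0 i j.+1 k); congr vint; apply/funext => x.
    by rewrite /monomial exprS; ring.
  + rewrite -[RHS](v0 i j k.+1); congr vint; apply/funext => x.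
    by rewrite /monomial exprS; ring.
- move=> u w pu hu pw hw v pv v0 i j k.
  rewrite (_ : (fun x => _) = (fun x => f x * (v x * u x) * monomial i j k x
      + f x * (v x * w x) * monomial i j k x)); last first.
    by apply/funext => x; ring.
  rewrite vintD ?hu ?hw ?addr0//; apply: bounded_supportM;
    [|exact/polyfun_continuous/polyfun_monomial| |exact/polyfun_continuous/polyfun_monomial];
    exact/bfp/polyfunM.
- move=> u w pu hu pw hw v pv v0 i j k.
  rewrite -[RHS](hw (fun x => v x * u x) (polyfunM pv pu) (hu v pv v0) i j k).
  by congr vint; apply/funext => x; rewrite !mulrA.
Qed.

(** The hypothesis is a polynomial identity in s whose coefficients are the mixed moments times
    binomial coefficients, which are nonzero. *)
Lemma binomial_moments_eq0 f u v n : bounded_support f -> polyfun u -> polyfun v ->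
  (forall s : R, vint (fun x => f x * (u x + s * v x) ^+ n) = 0) ->
  forall a b, (a + b)%N = n -> vint (fun x => f x * (u x ^+ a * v x ^+ b)) = 0.
Proof.
move=> bf pu pv h a b abn.
have pm i j : bounded_support (fun x => f x * (u x ^+ i * v x ^+ j)).
  apply: bounded_supportM => //.
  by apply/polyfun_continuous/polyfunM; exact: polyfunX.
pose c (i : 'I_n.+1) := 'C(n, i)%:R * vint (fun x => f x * (u x ^+ (n - i) * v x ^+ i)).
have c0 : forall i, c i = 0.
  apply: poly_coefficients_eq0 => s; rewrite -[RHS](h s).
  rewrite (_ : (fun x => _) = (fun x => \sum_(i < n.+1)
      ('C(n, i)%:R * s ^+ i) * (f x * (u x ^+ (n - i) * v x ^+ i)))).
    rewrite vint_sum => [|i]; last exact: bounded_supportZ.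
    by apply: eq_bigr => i _; rewrite vintZ// /c; ring.
  apply/funext => x; rewrite exprDn mulr_sumr; apply: eq_bigr => i _.
  by rewrite exprMn -mulr_natl; ring.
have bn : (b < n.+1)%N by rewrite ltnS -abn leq_addl.
have := c0 (Ordinal bn); rewrite /c /= -abn addnK => /eqP.
rewrite mulf_eq0 pnatr_eq0 eqn0Ngt bin_gt0 leq_addl /= => /eqP //.
Qed.

(** Polarization in two rounds: varying s isolates the power of x0, then varying t separates x1 from
    x2. *)
Lemma linear_form_moments_eq0 f : bounded_support f ->
  (forall (s t : R) n,
     vint (fun x => f x * (s * x 0 0 + t * x 0 1 + x 0 2%:R) ^+ n) = 0) ->
  forall i j k, vint (fun x => f x * monomial i j k x) = 0.
Proof.
move=> bf h i j k.
have pc := polyfun_coord.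
have h1 t : vint (fun x => f x * x 0 0 ^+ i * (x 0 2%:R + t * x 0 1) ^+ (k + j)) = 0.
  have := @binomial_moments_eq0 f (fun x => x 0 2%:R + t * x 0 1) (fun x => x 0 0)
    ((k + j) + i) bf.
  move=> /(_ (polyfunD (pc _) (polyfunM (polyfun_cst t) (pc _))) (pc _)).
  move=> /(_ _ (k + j)%N i erefl) => H; rewrite -[RHS]H => [|s].
    by congr vint; apply/funext => x; ring.
  rewrite -[RHS](h s t (k + j + i)%N); congr vint; apply/funext => x.
  by congr (_ * _ ^+ _); ring.
have bf' : bounded_support (fun x => f x * x 0 0 ^+ i).
  by apply: bounded_supportM => //; exact/polyfun_continuous/polyfunX/pc.
have := binomial_moments_eq0 bf' (pc 2%:R) (pc 1) h1 erefl => <-.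
by congr vint; apply/funext => x; rewrite /monomial; ring.
Qed.

End Moments.

(** * Polynomial moments determine a function at its points of continuity *)

Section Determinacy.
Variable R : realType.
Implicit Types (f u v : 'rV[R]_3 -> R) (x y p : 'rV[R]_3).

Lemma le_vint f u : bounded_support f -> bounded_support u ->
  (forall x, f x <= u x) -> vint f <= vint u.
Proof.
by move=> bf bu fu; apply: le_Rintegral => //; exact: bounded_support_integrable.
Qed.

Lemma bounded_support_ball p (d : R) : bounded_support (fun x => 1 * \1_(ball p d) x).
Proof.
apply: (@bounded_support_zero_ext _ (ball p d) (fun=> 1)).
- exact: ball_open.
- exists (`|p| + d); split; first exact: num_real.
  move=> r dr x; rewrite -ball_normE /ball_ /= => px.
  by have := ler_normB p (p - x); rewrite opprB addrC subrK; lra.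
- exact: cst_continuous.
Qed.

(** In the sup norm the ball is a cube of side 2 d, so its measure is a product. *)
Lemma vint_ball_gt0 p (d : R) : 0 < d -> 0 < vint (fun x => 1 * \1_(ball p d) x).
Proof.
move=> d0; have bE : @vec R @^-1` (ball p d) = (ball (p 0 0) d : set (measurableTypeR R)) `*`
    ((ball (p 0 1) d : set (measurableTypeR R)) `*` (ball (p 0 2%:R) d : set (measurableTypeR R))).
  apply/seteqP; split=> z; rewrite -!ball_normE /ball_ /=.
    move=> pz; rewrite -!(vecE z).
    have h j : `|p 0 j - vec z 0 j| < d.
      by apply: le_lt_trans pz; have := rV_coord_le (p - vec z) j; rewrite !mxE.
    by split; [exact: h|split; exact: h].
  move=> [z0 [z1 z2]].
  pose m := Num.max `|p 0 0 - z.1| (Num.max `|p 0 1 - z.2.1| `|p 0 2%:R - z.2.2|).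
  have m0 : 0 <= m by rewrite le_max normr_ge0.
  apply: (@le_lt_trans _ _ m); last by rewrite /m !gt_max z0 z1 z2.
  apply/(rV_norm_le _ m0) => j.
  have : [\/ j = 0, j = 1 | j = 2%:R].
    case: j => -[|[|[|//]]] la; [apply: Or31|apply: Or32|apply: Or33]; exact/val_inj.
  by case=> ->; rewrite mxE [X in _ + X]mxE vecE /m !le_max lexx ?orbT.
have mb (a : R) : measurable (ball a d : set (measurableTypeR R)) by exact: measurable_ball.
rewrite /vint /Rintegral.
rewrite (_ : (fun z => _) = (fun z => (\1_(@vec R @^-1` (ball p d)) z)%:E)); last first.
  by apply/funext => z /=; rewrite mul1r.
rewrite integral_indic//; last by rewrite bE; do ![apply: measurableX].
have l2 : leb2 ((ball (p 0 1) d : set (measurableTypeR R)) `*`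
    (ball (p 0 2%:R) d : set (measurableTypeR R))) = ((2 * d) * (2 * d))%:E.
  rewrite /leb2 product_measure1E//= !lebesgue_measure_ball ?ltW// -EFinM.
  by congr (_%:E); ring.
have l3 : leb3 ((ball (p 0 0) d : set (measurableTypeR R)) `*`
    ((ball (p 0 1) d : set (measurableTypeR R)) `*`
    (ball (p 0 2%:R) d : set (measurableTypeR R)))) = ((2 * d) * ((2 * d) * (2 * d)))%:E.
  rewrite /leb3 product_measure1E//=; last exact: measurableX.
  rewrite lebesgue_measure_ball ?ltW// [X in (_ * X)%E]l2 -EFinM.
  by congr (_%:E); ring.
rewrite setIT bE [X in fine X]l3 /=.
by rewrite !mulr_gt0.
Qed.

(** By symmetry it is enough to exclude a positive value at p. There g exceeds eps near p, and the
    powers of a quadratic q peaking at p make this contribution grow geometrically faster than what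
    the rest of the support can offset. *)
Lemma determined_by_moments f p : bounded_support f -> {for p, continuous f} ->
  (forall u, polyfun u -> vint (fun x => f x * u x) = 0) -> f p = 0.
Proof.
suff main g : bounded_support g -> {for p, continuous g} ->
    (forall u, polyfun u -> vint (fun x => g x * u x) = 0) -> g p <= 0.
  move=> bf cf f0; apply/le_anti; rewrite main//=.
  rewrite -oppr_le0; apply: (main (fun x => - f x)).
  - have := bounded_supportZ (-1) bf.
    by congr bounded_support; apply/funext => x; rewrite mulN1r.
  - exact: continuousN.
  - move=> u pu; have := f0 _ (polyfunM (polyfun_cst (-1)) pu) => <-.
    by congr vint; apply/funext => x; ring.
move=> bg cg g0; rewrite leNgt; apply/negP => gp.
have [mg [A gA]] := bg.
have A0 : 0 <= A by apply: le_trans (gA 0).1.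
pose eps := g p / 2.
have eps0 : 0 < eps by rewrite divr_gt0.
have [del del0 hdel] : exists2 del, 0 < del & forall x, `|p - x| < del -> eps <= g x.
  have : \forall x \near p, eps <= g x.
    have e1 : eps < g p by rewrite /eps; lra.
    by apply: filterS (cvgr_gt _ cg _ e1) => x /ltW.
  by move=> /nbhs_ballP[d d0]; rewrite -ball_normE => h; exists d.
pose S x := \sum_i (x 0 i - p 0 i) ^+ 2.
(* The first term dominates S on the support, with 3 for the three coordinates, so that q is
   nonnegative there; the others make B larger than del ^ 2, so that [q2] is positive. *)
pose B := 3 * (A + `|p|) ^+ 2 + del ^+ 2 + 1.
have B0 : 0 < B.
  by rewrite /B; have := sqr_ge0 (A + `|p|); have := sqr_ge0 del; lra.
pose q x : R := 1 - B^-1 * S x.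
have S3 x c : (forall i, `|x 0 i - p 0 i| <= c) -> S x <= 3 * c ^+ 2.
  move=> h; rewrite /S !big_ord_recl big_ord0.
  have hi i : (x 0 i - p 0 i) ^+ 2 <= c ^+ 2.
    by rewrite -[leLHS]real_normK ?num_real// lerXn2r ?nnegrE// (le_trans _ (h i)).
  have := hi 0; have := hi (lift ord0 ord0); have := hi (lift ord0 (lift ord0 ord0)); lra.
have xp i x : `|x 0 i - p 0 i| <= `|p - x|.
  by rewrite distrC; have := rV_coord_le (p - x) i; rewrite !mxE.
have S_A x : `|x| <= A -> S x <= B.
  move=> xA; apply: (@le_trans _ _ (3 * (A + `|p|) ^+ 2)).
    apply: S3 => i; apply: le_trans (xp i x) _.
    by rewrite (le_trans (ler_normB _ _))// addrC lerD2r.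
  by rewrite /B; have := sqr_ge0 del; lra.
have q_ge0 x : `|x| <= A -> 0 <= q x.
  by move=> /S_A h; rewrite /q subr_ge0 ler_pdivrMl// mulr1.
have pq : polyfun q.
  have -> : q = (fun x => 1 + (- B^-1) * \sum_i (x 0 i + - p 0 i) ^+ 2).
    by apply/funext => x; rewrite /q mulNr.
  apply: polyfunD; first exact: polyfun_cst.
  apply: polyfunM; first exact: polyfun_cst.
  apply: polyfun_sum => i; apply: polyfunX; apply: polyfunD.
    exact: polyfun_coord.
  exact: polyfun_cst.
(* Within del / 4 of p, S is at most 3 del ^ 2 / 16, hence q >= [q1]; at distance del or more some
   coordinate gives S >= del ^ 2, hence q <= [q2]. *)
pose q1 := 1 - B^-1 * (del ^+ 2 / 4); pose q2 := 1 - B^-1 * del ^+ 2.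
have q20 : 0 < q2.
  rewrite subr_gt0 ltr_pdivrMl// mulr1 /B; have := sqr_ge0 (A + `|p|); lra.
have q12 : q2 < q1.
  rewrite ltrD2l ltrN2 ltr_pM2l ?invr_gt0//; have : 0 < del ^+ 2 by rewrite exprn_gt0.
  lra.
have near_q x : `|p - x| < del / 4 -> q1 <= q x.
  move=> h; rewrite lerD2l lerN2 ler_pM2l ?invr_gt0//.
  apply: le_trans (S3 _ (del / 4) _) _; first by move=> i; rewrite (le_trans (xp i x))// ltW.
  have := sqr_ge0 del; rewrite expr_div_n; lra.
have far_q x : del <= `|p - x| -> q x <= q2.
  move=> h; rewrite lerD2l lerN2 ler_pM2l ?invr_gt0//.
  have [i hi] : exists i, del <= `|x 0 i - p 0 i|.
    apply: contrapT => /forallNP no.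
    have : `|p - x| < del; last by rewrite ltNge h.
    rewrite (_ : `|p - x| = mx_norm (p - x))// mx_normrE.
    apply/bigmax_ltP; split=> // -[j i] _; rewrite ord1 !mxE /= distrC.
    by rewrite ltNge; apply/negP/no.
  rewrite /S (bigD1 i)//= -[leLHS]addr0 lerD ?sumr_ge0// => [|j _]; last exact: sqr_ge0.
  by rewrite -[leRHS]real_normK ?num_real// lerXn2r ?nnegrE// ltW.
pose v0 := vint (fun x => 1 * \1_(ball p (del / 4)) x).
pose v1 := vint (fun x => 1 * \1_(ball (0 : 'rV[R]_3) (A + 1)) x).
have v00 : 0 < v0 by apply: vint_ball_gt0; rewrite divr_gt0.
(* The vanishing moment of q ^ n is bounded below by the gain on the small ball minus the largest
   loss away from p; in between the integrand is nonnegative. *)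
have key n : eps * q1 ^+ n * v0 <= A * q2 ^+ n * v1.
  rewrite -subr_le0 -[leRHS](g0 _ (polyfunX n pq)).
  rewrite -!vintZ; try exact: bounded_support_ball.
  rewrite -vintB; try (apply: bounded_supportZ; exact: bounded_support_ball).
  apply: le_vint.
  - by apply: bounded_supportB; apply: bounded_supportZ; exact: bounded_support_ball.
  - by apply: bounded_supportM => //; exact/polyfun_continuous/polyfunX.
  move=> x; rewrite !mul1r !indicE.
  have [xA|xA] := leP `|x| A; last first.
    rewrite (gA x).2// mul0r memNset ?mulr0 ?sub0r ?oppr_le0; last first.
      rewrite -ball_normE /ball_ /= => px.
      have : eps <= g x by apply: hdel; lra.
      by rewrite (gA x).2//; lra.
    by rewrite !mulr_ge0// exprn_ge0// ltW.
  have x1 : ball (0 : 'rV[R]_3) (A + 1) x.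
    by rewrite -ball_normE /ball_ /= sub0r normrN; lra.
  rewrite (mem_set x1) [_ * true%:R]mulr1.
  have qn0 : 0 <= q x ^+ n by rewrite exprn_ge0// q_ge0.
  have q2n : 0 <= A * q2 ^+ n by rewrite mulr_ge0// exprn_ge0// ltW.
  have [px|px] := ltP `|p - x| del; last first.
    rewrite memNset ?mulr0 ?sub0r; last first.
      by rewrite -ball_normE /ball_ /=; lra.
    have : `|g x * q x ^+ n| <= A * q2 ^+ n.
      rewrite normrM ler_pM ?(gA x).1//.
      by rewrite ger0_norm// lerXn2r ?nnegrE ?q_ge0 ?far_q// ltW.
    by rewrite ler_norml => /andP[].
  have gx := hdel x px.
  have [xb|xb] := pselect (ball p (del / 4) x); last first.
    rewrite (memNset xb) mulr0 sub0r (@le_trans _ _ 0) ?oppr_le0//.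
    by rewrite mulr_ge0// (le_trans _ gx)// ltW.
  rewrite (mem_set xb) mulr1 lerBlDr (@le_trans _ _ (g x * q x ^+ n)) ?lerDl//.
  rewrite ler_pM//; [exact: ltW|rewrite exprn_ge0//; lra|].
  have q10 : 0 <= q1 by lra.
  rewrite lerXn2r ?nnegrE// ?q_ge0//; apply: near_q.
  by move: xb; rewrite -ball_normE.
have v1_ge0 : 0 <= v1 by apply: ltW; apply: vint_ball_gt0; lra.
(* Dividing by the n-th power of [q2] leaves (1 + rho) ^ n bounded in n, which the linear lower
   bound for powers contradicts. *)
pose rho := q1 / q2 - 1.
have rho0 : 0 < rho by rewrite subr_gt0 ltr_pdivlMr// mul1r.
have bnd n : n%:R * (eps * v0 * rho) <= A * v1.
  have := key n; rewrite -(@ler_pM2r _ (q2 ^+ n)^-1); last by rewrite invr_gt0 exprn_gt0.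
  have q2n : q2 ^+ n != 0 by rewrite expf_neq0// gt_eqF.
  rewrite (_ : A * _ * _ * _ = A * v1); last by field.
  apply: le_trans.
  rewrite (_ : eps * _ * _ * _ = eps * v0 * (q1 / q2) ^+ n); last first.
    by rewrite expr_div_n; field.
  rewrite (_ : q1 / q2 = 1 + rho); last by rewrite /rho; ring.
  rewrite mulrCA ler_wpM2l//; first by rewrite mulr_ge0// ltW.
  by apply: expr_ge_linear; rewrite ltW.
have c0 : 0 < eps * v0 * rho by rewrite !mulr_gt0.
have := bnd (Num.truncn (A * v1 / (eps * v0 * rho))).+1.
rewrite -ler_pdivlMr// leNgt => /negP; apply; exact: truncnS_gt.
Qed.

End Determinacy.

(** * Injectivity of the ray data *)

(* Writing [u1 = (1,0,-s)] and [u2 = (0,1,-t)] for the basis of the plane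
   orthogonal to [(s,t,1)], the tensor is [N] in this basis and the quadratic
   form evaluated at [u1 + c u2] is [a (G N G) + b tr(N G) G], [G] being the
   Gram matrix. *)
Lemma transverse_tensor_eq0 (R : realFieldType) (a b s t A B C D E F : R) :
  a != 0 -> a + 2 * b != 0 ->
  s * A + t * B + D = 0 -> s * B + t * C + E = 0 -> s * D + t * E + F = 0 ->
  (forall c d, s + t * c + d = 0 ->
    a * (A + c ^+ 2 * C + d ^+ 2 * F + 2 * c * B + 2 * d * D + 2 * c * d * E)
    + b * (1 + c ^+ 2 + d ^+ 2) * (A + C + F) = 0) ->
  [/\ A = 0, B = 0, C = 0 & [/\ D = 0, E = 0 & F = 0]].
Proof.
move=> a0 ab0 hD hE hF q.
have DE : D = - (s * A + t * B) by lra.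
have EE : E = - (s * B + t * C) by lra.
have FE : F = s ^+ 2 * A + 2 * s * t * B + t ^+ 2 * C.
  have -> : F = - (s * D + t * E) by lra.
  by rewrite DE EE; ring.
pose G11 := 1 + s ^+ 2; pose G12 := s * t; pose G22 := 1 + t ^+ 2.
pose g := 1 + s ^+ 2 + t ^+ 2; pose T := A + C + F.
have g0 : g != 0 by rewrite gt_eqF// /g; have := sqr_ge0 s; have := sqr_ge0 t; lra.
pose M11 := G11 ^+ 2 * A + 2 * G11 * G12 * B + G12 ^+ 2 * C.
pose M12 := G11 * G12 * A + (G11 * G22 + G12 ^+ 2) * B + G12 * G22 * C.
pose M22 := G12 ^+ 2 * A + 2 * G12 * G22 * B + G22 ^+ 2 * C.
have form c : a * (M11 + 2 * c * M12 + c ^+ 2 * M22)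
    + b * T * (G11 + 2 * c * G12 + c ^+ 2 * G22) = 0.
  rewrite -[RHS](q c (- (s + t * c))) ?subrr//.
  by rewrite /M11 /M12 /M22 /T DE EE FE /G11 /G12 /G22; ring.
(* Three values of c separate the coefficients of a quadratic polynomial in c. *)
have := form 0; have := form 1; have := form (-1) => f1 f2 f3.
have e11 : a * M11 + b * T * G11 = 0 by lra.
have e12 : a * M12 + b * T * G12 = 0 by lra.
have e22 : a * M22 + b * T * G22 = 0 by lra.
(* The trace in a basis that is not orthonormal: contraction with the adjugate of G, whose
   determinant is g, turns G N G into g T and G into 2 g. *)
have T0 : T = 0.
  have : g * (a + 2 * b) * T = 0.
    transitivity (G22 * (a * M11 + b * T * G11) - 2 * G12 * (a * M12 + b * T * G12)
      + G11 * (a * M22 + b * T * G22)); last by rewrite e11 e12 e22; ring.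
    by rewrite /M11 /M12 /M22 /T FE /G11 /G12 /G22 /g; ring.
  by move/eqP; rewrite !mulf_eq0 (negbTE g0) (negbTE ab0) => /eqP.
have nz x : a * x + b * T * 0 = 0 -> x = 0.
  by rewrite mulr0 addr0 => /eqP; rewrite mulf_eq0 (negbTE a0) => /eqP.
have m11 : M11 = 0 by apply: nz; rewrite -[RHS]e11 T0; ring.
have m12 : M12 = 0 by apply: nz; rewrite -[RHS]e12 T0; ring.
have m22 : M22 = 0 by apply: nz; rewrite -[RHS]e22 T0; ring.
have gz x : g ^+ 2 * x = 0 -> x = 0.
  by move/eqP; rewrite mulf_eq0 sqrf_eq0 (negbTE g0) => /eqP.
(* The entries of N are recovered from G N G by multiplying with the adjugate of G on both sides, at
   the cost of the factor g ^ 2. *)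
have A0 : A = 0.
  apply: gz; transitivity (G22 ^+ 2 * M11 - 2 * G12 * G22 * M12 + G12 ^+ 2 * M22).
    by rewrite /M11 /M12 /M22 /G11 /G12 /G22 /g; ring.
  by rewrite m11 m12 m22; ring.
have B0 : B = 0.
  apply: gz; transitivity (- G12 * G22 * M11 + (G11 * G22 + G12 ^+ 2) * M12 - G11 * G12 * M22).
    by rewrite /M11 /M12 /M22 /G11 /G12 /G22 /g; ring.
  by rewrite m11 m12 m22; ring.
have C0 : C = 0.
  apply: gz; transitivity (G12 ^+ 2 * M11 - 2 * G11 * G12 * M12 + G11 ^+ 2 * M22).
    by rewrite /M11 /M12 /M22 /G11 /G12 /G22 /g; ring.
  by rewrite m11 m12 m22; ring.
by rewrite DE EE FE A0 B0 C0; split=> //; split; ring.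
Qed.

(** * Calculus of fields and of powers of linear forms *)

Section FieldCalculus.
Variable R : realType.
Implicit Types (f g : 'rV[R]_3 -> R) (x y v w p : 'rV[R]_3).

Lemma is_derive_partial f x i : differentiable f x ->
  is_derive x (delta_mx 0 i) f (partial i f x).
Proof. by move=> df; apply/derivableP/diff_derivable. Qed.

Lemma partialM f g x i : differentiable f x -> differentiable g x ->
  partial i (fun y => f y * g y) x = f x * partial i g x + g x * partial i f x.
Proof.
move=> df dg; rewrite /partial.
by have [_ <-] := is_deriveM (is_derive_partial i df) (is_derive_partial i dg).
Qed.

Lemma partialB f g x i : differentiable f x -> differentiable g x ->
  partial i (fun y => f y - g y) x = partial i f x - partial i g x.
Proof.
move=> df dg; rewrite /partial.
by have [_ <-] := is_deriveB (is_derive_partial i df) (is_derive_partial i dg).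
Qed.

Lemma C1M f g : C1 f -> C1 g -> C1 (fun x => f x * g x).
Proof.
move=> Cf Cg; have [df cf] := Cf; have [dg cg] := Cg.
split=> [x|i x]; first exact: differentiableM.
have -> : partial i (fun y => f y * g y) = (f \* partial i g) + (g \* partial i f).
  by apply/funext => y; rewrite partialM.
apply: continuousD; apply: continuousM; [|exact: cg| |exact: cf];
exact: C1_continuous.
Qed.

Lemma C1B f g : C1 f -> C1 g -> C1 (fun x => f x - g x).
Proof.
move=> [df cf] [dg cg]; split=> [x|i x]; first exact: differentiableB.
have -> : partial i (fun y => f y - g y) = partial i f - partial i g.
  by apply/funext => y; rewrite partialB.
by apply: continuousB; [exact: cf|exact: cg].
Qed.

Definition dot (xi x : 'rV[R]_3) : R := \sum_i xi 0 i * x 0 i.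

Lemma dotD xi x y : dot xi (x + y) = dot xi x + dot xi y.
Proof. by rewrite /dot -big_split; apply: eq_bigr => i _; rewrite mxE mulrDr. Qed.

Lemma dotZ xi x (k : R) : dot xi (k *: x) = k * dot xi x.
Proof. by rewrite /dot mulr_sumr; apply: eq_bigr => i _; rewrite mxE; ring. Qed.

Lemma polyfun_dot xi : polyfun (dot xi).
Proof.
apply: polyfun_sum => i; apply: polyfunM; [exact: polyfun_cst|exact: polyfun_coord].
Qed.

Lemma polyfun_differentiable f : polyfun f -> forall x, differentiable f x.
Proof.
elim=> [c|i|u v _ du _ dv|u v _ du _ dv] x.
- exact: differentiable_cst.
- exact: differentiable_coord.
- exact: differentiableD.
- exact: differentiableM.
Qed.

Lemma is_derive_dotX xi n x v :
  is_derive x v (fun y => dot xi y ^+ n.+1) (n.+1%:R * dot xi x ^+ n * dot xi v).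
Proof.
have d1 : is_derive x v (dot xi) (dot xi v).
  apply: is_derive_epsilon => e e0; near=> h.
  rewrite dotD dotZ (_ : _ - _ - _ = 0); last by ring.
  by rewrite normr0 mulr_ge0// ltW.
by have := is_deriveX n.+1 d1; rewrite exprfctE.
Unshelve. all: by end_near. Qed.

Lemma partial_dotX xi n i x :
  partial i (fun y => dot xi y ^+ n.+1) x = n.+1%:R * xi 0 i * dot xi x ^+ n.
Proof.
rewrite /partial; have [_ ->] := is_derive_dotX xi n x (delta_mx 0 i).
have -> : dot xi (delta_mx 0 i) = xi 0 i.
  rewrite /dot (bigD1 i)//= big1 ?addr0 => [|j ji]; rewrite mxE eqxx /= ?eqxx ?mulr1//.
  by rewrite (negbTE ji) mulr0.
by ring.
Qed.

Lemma C1_dotX xi n : C1 (fun y => dot xi y ^+ n).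
Proof.
have pd m : polyfun (fun y => dot xi y ^+ m) by apply/polyfunX/polyfun_dot.
split=> [x|i]; first exact: polyfun_differentiable.
case: n => [|n].
  have -> : partial i (fun y => dot xi y ^+ 0) = cst 0.
    by apply/funext => x; rewrite /partial derive_cst.
  exact: cst_continuous.
apply: polyfun_continuous; rewrite (_ : partial _ _ = (fun x => n.+1%:R * xi 0 i * dot xi x ^+ n)).
  by apply: polyfunM; [exact: polyfun_cst|exact: pd].
by apply/funext => x; rewrite partial_dotX.
Qed.

End FieldCalculus.

Section LineRestriction.
Variable R : realType.
Notation leb := (@lebesgue_measure R).
Implicit Types (f : 'rV[R]_3 -> R) (x w : 'rV[R]_3).

(** This holds on every line: f is a measurable function of the coordinates, which are affine in t,
    and the line meets the support in a bounded set of parameters. *)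
Lemma bounded_support_line f x w : bounded_support f -> w != 0 ->
  leb.-integrable setT (EFin \o (fun t => f (x + t *: w))).
Proof.
move=> [mf [A fA]] w0; have A0 : 0 <= A by apply: le_trans (fA 0).1.
have nw : 0 < `|w| by rewrite normr_gt0.
pose B := (A + `|x|) / `|w|.
have B0 : 0 <= B by rewrite divr_ge0// addr_ge0.
apply: (@bounded_on_integrable _ _ _ leb (cube1 B) A).
- exact: measurable_cube1.
- by rewrite [X in (X < _)%E]lebesgue_cube1// ltry.
have mline : measurable_fun setT ((fun t => unvec (x + t *: w)) :
    measurableTypeR R -> measurableTypeR R * (measurableTypeR R * measurableTypeR R)).
  have mc i : measurable_fun setT ((fun t => (x + t *: w) 0 i) : measurableTypeR R -> measurableTypeR R).
    rewrite (_ : (fun t => _) = (fun t => w 0 i * t + x 0 i)); last first.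
      by apply/funext => t; rewrite !mxE; ring.
    exact: measurable_affine.
  apply/measurable_fun_pairP; split; first exact: mc.
  by apply/measurable_fun_pairP; split; exact: mc.
split.
  rewrite (_ : (fun t => _) = (f \o @vec R) \o (fun t => unvec (x + t *: w))); last first.
    by apply/funext => t /=; rewrite unvecK.
  exact: measurableT_comp mf mline.
move=> t; split; first exact: (fA _).1.
move=> tB; apply: (fA _).2; rewrite ltNge; apply/negP => h; apply: tB.
rewrite /cube1 /= in_itv /= -ler_norml /B ler_pdivlMr// -normrZ.
by rewrite -[_ *: w](addKr x) addrC (le_trans (ler_normB _ _))// lerD2r.
Qed.

Lemma enorm_gt0 w : w != 0 -> 0 < enorm w.
Proof.
move=> w0; rewrite /enorm sqrtr_gt0 lt_neqAle sumr_ge0 ?andbT => [|i _]; last exact: sqr_ge0.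
apply: contra_neq w0 => /esym/eqP; rewrite psumr_eq0 => [/allP h|i _]; last exact: sqr_ge0.
apply/rowP => i; rewrite [RHS]mxE; apply/eqP; rewrite -sqrf_eq0.
by apply: (h i); rewrite mem_index_enum.
Qed.

Lemma enorm_sqr w : enorm w ^+ 2 = \sum_i w 0 i ^+ 2.
Proof. by rewrite sqr_sqrtr// sumr_ge0// => i _; exact: sqr_ge0. Qed.

Lemma enorm_normalize w : w != 0 -> enorm ((enorm w)^-1 *: w) = 1.
Proof.
move=> w0; have e0 := enorm_gt0 w0; rewrite {1}/enorm.
rewrite (_ : \sum_j _ = 1) ?sqrtr1//.
under eq_bigr do rewrite mxE exprMn.
by rewrite -mulr_sumr -enorm_sqr -exprMn mulVf ?gt_eqF// expr1n.
Qed.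

End LineRestriction.

(** * Moment identities for stress fields *)

Section Uniqueness.
Variable R : realType.
Notation leb := (@lebesgue_measure R).
Variable M : set 'rV[R]_3.
Hypothesis M_domain : is_domain M.
Hypothesis M_bounded : bounded_set M.
Hypothesis M_convex : convex_set M.
Hypothesis M_smooth : smooth_boundary M.
Implicit Types (x y v w p : 'rV[R]_3) (g : 'I_3 -> 'I_3 -> 'rV[R]_3 -> R).

Definition traction_free g := [/\ forall j k, C1 (g j k),
  forall x, M x -> forall j k, g j k x = g k j x,
  forall x, M x -> forall j, \sum_k partial k (g j k) x = 0 &
  forall p N, boundary M p -> unit_normal M p N ->
    forall j, \sum_k g j k p * N 0 k = 0].

Lemma residual_stress_extension (S : 'rV[R]_3 -> 'M[R]_3) : residual_stress M S ->
  exists2 g, traction_free g & forall x, closure M x -> forall j k, S x j k = g j k x.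
Proof.
move=> [sS symS divS tS]; have [oM _ _] := M_domain.
have /choice[g hg] : forall jk : 'I_3 * 'I_3, exists G : 'rV[R]_3 -> R,
    smooth_on setT G /\ forall x, closure M x -> S x jk.1 jk.2 = G x.
  by move=> [j k]; have [G g1 g2] := sS j k; exists G.
have Sg x : closure M x -> forall j k, S x j k = g (j, k) x.
  by move=> cx j k; exact: (hg (j, k)).2.
exists (fun j k => g (j, k)) => //; split.
- by move=> j k; apply: smooth_C1; exact: (hg (j, k)).1.
- by move=> x /(@subset_closure _ M) cx j k; rewrite -!Sg// symS.
- move=> x Mx j; rewrite -[RHS](divS x Mx j); apply: eq_bigr => k _.
  apply: near_eq_derive; have : nbhs x M by exact: open_nbhs_nbhs.
  by apply: filterS => y /(@subset_closure _ M) cy; rewrite Sg.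
- move=> p N bp uN j; rewrite -[RHS](tS p N bp uN j).
  by apply: eq_bigr => k _; rewrite Sg//; case: bp.
Qed.

Lemma traction_freeB g g' : traction_free g -> traction_free g' ->
  traction_free (fun j k x => g j k x - g' j k x).
Proof.
move=> [c1 s1 d1 t1] [c2 s2 d2 t2]; split.
- by move=> j k; apply: C1B.
- by move=> x Mx j k; rewrite s1// s2.
- move=> x Mx j; transitivity (\sum_k (partial k (g j k) x - partial k (g' j k) x)).
    by apply: eq_bigr => k _; rewrite partialB//; [exact: (c1 j k).1|exact: (c2 j k).1].
  by rewrite sumrB d1// d2// subrr.
- move=> p N bp uN j; under eq_bigr do rewrite mulrBl.
  by rewrite sumrB t1// t2// subrr.
Qed.

Definition zero_extension g j k x := g j k x * \1_M x.

(** The factor |w| ^ 2 in the trace term makes this homogeneous of degree 2 in w, so that directions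
    need not be normalized. *)
Definition ray_form (a b : R) (h : 'I_3 -> 'I_3 -> 'rV[R]_3 -> R) w x :=
  a * (\sum_j \sum_k h j k x * w 0 j * w 0 k)
  + b * (\sum_i w 0 i ^+ 2) * \sum_i h i i x.

Lemma ray_formZ a b h (k : R) w x :
  ray_form a b h (k *: w) x = k ^+ 2 * ray_form a b h w x.
Proof.
rewrite /ray_form.
have -> : \sum_i (k *: w) 0 i ^+ 2 = k ^+ 2 * \sum_i w 0 i ^+ 2.
  by rewrite mulr_sumr; apply: eq_bigr => i _; rewrite mxE exprMn.
have -> : \sum_i \sum_j h i j x * (k *: w) 0 i * (k *: w) 0 j =
    k ^+ 2 * \sum_i \sum_j h i j x * w 0 i * w 0 j.
  rewrite mulr_sumr; apply: eq_bigr => i _.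
  by rewrite mulr_sumr; apply: eq_bigr => j _; rewrite !mxE; ring.
by ring.
Qed.

Lemma bounded_support_ray_form a b h w : (forall j k, bounded_support (h j k)) ->
  bounded_support (ray_form a b h w).
Proof.
move=> bh; apply: bounded_supportD; apply: bounded_supportZ.
  apply: bounded_support_sum => j; apply: bounded_support_sum => k.
  have := bounded_supportZ (w 0 j * w 0 k) (bh j k).
  by congr bounded_support; apply/funext => x; ring.
exact: bounded_support_sum.
Qed.

Lemma bounded_support_zero_extension g : traction_free g ->
  forall j k, bounded_support (zero_extension g j k).
Proof.
move=> [c _ _ _] j k; have [oM _ _] := M_domain.
by apply: bounded_support_zero_ext => //; exact/C1_continuous/c.
Qed.

(** Row j times the power n + 1 of xi . x is still tangential, and as the row is divergence free its
    divergence is (n + 1) (xi . x) ^ n times the contraction of the row with xi. *)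
Lemma solenoidal_moments g (xi : 'rV[R]_3) n j : traction_free g ->
  \sum_k xi 0 k * vint (fun x => zero_extension g j k x * dot xi x ^+ n) = 0.
Proof.
move=> tg; have [c _ d t] := tg.
have bs := bounded_support_zero_extension tg.
have pd m : continuous (fun x => dot xi x ^+ m).
  by apply/polyfun_continuous/polyfunX/polyfun_dot.
have := @tangential_divergence R M (fun k x => g j k x * dot xi x ^+ n.+1)
  M_domain M_bounded M_convex M_smooth.
move=> /(_ (fun k => C1M (c j k) (C1_dotX xi n.+1))) => h.
have : n.+1%:R * \sum_k xi 0 k * vint (fun x => zero_extension g j k x * dot xi x ^+ n) = 0.
  rewrite -[RHS]h => [|p N bp uN]; last first.
    under eq_bigr do rewrite mulrAC.
    by rewrite -mulr_suml t// mul0r.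
  rewrite (_ : (fun x => _ * \1_M x) = (fun x => \sum_k (n.+1%:R * xi 0 k) *
      (zero_extension g j k x * dot xi x ^+ n))).
    rewrite vint_sum => [|k]; last exact/bounded_supportZ/bounded_supportM.
    rewrite mulr_sumr; apply: eq_bigr => k _; rewrite vintZ ?mulrA//.
    exact: bounded_supportM.
  apply/funext => x; rewrite /zero_extension indicE.
  have [Mx|nMx] := pselect (M x); last first.
    by rewrite memNset// mulr0 big1// => k _; rewrite mulr0 mul0r mulr0.
  rewrite mem_set// mulr1.
  have d0 : (\sum_k partial k (g j k) x) * dot xi x ^+ n.+1 = 0 by rewrite d// mul0r.
  transitivity (\sum_k (n.+1%:R * xi 0 k) * (g j k x * dot xi x ^+ n)
      + (\sum_k partial k (g j k) x) * dot xi x ^+ n.+1).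
    rewrite mulr_suml -big_split; apply: eq_bigr => k _.
    have dg := (c j k).1 x; have dd := (C1_dotX xi n.+1).1 x.
    by rewrite partialM// partial_dotX /=; ring.
  by rewrite d0 addr0; apply: eq_bigr => k _; rewrite mulr1.
by move/eqP; rewrite mulf_eq0 pnatr_eq0 => /eqP.
Qed.

(** The weight (xi . x) ^ n is constant along lines orthogonal to xi, so it leaves the line
    integrals zero; [ray_form] is linear in the tensor and commutes with integration. The moments
    are constant functions, and the final 0 is a dummy point. *)
Lemma ray_moments (h : 'I_3 -> 'I_3 -> 'rV[R]_3 -> R) (a b : R) w xi n :
  (forall j k, bounded_support (h j k)) ->
  (forall x v, enorm v = 1 ->
     Rintegral leb setT (fun t => ray_form a b h v (x + t *: v)) = 0) ->
  w 0 0 = 1 -> dot xi w = 0 ->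
  ray_form a b (fun j k _ => vint (fun x => h j k x * dot xi x ^+ n)) w 0 = 0.
Proof.
move=> bh h0 w1 xiw.
have w0 : w != 0.
  by apply/eqP => wE; move: w1; rewrite wE mxE => /eqP; rewrite eq_sym oner_eq0.
have pd : continuous (fun x => dot xi x ^+ n).
  by apply/polyfun_continuous/polyfunX/polyfun_dot.
have bq := bounded_support_ray_form a b w bh.
have bqd : bounded_support (fun x => ray_form a b h w x * dot xi x ^+ n).
  exact: bounded_supportM.
(* The data concern unit directions whereas the shear wants first coordinate 1, hence a
   reparameterization by the length k of w. *)
have [k k0 [u u1 wu]] : exists2 k, 0 < k & exists2 u, enorm u = 1 & w = k *: u.
  exists (enorm w); first exact: enorm_gt0.
  exists ((enorm w)^-1 *: w); first exact: enorm_normalize.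
  by rewrite scalerA mulfV ?scale1r// gt_eqF// enorm_gt0.
have u0 : u != 0.
  by apply/eqP => uE; move: w0; rewrite wu uE scaler0 eqxx.
have line x : Rintegral leb setT (fun t => ray_form a b h w (x + t *: w)) = 0.
  have bu := bounded_support_ray_form a b u bh.
  have bui := bounded_support_line x bu u0.
  have bwi := bounded_support_line x bu w0.
  pose F t := ray_form a b h u (x + t *: u).
  have FE : (fun t => F (k * t + 0)) = (fun t => ray_form a b h u (x + t *: w)).
    apply/funext => t; by rewrite /F addr0 wu scalerA mulrC.
  have := @integral_affine R k 0 F k0 bui; rewrite FE [X in X = _]h0//.
  move=> /(_ bwi)/esym/eqP; rewrite mulf_eq0 gt_eqF//= => /eqP hz.
  have -> : (fun t => ray_form a b h w (x + t *: w)) =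
      (fun t => k ^+ 2 * ray_form a b h u (x + t *: w)).
    by apply/funext => t; rewrite {1}wu ray_formZ.
  by rewrite RintegralZl// hz mulr0.
have : vint (fun x => ray_form a b h w x * dot xi x ^+ n) = 0.
  apply: (vint_shear bqd w1) => x.
  have -> : (fun t => ray_form a b h w (x + t *: w) * dot xi (x + t *: w) ^+ n) =
      (fun t => dot xi x ^+ n * ray_form a b h w (x + t *: w)).
    by apply/funext => t; rewrite dotD dotZ xiw mulr0 addr0 mulrC.
  by rewrite RintegralZl ?line ?mulr0//; exact: bounded_support_line.
move=> <-.
have bm i j : bounded_support (fun x => h i j x * dot xi x ^+ n) by exact: bounded_supportM.
rewrite (_ : (fun x => _) = (fun x =>
    a * (\sum_i \sum_j (w 0 i * w 0 j) * (h i j x * dot xi x ^+ n)) +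
    (b * \sum_i w 0 i ^+ 2) * \sum_i (h i i x * dot xi x ^+ n))).
  have bZ i j : bounded_support (fun x => (w 0 i * w 0 j) * (h i j x * dot xi x ^+ n)).
    exact: bounded_supportZ.
  have bS i : bounded_support
      (fun x => \sum_j (w 0 i * w 0 j) * (h i j x * dot xi x ^+ n)).
    exact: bounded_support_sum.
  have bSS : bounded_support
      (fun x => \sum_i \sum_j (w 0 i * w 0 j) * (h i j x * dot xi x ^+ n)).
    exact: bounded_support_sum.
  have bT : bounded_support (fun x => \sum_i (h i i x * dot xi x ^+ n)).
    exact: bounded_support_sum.
  rewrite vintD ?vintZ//; try exact: bounded_supportZ.
  rewrite !vint_sum// /ray_form; congr (a * _ + _).
  apply: eq_bigr => i _; rewrite vint_sum//; apply: eq_bigr => j _.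
  by rewrite vintZ//; ring.
apply/funext => x; rewrite /ray_form mulrDl; congr (_ + _).
  rewrite -mulrA; congr (_ * _); rewrite mulr_suml; apply: eq_bigr => i _.
  by rewrite mulr_suml; apply: eq_bigr => j _; ring.
by rewrite -mulrA; congr (_ * _); rewrite mulr_suml.
Qed.

End Uniqueness.

Lemma sum_ord3 (V : nmodType) (F : 'I_3 -> V) : \sum_i F i = F 0 + F 1 + F 2%:R.
Proof.
rewrite !big_ord_recl big_ord0 addr0 addrA.
by congr (F _ + F _ + F _); exact/val_inj.
Qed.

Lemma ord3P (P : 'I_3 -> Prop) : P 0 -> P 1 -> P 2%:R -> forall i, P i.
Proof.
move=> p0 p1 p2 [[|[|[|//]]] i].
- by rewrite (_ : Ordinal i = 0)//; exact/val_inj.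
- by rewrite (_ : Ordinal i = 1)//; exact/val_inj.
- by rewrite (_ : Ordinal i = 2%:R)//; exact/val_inj.
Qed.

(** * From vanishing ray data to a vanishing field *)

Section Injectivity.
Variable R : realType.
Notation leb := (@lebesgue_measure R).
Variable M : set 'rV[R]_3.
Hypothesis M_domain : is_domain M.
Hypothesis M_bounded : bounded_set M.
Hypothesis M_convex : convex_set M.
Hypothesis M_smooth : smooth_boundary M.
Implicit Types (x y v w p : 'rV[R]_3) (g : 'I_3 -> 'I_3 -> 'rV[R]_3 -> R).

Theorem traction_free_ray_injective g (a b : R) : traction_free M g ->
  a != 0 -> a + 2 * b != 0 ->
  (forall x v, enorm v = 1 -> Rintegral leb setT
     (fun t => ray_form a b (zero_extension M g) v (x + t *: v)) = 0) ->
  forall x, closure M x -> forall j k, g j k x = 0.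
Proof.
move=> tg a0 ab0 h0; have [cg sg _ _] := tg; have [oM _ _] := M_domain.
have bs := bounded_support_zero_extension M_domain M_bounded tg.
have moments (s t : R) n j k :
    vint (fun x => zero_extension M g j k x * (s * x 0 0 + t * x 0 1 + x 0 2%:R) ^+ n) = 0.
  (* For this xi the orthogonal vectors (1, c, d) are those with s + t c + d = 0. *)
  pose xi := vec (s, (t, 1)).
  have dE x : dot xi x = s * x 0 0 + t * x 0 1 + x 0 2%:R.
    by rewrite /dot sum_ord3 !vecE /= mul1r.
  under eq_fun do rewrite -dE.
  pose m j k := vint (fun x => zero_extension M g j k x * dot xi x ^+ n).
  have msym i l : m i l = m l i.
    congr vint; apply/funext => x; rewrite /zero_extension indicE.
    have [Mx|nMx] := pselect (M x); first by rewrite sg.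
    by rewrite memNset// !mulr0.
  have sol i : s * m i 0 + t * m i 1 + m i 2%:R = 0.
    rewrite -[RHS](solenoidal_moments M_domain M_bounded M_convex M_smooth xi n i tg).
    by rewrite sum_ord3 !vecE /= mul1r.
  have [m00 m01 m11 [m02 m12 m22]] :
      [/\ m 0 0 = 0, m 0 1 = 0, m 1 1 = 0 & [/\ m 0 2%:R = 0, m 1 2%:R = 0 & m 2%:R 2%:R = 0]].
    apply: (@transverse_tensor_eq0 R a b s t) => //.
    - by have := sol 1; rewrite (msym 1 0).
    - by have := sol 2%:R; rewrite (msym 2%:R 0) (msym 2%:R 1).
    move=> c d scd; pose w := vec (1, (c, d)).
    rewrite -[RHS](@ray_moments R (zero_extension M g) a b w xi n bs h0).
    - rewrite /ray_form !sum_ord3 !vecE /= -/(m _ _).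
      rewrite -!/(m _ _) (msym 1 0) (msym 2%:R 0) (msym 2%:R 1); ring.
    - by rewrite vecE.
    - by rewrite dE !vecE /= mulr1.
  have m0 : forall i l, m i l = 0.
    apply: ord3P; apply: ord3P => //.
    - by rewrite msym.
    - by rewrite msym.
    - by rewrite msym.
  exact: m0.
have inM x j k : M x -> g j k x = 0.
  move=> Mx; rewrite -[RHS](@determined_by_moments R (zero_extension M g j k) x (bs j k)).
  - by rewrite /zero_extension indicE mem_set// mulr1.
  - have cgx := C1_continuous (cg j k) (x := x).
    have nE : \forall y \near x, g j k y = zero_extension M g j k y.
      have : nbhs x M by exact: open_nbhs_nbhs.
      by apply: filterS => y My; rewrite /zero_extension indicE mem_set// mulr1.
    have zE : zero_extension M g j k x = g j k x.
      by rewrite /zero_extension indicE mem_set// mulr1.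
    have h : zero_extension M g j k y @[y --> x] --> g j k x.
      exact: (cvg_trans (near_eq_cvg nE) cgx).
    by rewrite -zE in h.
  - move=> u; apply: polynomial_moments_eq0; first exact: bs.
    exact: (linear_form_moments_eq0 (bs j k) (fun s t n => moments s t n j k)).
(* Continuity carries the vanishing from M to its closure. *)
move=> x cx j k; apply: contrapT => gx.
have cgx := C1_continuous (cg j k) (x := x).
have : nbhs x [set y | g j k y != 0].
  by apply: (cvgr_neq0 _ cgx); exact/eqP.
by move=> /cx[y [My]] /=; rewrite inM// eqxx.
Qed.

Section Data.
Variables lambda mu rho nu1 nu2 nu3 nu4 : R.
Hypothesis rho_gt0 : 0 < rho.
Hypothesis lambda_mu : 0 < lambda + 2 * mu.

Let c0 := (rho * vp lambda mu rho ^+ 4)^-1.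

Lemma DR_factor_neq0 : c0 != 0.
Proof.
rewrite invr_eq0 mulf_neq0 ?gt_eqF//; apply: exprn_gt0.
by rewrite /vp sqrtr_gt0 divr_gt0.
Qed.

Lemma DR_ray_form g (S : 'rV[R]_3 -> 'M[R]_3) x w : traction_free M g ->
  (forall y, M y -> forall j k, S y j k = g j k y) -> enorm w = 1 ->
  DR M lambda mu rho nu1 nu2 nu3 nu4 S x w =
  c0 * Rintegral leb setT (fun t => ray_form (1 + nu3 + nu4) (2^-1 * (nu1 + nu2))
    (zero_extension M g) w (x + t *: w)).
Proof.
move=> tg Sg w1.
have w0 : w != 0.
  apply/eqP => wE; move: w1; rewrite wE /enorm big1 => [|i _].
    by rewrite sqrtr0 => /esym/eqP; rewrite oner_eq0.
  by rewrite mxE expr0n.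
have bs := bounded_support_zero_extension M_domain M_bounded tg.
rewrite -RintegralZl//; last first.
  by apply: bounded_support_line => //; exact: bounded_support_ray_form.
rewrite /DR; congr Rintegral; apply/funext => t; rewrite /DR_integrand -/c0.
congr (_ * _); rewrite /ray_form -enorm_sqr w1 expr1n mulr1.
have E j k : patch (fun=> 0) M S (x + t *: w) j k = zero_extension M g j k (x + t *: w).
  rewrite /zero_extension indicE /patch; case: ifPn => [|nM].
    by rewrite inE => My; rewrite Sg// mulr1.
  by rewrite mxE mulr0.
congr (_ * _ + _ * _); last by apply: eq_bigr => i _.
by apply: eq_bigr => i _; apply: eq_bigr => k _; rewrite E.
Qed.

Theorem residual_stress_determined (S S' : 'rV[R]_3 -> 'M[R]_3) :
  1 + nu3 + nu4 != 0 -> nu1 + nu2 + nu3 + nu4 != -1 ->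
  residual_stress M S -> residual_stress M S' ->
  (forall x w, enorm w = 1 ->
     DR M lambda mu rho nu1 nu2 nu3 nu4 S x w = DR M lambda mu rho nu1 nu2 nu3 nu4 S' x w) ->
  forall x, closure M x -> S x = S' x.
Proof.
move=> a0 nu sS sS' SS' x cx.
have [g tg Sg] := residual_stress_extension M_domain sS.
have [g' tg' Sg'] := residual_stress_extension M_domain sS'.
have tgg := traction_freeB tg tg'.
have bs := bounded_support_zero_extension M_domain M_bounded tg.
have bs' := bounded_support_zero_extension M_domain M_bounded tg'.
(* Here a + 2 b = 1 + nu1 + nu2 + nu3 + nu4. *)
have ab0 : 1 + nu3 + nu4 + 2 * (2^-1 * (nu1 + nu2)) != 0.
  apply: contra_neq nu => h; lra.
apply/matrixP => j k; rewrite Sg// Sg'//; apply/eqP; rewrite -subr_eq0; apply/eqP.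
apply: (traction_free_ray_injective tgg a0 ab0) => // {j k} y v v1.
have v0 : v != 0.
  apply/eqP => vE; move: v1; rewrite vE /enorm big1 => [|i _].
    by rewrite sqrtr0 => /esym/eqP; rewrite oner_eq0.
  by rewrite mxE expr0n.
have inM (T : 'rV[R]_3 -> 'M[R]_3) h : (forall x, closure M x -> forall j k, T x j k = h j k x) ->
    (forall x, M x -> forall j k, T x j k = h j k x).
  by move=> Th z /(@subset_closure _ M); exact: Th.
have := SS' y v v1; rewrite (DR_ray_form y tg (inM _ _ Sg) v1).
rewrite (DR_ray_form y tg' (inM _ _ Sg') v1) => /(mulfI DR_factor_neq0)/eqP.
rewrite -subr_eq0 -RintegralB//; first last.
- by apply: bounded_support_line => //; exact: bounded_support_ray_form.
- by apply: bounded_support_line => //; exact: bounded_support_ray_form.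
move=> /eqP h; rewrite -[RHS]h; congr Rintegral; apply/funext => t.
set z := y + t *: v; rewrite /ray_form opprD addrACA -!mulrBr -!sumrB.
congr (_ * _ + _ * _).
  apply: eq_bigr => j _; rewrite -sumrB; apply: eq_bigr => k _.
  by rewrite /zero_extension; ring.
by apply: eq_bigr => i _; rewrite /zero_extension; ring.
Qed.

End Data.
End Injectivity.

(** * A residual stress with vanishing ray data *)

Section FlatFunctions.
Context {R : realType}.
Implicit Types (s t : R) (n : nat).

(** The functions t ^ -n exp(-1/t), cut off at 0: derivatives of members of this family are linear
    combinations of members, which gives smoothness without computing iterated derivatives. *)
Definition flat n t : R := if 0 < t then t^-1 ^+ n * expR (- t^-1) else 0.

Lemma flat_le0 n t : t <= 0 -> flat n t = 0.
Proof. by rewrite /flat leNgt => /negbTE ->. Qed.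

(** With u = 1/t, the exponential series gives u ^ (n + 2) <= (n + 2)! exp u. The quadratic bound is
    what makes the derivative at 0 vanish. *)
Lemma flat_bound n t : `|flat n t| <= (n.+2)`!%:R * t ^+ 2.
Proof.
rewrite /flat; case: ifPn => [t0|_]; last by rewrite normr0 mulr_ge0// sqr_ge0.
rewrite ger0_norm; last by rewrite mulr_ge0 ?expR_ge0// exprn_ge0// invr_ge0 ltW.
have u0 : 0 < t^-1 by rewrite invr_gt0.
have f0 : 0 < (n.+2)`!%:R :> R by rewrite ltr0n fact_gt0.
have h : t^-1 ^+ n.+2 <= (n.+2)`!%:R * expR t^-1.
  rewrite mulrC -ler_pdivrMr//.
  by apply: le_trans (expR_ge1Dxn n.+1 (ltW u0)); rewrite lerDr.
rewrite expRN ler_pdivrMr ?expR_gt0//.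
have -> : t^-1 ^+ n = t ^+ 2 * t^-1 ^+ n.+2.
  have -> : t^-1 ^+ n.+2 = t^-1 ^+ n * (t^-1 * t^-1) by rewrite !exprSr mulrA.
  by field; rewrite gt_eqF.
rewrite [leRHS](_ : _ = t ^+ 2 * ((n.+2)`!%:R * expR t^-1)); last by ring.
by rewrite ler_wpM2l// sqr_ge0.
Qed.

Lemma is_derive_flat n t : is_derive t 1 (flat n) (flat n.+2 t - n%:R * flat n.+1 t).
Proof.
have [t0|t0|->] := ltgtP t 0.
- rewrite !flat_le0 ?ltW// mulr0 subr0.
  apply: near_eq_is_derive (is_derive_cst (0 : R) t 1).
  near=> s; rewrite flat_le0//; apply: ltW; near: s; exact: lt_nbhsl.
- have d0 : is_derive t 1 (fun s => s^-1) (- t ^- 2).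
    have := is_deriveV (lt0r_neq0 t0) (is_derive_id t (1 : R)).
    by rewrite [_ *: _]mulr1.
  have d1 := is_deriveX n d0; rewrite exprfctE in d1.
  have d2 : is_derive t 1 (fun s => expR (- s^-1)) (expR (- t^-1) * t ^- 2).
    have := is_derive_comp_real (is_deriveN d0) (is_derive_expR _).
    by rewrite opprK.
  have := is_deriveM d1 d2 => d3.
  have E : flat n.+2 t - n%:R * flat n.+1 t =
      (t^-1 ^+ n *: (expR (- t^-1) * t ^- 2) +
       expR (- t^-1) *: ((n%:R * t^-1 ^+ n.-1) *: (- t ^- 2))).
    rewrite /flat t0 /GRing.scale /=; case: n {d1 d3} => [|n]; rewrite ?mul0r !exprS ?expr0;
    by field; rewrite gt_eqF.
  rewrite E; apply: near_eq_is_derive d3.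
  near=> s; rewrite /flat ifT//; near: s; exact: lt_nbhsr.
- rewrite !flat_le0// mulr0 subr0; apply: is_derive_epsilon => e e0; near=> h.
  rewrite [h%:A]mulr1 addr0 (flat_le0 _ (lexx 0)) mulr0 !subr0.
  apply: le_trans (flat_bound n h) _.
  rewrite -[h ^+ 2]ger0_norm ?sqr_ge0// normrX expr2 mulrA ler_wpM2r//.
  rewrite -ler_pdivlMl ?ltr0n ?fact_gt0//.
  near: h; apply: (@nbhs0_le R R^o); apply: mulr_gt0 => //.
Unshelve. all: by end_near. Qed.

End FlatFunctions.

(** * A smooth bump and its divergence-free tensor *)

Section Bump.
Variable R : realType.
Variables (p : 'rV[R]_3) (r : R).
Implicit Types (f g : 'rV[R]_3 -> R) (x w : 'rV[R]_3).

Definition sqdist x := \sum_i (x 0 i - p 0 i) ^+ 2.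

Definition rbump n x := flat n (r ^+ 2 - sqdist x).

(** An algebra of differentiable functions that is stable under partial derivatives; all its members
    are therefore smooth. *)
Inductive bump_algebra : ('rV[R]_3 -> R) -> Prop :=
| bump_algebra_cst c : bump_algebra (fun=> c)
| bump_algebra_coord i : bump_algebra (fun x => x 0 i)
| bump_algebra_bump n : bump_algebra (rbump n)
| bump_algebraD f g : bump_algebra f -> bump_algebra g -> bump_algebra (fun x => f x + g x)
| bump_algebraM f g : bump_algebra f -> bump_algebra g -> bump_algebra (fun x => f x * g x).

Lemma polyfun_sqdist : polyfun sqdist.
Proof.
apply: polyfun_sum => i; apply: polyfunX; apply: (@polyfunD _ _ (fun=> - p 0 i)).
  exact: polyfun_coord.
exact: polyfun_cst.
Qed.

Lemma is_derive_coord x w i : is_derive x w (fun y : 'rV[R]_3 => y 0 i) (w 0 i).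
Proof.
apply: is_derive_epsilon => e e0; near=> h.
rewrite !mxE (_ : _ - _ - _ = 0); last by ring.
by rewrite normr0 mulr_ge0// ltW.
Unshelve. all: by end_near. Qed.

Lemma is_derive_shifted_coord x w i : is_derive x w (fun y : 'rV[R]_3 => y 0 i - p 0 i) (w 0 i).
Proof.
have := is_deriveB (is_derive_coord x w i) (is_derive_cst (p 0 i) x w).
by rewrite subr0.
Qed.

Lemma is_derive_sqdist x w : is_derive x w sqdist (2 * \sum_i (x 0 i - p 0 i) * w 0 i).
Proof.
have d i := is_deriveX 2 (is_derive_shifted_coord x w i).
have := is_derive_sum d; rewrite mulr_sumr (_ : \sum_i (_ ^+ 2) = sqdist).
  by congr is_derive; apply: eq_bigr => i _; rewrite /GRing.scale /= expr1; ring.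
by apply/funext => y; rewrite fct_sumE /sqdist.
Qed.

Lemma is_derive_bump n x w : is_derive x w (rbump n)
  ((rbump n.+2 x - n%:R * rbump n.+1 x) * (- 2 * \sum_i (x 0 i - p 0 i) * w 0 i)).
Proof.
have d := is_deriveB (is_derive_cst (r ^+ 2) x w) (is_derive_sqdist x w).
have := is_derive_comp_real d (is_derive_flat n _).
by rewrite sub0r mulNr.
Qed.

Lemma bump_algebra_differentiable f : bump_algebra f -> forall x, differentiable f x.
Proof.
elim=> [c|i|n|u v _ du _ dv|u v _ du _ dv] x.
- exact: differentiable_cst.
- exact: differentiable_coord.
- apply: (@differentiable_comp _ _ _ _ (fun x => r ^+ 2 - sqdist x) (flat n)).
    apply: differentiableB; first exact: differentiable_cst.
    exact/polyfun_differentiable/polyfun_sqdist.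
  by apply/derivable1_diffP; case: (is_derive_flat n (r ^+ 2 - sqdist x)).
- exact: differentiableD.
- exact: differentiableM.
Qed.

Lemma bump_algebra_sub_cst f c : bump_algebra f -> bump_algebra (fun x => f x - c).
Proof. by move=> bf; apply: (bump_algebraD bf); exact: bump_algebra_cst. Qed.

Lemma bump_algebra_sum (I : Type) (s : seq I) (F : I -> 'rV[R]_3 -> R) :
  (forall i, bump_algebra (F i)) -> bump_algebra (fun x => \sum_(i <- s) F i x).
Proof.
move=> bF; elim: s => [|i s ih].
  by under eq_fun do rewrite big_nil; exact: bump_algebra_cst.
by under eq_fun do rewrite big_cons; exact: bump_algebraD.
Qed.

Lemma bump_algebra_partial f i : bump_algebra f -> bump_algebra (partial i f).
Proof.
elim=> [c|j|n|u v bu du bv dv|u v bu du bv dv].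
- rewrite (_ : partial _ _ = fun=> 0); first exact: bump_algebra_cst.
  by apply/funext => x; rewrite /partial derive_cst.
- rewrite (_ : partial _ _ = fun=> (delta_mx 0 i : 'rV[R]_3) 0 j); first exact: bump_algebra_cst.
  by apply/funext => x; rewrite /partial; case: (is_derive_coord x (delta_mx 0 i) j).
- rewrite (_ : partial _ _ = (fun x => (rbump n.+2 x + (- n%:R) * rbump n.+1 x) *
     (- 2 * \sum_j (x 0 j - p 0 j) * (delta_mx 0 i : 'rV[R]_3) 0 j))).
    apply: bump_algebraM; last first.
      apply: bump_algebraM; first exact: bump_algebra_cst.
      apply: bump_algebra_sum => j; apply: bump_algebraM; last exact: bump_algebra_cst.
      exact/bump_algebra_sub_cst/bump_algebra_coord.
    apply: bump_algebraD; first exact: bump_algebra_bump.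
    apply: bump_algebraM; [exact: bump_algebra_cst|exact: bump_algebra_bump].
  apply/funext => x; rewrite /partial.
  by case: (is_derive_bump n x (delta_mx 0 i)) => _ ->; rewrite [- n%:R * _]mulNr.
- rewrite (_ : partial _ _ = (fun x => partial i u x + partial i v x)).
    exact: bump_algebraD.
  apply/funext => x; rewrite /partial deriveD//; apply: diff_derivable.
    exact: (bump_algebra_differentiable bu).
  exact: (bump_algebra_differentiable bv).
- rewrite (_ : partial _ _ = (fun x => u x * partial i v x + v x * partial i u x)).
    by apply: bump_algebraD; exact: bump_algebraM.
  apply/funext => x; rewrite partialM//.
    exact: (bump_algebra_differentiable bu).
  exact: (bump_algebra_differentiable bv).
Qed.

Lemma bump_algebra_smooth f : bump_algebra f -> smooth_on setT f.
Proof.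
move=> bf s x _; apply: bump_algebra_differentiable.
by elim: s => //= i s; exact: bump_algebra_partial.
Qed.

(* [\nabla^2 phi - (\Delta phi) 1] up to a factor, for a potential [phi] that
   is a function of [r^2 - sqdist] with derivative [flat 0]. *)
Definition bump_stress x : 'M[R]_3 := \matrix_(j, k)
  (rbump 2 x * (x 0 j - p 0 j) * (x 0 k - p 0 k)
   + (j == k)%:R * (rbump 0 x - rbump 2 x * sqdist x)).

Lemma bump_stress_algebra j k : bump_algebra (fun x => bump_stress x j k).
Proof.
have bb n := bump_algebra_bump n.
have bc i : bump_algebra (fun x => x 0 i - p 0 i).
  exact/bump_algebra_sub_cst/bump_algebra_coord.
rewrite (_ : (fun x => _) = (fun x => rbump 2 x * (x 0 j - p 0 j) * (x 0 k - p 0 k)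
   + (j == k)%:R * (rbump 0 x + rbump 2 x * (- 1 * \sum_i (x 0 i - p 0 i) * (x 0 i - p 0 i))))).
  apply: bump_algebraD; first exact: (bump_algebraM (bump_algebraM (bb 2) (bc j)) (bc k)).
  apply: bump_algebraM; first exact: bump_algebra_cst.
  apply: bump_algebraD => //; apply: bump_algebraM => //.
  apply: bump_algebraM; first exact: bump_algebra_cst.
  by apply: bump_algebra_sum => i; exact: bump_algebraM.
by apply/funext => x; rewrite mxE mulN1r mulrN.
Qed.

(** In terms of the potential this says that derivatives commute: both parts of the tensor have
    divergence the gradient of the Laplacian. The proof computes it from the derivatives of the
    bumps. *)
Lemma bump_stress_div x j : \sum_k partial k (fun y => bump_stress y j k) x = 0.
Proof.
pose e k : 'rV[R]_3 := delta_mx 0 k; pose y i := x 0 i - p 0 i.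
have sum_e k : \sum_i y i * e k 0 i = y k.
  rewrite (bigD1 k)//= big1 ?addr0 => [|i ik]; rewrite /e mxE eqxx /= ?eqxx ?mulr1//.
  by rewrite (negbTE ik) mulr0.
have P k : partial k (fun y => bump_stress y j k) x =
    (rbump 4 x - 2 * rbump 3 x) * (- 2 * y k) * y j * y k
    + rbump 2 x * (j == k)%:R * y k + rbump 2 x * y j
    + (j == k)%:R * (rbump 2 x * (- 2 * y k)
      - (rbump 4 x - 2 * rbump 3 x) * (- 2 * y k) * sqdist x - rbump 2 x * (2 * y k)).
  have b2 := is_derive_bump 2 x (e k); have b0 := is_derive_bump 0 x (e k).
  rewrite !sum_e mul0r subr0 in b0 b2.
  have dj := is_derive_shifted_coord x (e k) j.
  have dk := is_derive_shifted_coord x (e k) k.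
  have ds := is_derive_sqdist x (e k); rewrite sum_e in ds.
  have ejk : e k 0 j = (j == k)%:R by rewrite /e mxE eqxx eq_sym.
  have ekk : e k 0 k = 1 by rewrite /e mxE !eqxx.
  have d1 := is_deriveM (is_deriveM b2 dj) dk.
  have d2 := is_deriveM (is_derive_cst ((j == k)%:R : R) x (e k)) (is_deriveB b0 (is_deriveM b2 ds)).
  have := is_deriveD d1 d2.
  rewrite (_ : _ + _ = (fun y => bump_stress y j k)).
    rewrite /partial => -[_ ->]; rewrite ejk ekk /GRing.scale /= -/(y j) -/(y k).
    by rewrite mulr0 mulrfctE -/(y j); ring.
  by apply/funext => z; rewrite mxE.
under eq_bigr do rewrite P.
(* Trading y k for y j in the diagonal terms leaves sums of y k ^ 2, which give [sqdist], and of
   constants, whose factor 3 cancels the one in the diagonal part. *)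
have d k : (j == k)%:R * y k = (j == k)%:R * y j by case: eqP => [->|]; rewrite ?mul0r.
transitivity (\sum_k (- 2 * (rbump 4 x - 2 * rbump 3 x) * y j * (y k ^+ 2) + rbump 2 x * y j
   + (j == k)%:R * (y j * (2 * (rbump 4 x - 2 * rbump 3 x) * sqdist x - 3 * rbump 2 x)))).
  apply: eq_bigr => k _.
  have -> : rbump 2 x * (j == k)%:R * y k = rbump 2 x * ((j == k)%:R * y j) by rewrite -d mulrA.
  rewrite [X in _ + X](_ : _ = ((j == k)%:R * y k) * (rbump 2 x * (- 2)
      - (rbump 4 x - 2 * rbump 3 x) * (- 2) * sqdist x - rbump 2 x * 2)); last by ring.
  by rewrite d; ring.
rewrite !big_split /= -mulr_sumr -mulr_suml -/(sqdist x) sumr_const card_ord.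
rewrite (bigD1 j)//= [X in _ + (_ + X)]big1 => [|k /negbTE]; last by rewrite eq_sym => ->; rewrite mul0r.
rewrite eqxx [true%:R]/(1 : R) -[_ *+ 3]mulr_natl mul1r addr0.
move: (rbump 4 x) (rbump 3 x) (rbump 2 x) (sqdist x) (y j) => u v w z a; ring.
Qed.

End Bump.

Lemma integral_derivative_compact_support (R : realType) (F f : R -> R) (T : R) :
  0 < T -> continuous f -> (forall t, is_derive t (1 : R) F (f t)) ->
  (forall t, T <= `|t| -> F t = 0) -> (forall t, T <= `|t| -> f t = 0) ->
  Rintegral (@lebesgue_measure R) setT f = 0.
Proof.
move=> T0 cf dF F0 f0.
have -> : f = f \_ `[- T, T]%classic.
  apply/funext => t; rewrite /patch; case: ifPn => // /negP; rewrite inE /= in_itv /=.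
  by rewrite -ler_norml => /negP; rewrite -ltNge => /ltW/f0.
rewrite -Rintegral_mkcond /Rintegral.
have dFt t : derivable F t 1 by case: (dF t).
have cF : continuous F by move=> t; exact/differentiable_continuous/derivable1_diffP.
rewrite (@continuous_FTC2 _ f F).
- have FT : F T = 0 by apply: F0; rewrite ger0_norm// ltW.
  have FNT : F (- T) = 0 by apply: F0; rewrite normrN ger0_norm// ltW.
  by rewrite FT FNT -EFinB subrr.
- by rewrite gtrN.
- exact: continuous_subspaceT.
- split; first by move=> t _.
  + exact/cvg_at_right_filter/cF.
  + exact/cvg_at_left_filter/cF.
- by move=> t _; rewrite derive1E; case: (dF t).
Qed.

(** * The critical case a + 2 b = 0 *)

Section Counterexample.
Variable R : realType.
Variable M : set 'rV[R]_3.
Hypothesis M_domain : is_domain M.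
Implicit Types (x y v w : 'rV[R]_3).

Variables (p : 'rV[R]_3) (r : R).
Hypothesis r_gt0 : 0 < r.
Hypothesis ball_M : ball p r `<=` M.

(** The Euclidean ball on which the bump lives is contained in the sup-norm ball of the same
    radius. *)
Lemma sqdist_ge x : r <= `|p - x| -> r ^+ 2 - sqdist p x <= 0.
Proof.
move=> h; rewrite subr_le0.
have [i hi] : exists i, r <= `|x 0 i - p 0 i|.
  apply: contrapT => /forallNP no.
  have : `|p - x| < r; last by rewrite ltNge h.
  rewrite (_ : `|p - x| = mx_norm (p - x))// mx_normrE.
  apply/bigmax_ltP; split=> // -[j i] _; rewrite ord1 !mxE /= distrC.
  by rewrite ltNge; apply/negP/no.
rewrite /sqdist (bigD1 i)//= -[leLHS]addr0 lerD ?sumr_ge0// => [|j _]; last exact: sqr_ge0.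
by rewrite -[leRHS]real_normK ?num_real// lerXn2r ?nnegrE// ltW.
Qed.

Lemma bump_far n x : r <= `|p - x| -> rbump p r n x = 0.
Proof. by move=> /sqdist_ge; exact: flat_le0. Qed.

Lemma bump_stress_out x : ~ M x -> bump_stress p r x = 0.
Proof.
move=> nMx; have h : r <= `|p - x|.
  by rewrite leNgt; apply/negP => h; apply: nMx; apply: ball_M; rewrite -ball_normE.
by apply/matrixP => j k; rewrite !mxE !bump_far// !mul0r subr0 mulr0 addr0.
Qed.

Lemma residual_stress_bump : residual_stress M (bump_stress p r).
Proof.
have [oM _ _] := M_domain; split.
- by move=> j k; exists (fun x => bump_stress p r x j k) => //; exact/bump_algebra_smooth/bump_stress_algebra.
- move=> x _ j k; rewrite !mxE [k == j]eq_sym; congr (_ + _); ring.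
- by move=> x _ j; exact: bump_stress_div.
- move=> q N /(boundaryP oM)[_ nMq] _ j.
  by rewrite bump_stress_out// big1// => k _; rewrite mxE mul0r.
Qed.

Lemma bump_stress_centre : bump_stress p r p 0 0 != 0.
Proof.
have s0 : sqdist p p = 0.
  by rewrite /sqdist big1// => i _; rewrite subrr expr0n.
rewrite mxE eqxx subrr !mulr0 add0r mul1r s0 mulr0 subr0 /rbump s0 subr0 /flat.
by rewrite exprn_gt0// expr0 mul1r gt_eqF// expR_gt0.
Qed.

(** This is -1/2 times the derivative in the direction w of the potential behind [bump_stress], so
    [along_derivative] is -1/2 times its second derivative in that direction. *)
Let along w y := rbump p r 0 y * \sum_i w 0 i * (y 0 i - p 0 i).

Let along_derivative w y :=
  rbump p r 2 y * (- 2) * (\sum_i w 0 i * (y 0 i - p 0 i)) ^+ 2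
  + rbump p r 0 y * \sum_i w 0 i ^+ 2.

Let is_derive_along_bump w x (t : R) :
  is_derive t (1 : R) (fun s : R => along w (x + s *: w)) (along_derivative w (x + t *: w)).
Proof.
set y := x + t *: w.
have d0 := is_derive_bump p r 0 y w; rewrite mul0r subr0 in d0.
have dl i := is_deriveZ (w 0 i) (is_derive_shifted_coord p y w i).
have d1 := is_derive_sum dl.
have d2 := is_deriveM d0 d1.
have : is_derive y w (along w) (along_derivative w y).
  move: d2; congr is_derive.
    by apply/funext => z; rewrite mulrfctE fct_sumE.
  rewrite fct_sumE /GRing.scale /= addrC /along_derivative.
  have -> : \sum_i (y 0 i - p 0 i) * w 0 i = \sum_i w 0 i * (y 0 i - p 0 i).
    by apply: eq_bigr => i _; rewrite mulrC.
  by congr (_ + _); rewrite /=; ring.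
move=> /is_derive_line h; apply/is_derive_line; move: h; congr is_derive.
apply/funext => s; congr along.
by rewrite /y [s%:A]mulr1 scalerDl addrCA.
Qed.

Let along_derivative_integral (C : R) x w : w != 0 ->
  Rintegral (@lebesgue_measure R) setT
    (fun t => C * along_derivative w (x + t *: w)) = 0.
Proof.
move=> w0.
have far t : (r + `|p - x|) / `|w| + 1 <= `|t| -> r <= `|p - (x + t *: w)|.
  have nw : 0 < `|w| by rewrite normr_gt0.
  move=> h; have : (r + `|p - x|) / `|w| <= `|t| by lra.
  rewrite ler_pdivrMr// -normrZ => tw.
  have := ler_normB (p - x) (p - (x + t *: w)).
  rewrite (_ : p - x - _ = t *: w); first by lra.
  by apply/rowP => i; rewrite !mxE; ring.
pose F (t : R) := C * along w (x + t *: w).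
pose f (t : R) := C * along_derivative w (x + t *: w).
apply: (integral_derivative_compact_support (F := F) (f := f) (T := (r + `|p - x|) / `|w| + 1)).
- by rewrite ltr_wpDl// divr_ge0// addr_ge0// ltW.
- move=> t; apply/differentiable_continuous/derivable1_diffP.
  have dA : forall y, differentiable (fun y => C * along_derivative w y) y.
    apply: bump_algebra_differentiable; apply: bump_algebraM (bump_algebra_cst _ _ C) _.
    have bs : bump_algebra p r (fun y => \sum_i w 0 i * (y 0 i - p 0 i)).
      apply: bump_algebra_sum => i; apply: bump_algebraM; first exact: bump_algebra_cst.
      exact/bump_algebra_sub_cst/bump_algebra_coord.
    apply: bump_algebraD; apply: bump_algebraM.
    - by apply: bump_algebraM; [exact: bump_algebra_bump|exact: bump_algebra_cst].
    - exact: bump_algebraM.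
    - exact: bump_algebra_bump.
    - exact: bump_algebra_cst.
  by case: (is_derive_along x w t dA).
- move=> t; exact: is_deriveZ.
- by move=> t /far h; rewrite /F /along bump_far// mul0r mulr0.
- by move=> t /far h; rewrite /f /along_derivative !bump_far// !mul0r addr0 mulr0.
Qed.

(** For S = Hess phi - (Laplacian phi) 1 and b = - a / 2 the Laplacians in a S(w,w) + b tr S cancel
    and a times the second derivative of phi along the line remains. The normalizations of
    [bump_stress] (1/4) and [along] (-1/2) turn a into - a / 2 in the constant C. *)
Lemma DR_bump (lambda mu rho nu1 nu2 nu3 nu4 : R) x w :
  nu1 + nu2 + nu3 + nu4 = -1 -> enorm w = 1 ->
  DR M lambda mu rho nu1 nu2 nu3 nu4 (bump_stress p r) x w = 0.
Proof.
move=> nu w1.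
have w0 : w != 0.
  apply/eqP => wE; move: w1; rewrite wE /enorm big1 => [|i _].
    by rewrite sqrtr0 => /esym/eqP; rewrite oner_eq0.
  by rewrite mxE expr0n.
have w2 : \sum_i w 0 i ^+ 2 = 1 by rewrite -enorm_sqr w1 expr1n.
pose C := (rho * vp lambda mu rho ^+ 4)^-1 * (- (1 + nu3 + nu4) / 2).
rewrite /DR; transitivity (Rintegral (@lebesgue_measure R) setT
    (fun t => C * along_derivative w (x + t *: w))).
  congr Rintegral; apply/funext => t; set y := x + t *: w.
  have -> : patch (fun=> 0) M (bump_stress p r) y = bump_stress p r y.
    by rewrite /patch; case: ifPn => // /negP; rewrite inE => /bump_stress_out ->.
  rewrite /DR_integrand /C; move: (rho * _)^-1 => c.
  have [e01 e02 e10] : [/\ ((0 : 'I_3) == 1) = false, ((0 : 'I_3) == 2%:R) = false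
    & ((1 : 'I_3) == 0) = false] by [].
  have [e12 e20 e21] : [/\ ((1 : 'I_3) == 2%:R) = false, ((2%:R : 'I_3) == 0) = false
    & ((2%:R : 'I_3) == 1) = false] by [].
  have qf z : \sum_j \sum_k bump_stress p r z j k * w 0 j * w 0 k =
      rbump p r 2 z * (\sum_i w 0 i * (z 0 i - p 0 i)) ^+ 2
      + (rbump p r 0 z - rbump p r 2 z * sqdist p z).
    rewrite -[X in _ = _ + X]mulr1 -w2 !sum_ord3 ![bump_stress _ _ _ _ _]mxE.
    rewrite !eqxx e01 e02 e10 e12 e20 e21 !mulr0n !mulr1n.
    by move: (rbump p r 2 z) (rbump p r 0 z) (sqdist p z) => b2 b0 N; ring.
  have tr z : \tr (bump_stress p r z) = 3 * rbump p r 0 z - 2 * (rbump p r 2 z * sqdist p z).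
    rewrite /mxtrace sum_ord3 ![bump_stress _ _ _ _ _]mxE !eqxx !mulr1n /sqdist !sum_ord3.
    by move: (rbump p r 2 z) (rbump p r 0 z) => b2 b0; ring.
  rewrite (qf y) tr /along_derivative w2 mulr1.
  have -> : nu1 + nu2 = - (1 + nu3 + nu4) by lra.
  by field.
exact: along_derivative_integral.
Qed.

End Counterexample.

(** * The equivalence *)

Lemma residual_stress0 (R : realType) (M : set 'rV[R]_3) : residual_stress M (fun=> 0).
Proof.
split=> [j k|x _ j k|x _ j|q N _ _ j].
- exists (fun=> 0); last by move=> x _; rewrite mxE.
  exact: bump_algebra_smooth (bump_algebra_cst 0 0 0).
- by rewrite !mxE.
- apply: big1 => k _; rewrite /partial (_ : (fun _ => _) = cst 0) ?derive_cst//.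
  by apply/funext => y; rewrite mxE.
- by apply: big1 => k _; rewrite mxE mul0r.
Qed.

Lemma DR0 (R : realType) (M : set 'rV[R]_3) (lambda mu rho nu1 nu2 nu3 nu4 : R) x w :
  DR M lambda mu rho nu1 nu2 nu3 nu4 (fun=> 0) x w = 0.
Proof.
rewrite /DR; transitivity (Rintegral (@lebesgue_measure R) setT (cst 0)); last first.
  by rewrite Rintegral_cst// mul0r.
congr Rintegral; apply/funext => t; rewrite /patch if_same /DR_integrand mxtrace0.
rewrite mulr0 addr0 big1 ?mulr0// => j _; rewrite big1// => k _.
by rewrite mxE !mul0r.
Qed.

Theorem mainTheorem1 (R : realType) (M : set 'rV[R]_3)
    (M_domain : is_domain M) (M_bounded : bounded_set M)
    (M_convex : convex_set M) (M_smooth : smooth_boundary M)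
    (lambda mu rho nu1 nu2 nu3 nu4 : R)
    (rho_gt0 : 0 < rho) (lambda_mu : 0 < lambda + 2 * mu)
    (nu_neq : 3 * (nu1 + nu2) + 2 * (1 + nu3 + nu4) != 0)
    (nu34_neq : 1 + nu3 + nu4 != 0) :
  (forall S S' : 'rV[R]_3 -> 'M[R]_3,
     residual_stress M S -> residual_stress M S' ->
     (forall x w : 'rV[R]_3, enorm w = 1 ->
        DR M lambda mu rho nu1 nu2 nu3 nu4 S x w
        = DR M lambda mu rho nu1 nu2 nu3 nu4 S' x w) ->
     forall x, closure M x -> S x = S' x)
  <-> nu1 + nu2 + nu3 + nu4 != -1.
Proof.
split=> [injective|nu S S' sS sS' SS'].
  (* In the critical case the bump stress of a ball inside M has the same data as the zero field but
     is nonzero at the centre. *)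
  apply/eqP => nu; have [oM [p Mp] _] := M_domain.
  have /nbhs_ballP[r /= r0 rM] := open_nbhs_nbhs (conj oM Mp).
  have := bump_stress_centre p r0; rewrite (injective (bump_stress p r) (fun=> 0)).
  - by rewrite mxE eqxx.
  - exact: residual_stress_bump.
  - exact: residual_stress0.
  - by move=> x w w1; rewrite DR0 (DR_bump r0 rM).
  - exact: subset_closure.
exact: (residual_stress_determined M_domain M_bounded M_convex M_smooth rho_gt0
  lambda_mu nu34_neq nu sS sS' SS').
Qed.
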